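(* Let $\Gamma$ be a countably infinite group without Kazhdan's property (T). Then $\Gamma$ has property $\mathrm{EMD}$ if and only if $\Gamma$ has property $\mathrm{MD}$.
   Context: A measure preserving action $\bm{a}=\Gamma\curvearrowright^a(X,\mu)$ of a countable group $\Gamma$ is a Borel action $a$ of $\Gamma$ on a standard Borel space $X$ preserving a Borel probability measure $\mu$ on $X$. Weak containment: for $\bm{a}$ on $(X,\mu)$ and $\bm{b}$ on $(Y,\nu)$, $\bm{a}\prec\bm{b}$ means that for every finite measurable partition $A_0,\dots,A_{k-1}$ of $X$, every finite $F\subseteq\Gamma$, and every $\epsilon>0$ there is a measurable partition $B_0,\dots,B_{k-1}$ of $Y$ with $|\mu(\gamma^aA_i\cap A_j)-\nu(\gamma^bB_i\cap B_j)|<\epsilon$ for all $\gamma\in F$ and $i,j<k$. Let $\bm{p}_\Gamma$ denote the action of $\Gamma$ by left translation (via the canonical homomorphism) on its profinite completion, equipped with normalized Haar measure (if the profinite completion is not metrizable, the definition of weak containment is applied verbatim to this probability space). Let $\bm{\iota}$ denote the identity action of $\Gamma$ on a standard non-atomic probability space, and $\bm{\iota}\times\bm{p}_\Gamma$ the product action with product measure. A countably infinite group $\Gamma$ has property $\mathrm{EMD}$ if $\bm{b}\prec\bm{p}_\Gamma$ for every measure preserving action $\bm{b}$ of $\Gamma$; it has property $\mathrm{MD}$ if $\bm{b}\prec\bm{\iota}\times\bm{p}_\Gamma$ for every measure preserving action $\bm{b}$ of $\Gamma$. *)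

(* Defs.v *)
From HB Require Import structures.
From mathcomp Require Import all_boot all_order all_algebra.
From mathcomp Require Import sesquilinear complex.
From mathcomp Require Import all_classical all_reals all_analysis.
Set Implicit Arguments.
Unset Strict Implicit.
Unset Printing Implicit Defensive.
Import Order.TTheory GRing.Theory Num.Theory.
Import numFieldNormedType.Exports.
Local Open Scope classical_set_scope.
Local Open Scope ring_scope.

Definition polish_space (R : realType) (S : completePseudoMetricType R) : Prop :=
  hausdorff_space S /\ exists2 D : set S, countable D & dense D.

Definition standard_borel (R : realType) (d : measure_display)
    (X : measurableType d) : Prop :=
  exists (S : completePseudoMetricType R) (f : X -> S),
    [/\ polish_space S, bijective f &
        forall A : set X, measurable A <-> <<s @open S >> (f @` A)].

Definition non_atomic (R : realType) (d : measure_display)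
    (X : measurableType d) (mu : probability X R) : Prop :=
  forall A, measurable A -> (0 < mu A)%E ->
    exists B, [/\ measurable B, B `<=` A & (0 < mu B < mu A)%E].

(* [G] is countable and discrete, so the action map [G * X -> X] is Borel
   exactly when each [act g] is. *)
Definition measure_preserving_action (R : realType) (G : groupType)
    (d : measure_display) (X : measurableType d) (mu : probability X R)
    (act : G -> X -> X) : Prop :=
  [/\ forall x, act 1%g x = x,
      forall g h x, act (g * h)%g x = act g (act h x),
      forall g, measurable_fun [set: X] (act g) &
      forall g A, measurable A -> mu (act g @^-1` A) = mu A].

(* The pieces are allowed to be empty. *)
Definition measurable_partition (d : measure_display) (X : measurableType d)
    (k : nat) (A : 'I_k -> set X) : Prop :=
  [/\ forall i, measurable (A i), trivIset [set: 'I_k] A &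
      \bigcup_i A i = [set: X]].

Definition weakly_contained (R : realType) (G : groupType)
    (d d' : measure_display) (X : measurableType d) (Y : measurableType d')
    (mu : probability X R) (a : G -> X -> X)
    (nu : probability Y R) (b : G -> Y -> Y) : Prop :=
  forall (k : nat) (A : 'I_k -> set X), measurable_partition A ->
  forall F : set G, finite_set F ->
  forall eps : R, 0 < eps ->
  exists B : 'I_k -> set Y, measurable_partition B /\
    forall g, F g -> forall i j : 'I_k,
      (`| mu ((a g @` A i) `&` A j) - nu ((b g @` B i) `&` B j) | < eps%:E)%E.

Definition lcoset_of (G : groupType) (g : G) (N : set G) : set G :=
  [set (g * n)%g | n in N].

Record fin_index_normal (G : groupType) := FinIndexNormal {
  finN_set :> set G;
  finN1 : finN_set 1%g;
  finNM : forall g h, finN_set g -> finN_set h -> finN_set (g * h)%g;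
  finNV : forall g, finN_set g -> finN_set g^-1%g;
  finNJ : forall g h, finN_set g -> finN_set (g ^ h)%g;
  finN_index : finite_set [set lcoset_of g finN_set | g in [set: G]]
}.

(* The inverse limit of the quotients [G / N]: an element is a compatible
   choice of a coset of every finite-index normal subgroup, the projection
   [G / M -> G / N] (for [M] contained in [N]) sending a coset of [M] to the
   unique coset of [N] that contains it. *)
Record profinite (G : groupType) := Profinite {
  pf_coset :> fin_index_normal G -> set G;
  pf_cosetP : forall N, exists g, pf_coset N = lcoset_of g N;
  pf_compat : forall M N : fin_index_normal G,
    M `<=` N -> pf_coset M `<=` pf_coset N
}.

HB.instance Definition _ (G : groupType) := gen_eqMixin (profinite G).
HB.instance Definition _ (G : groupType) := gen_choiceMixin (profinite G).

Section ProfiniteGroup.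
Variable G : groupType.
Implicit Types (N M : fin_index_normal G) (x y z : profinite G) (g h : G).
Local Open Scope group_scope.

Lemma profinite_eq x y : (forall N, x N = y N) -> x = y.
Proof.
case: x y => [x xP xC] [y yP yC] /= xy.
have {xy}e : x = y by apply/funext => N; exact: xy.
by rewrite {}e in xP xC *; congr Profinite; exact: Prop_irrelevance.
Qed.

Lemma mem_lcoset_of g N h : lcoset_of g N h <-> finN_set N (g^-1 * h).
Proof.
split=> [[n Nn <-]|Nh]; first by rewrite mulKg.
by exists (g^-1 * h) => //; rewrite mulVKg.
Qed.

Lemma lcoset_of_refl g N : lcoset_of g N g.
Proof. by apply/mem_lcoset_of; rewrite mulVg; exact: finN1. Qed.

Lemma lcoset_of_eq g N h : lcoset_of g N h -> lcoset_of g N = lcoset_of h N.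
Proof.
move=> /mem_lcoset_of gh; apply/seteqP; split=> k /mem_lcoset_of Nk;
  apply/mem_lcoset_of.
- suff -> : h^-1 * k = (g^-1 * h)^-1 * (g^-1 * k).
    by apply: finNM => //; exact: finNV.
  by rewrite invgM invgK -mulgA mulVKg.
- suff -> : g^-1 * k = (g^-1 * h) * (h^-1 * k) by exact: finNM.
  by rewrite -mulgA mulVKg.
Qed.

Lemma lcoset_ofM g h N :
  [set a * b | a in lcoset_of g N & b in lcoset_of h N] = lcoset_of (g * h) N.
Proof.
apply/seteqP; split=> [_ [_ [n Nn <-]] [_ [m Nm <-]] <-|_ [n Nn <-]].
- exists (n ^ h * m); first by apply: finNM => //; exact: finNJ.
  by rewrite conjgE !mulgA mulgK.
- exists g; first exact: lcoset_of_refl.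
  by exists (h * n); [exists n|rewrite mulgA].
Qed.

Lemma lcoset_ofV g N : [set a^-1 | a in lcoset_of g N] = lcoset_of g^-1 N.
Proof.
apply/seteqP; split=> [_ [_ [n Nn <-]] <-|_ [n Nn <-]].
- apply/mem_lcoset_of; rewrite invgK invgM.
  suff -> : g * (n^-1 * g^-1) = n^-1 ^ g^-1 by apply: finNJ; exact: finNV.
  by rewrite conjgE invgK.
- exists (n^-1 * g); last by rewrite invgM invgK.
  apply/mem_lcoset_of; rewrite -conjgE.
  by apply: finNJ; exact: finNV.
Qed.

Definition profinite_hom (g : G) : profinite G.
Proof.
exists (fun N => lcoset_of g N); first by move=> N; exists g.
by move=> M N MN _ [n Mn <-]; exists n => //; exact: MN.
Defined.

Definition pf_mul x y : profinite G.
Proof.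
exists (fun N => [set a * b | a in x N & b in y N]).
  move=> N; have [g ->] := pf_cosetP x N; have [h ->] := pf_cosetP y N.
  by exists (g * h); exact: lcoset_ofM.
move=> M N MN _ [a xa [b yb <-]].
by exists a; [exact: pf_compat MN _ xa|exists b => //; exact: pf_compat MN _ yb].
Defined.

Definition pf_inv x : profinite G.
Proof.
exists (fun N => [set a^-1 | a in x N]).
  move=> N; have [g ->] := pf_cosetP x N.
  by exists g^-1; exact: lcoset_ofV.
by move=> M N MN _ [a xa <-]; exists a => //; exact: pf_compat MN _ xa.
Defined.

Lemma pf_mulA : associative pf_mul.
Proof.
move=> x y z; apply: profinite_eq => N /=.
have [g ->] := pf_cosetP x N; have [h ->] := pf_cosetP y N.
by have [k ->] := pf_cosetP z N; rewrite !lcoset_ofM mulgA.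
Qed.

Lemma pf_mul1l : left_id (profinite_hom 1) pf_mul.
Proof.
move=> x; apply: profinite_eq => N /=; have [g ->] := pf_cosetP x N.
by rewrite lcoset_ofM mul1g.
Qed.

Lemma pf_mul1r : right_id (profinite_hom 1) pf_mul.
Proof.
move=> x; apply: profinite_eq => N /=; have [g ->] := pf_cosetP x N.
by rewrite lcoset_ofM mulg1.
Qed.

Lemma pf_mulV : left_inverse (profinite_hom 1) pf_inv pf_mul.
Proof.
move=> x; apply: profinite_eq => N /=; have [g ->] := pf_cosetP x N.
by rewrite lcoset_ofV lcoset_ofM mulVg.
Qed.

Lemma pf_Vmul : right_inverse (profinite_hom 1) pf_inv pf_mul.
Proof.
move=> x; apply: profinite_eq => N /=; have [g ->] := pf_cosetP x N.
by rewrite lcoset_ofV lcoset_ofM mulgV.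
Qed.

End ProfiniteGroup.

HB.instance Definition _ (G : groupType) := isGroup.Build (profinite G)
  (@pf_mulA G) (@pf_mul1l G) (@pf_mul1r G) (@pf_mulV G) (@pf_Vmul G).

HB.instance Definition _ (G : groupType) :=
  isPointed.Build (profinite G) (1%g : profinite G).

(* Inverse limit topology: that induced by the product of the discrete finite
   quotients, with the one-coordinate cylinders as a subbase. *)
HB.instance Definition _ (G : groupType) := isSubBaseTopological.Build
  (profinite G)
  [set C : set (profinite G) | exists (N : fin_index_normal G) (c : set G),
     C = [set x | pf_coset x N = c]]
  id.

Definition profinite_borel (G : groupType) :=
  g_sigma_algebraType (@open (profinite G)).

(* Inner regularity by compact sets matters only when the profinite completion
   is not metrizable; it is part of the usual definition of Haar measure and
   makes the normalized Haar measure unique. *)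
Definition normalized_haar (R : realType) (G : groupType)
    (h : probability (profinite_borel G) R) : Prop :=
  (forall (x : profinite G) (A : set (profinite_borel G)),
     measurable A -> h [set (x * y)%g | y in (A : set (profinite G))] = h A) /\
  (forall A : set (profinite_borel G), measurable A ->
     h A = ereal_sup
       [set h K | K in [set K : set (profinite G) | compact K /\ K `<=` A]]).

Definition profinite_translation (G : groupType) (g : G)
    (x : profinite_borel G) : profinite_borel G :=
  (profinite_hom g * (x : profinite G))%g.

Definition identity_action (G : groupType) (Z : Type) (g : G) (z : Z) : Z := z.

Definition product_action (G : groupType) (X Y : Type)
    (a : G -> X -> X) (b : G -> Y -> Y) (g : G) (p : X * Y) : X * Y :=
  (a g p.1, b g p.2).

Definition property_EMD (R : realType) (G : groupType) : Prop :=
  forall h : probability (profinite_borel G) R, normalized_haar h ->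
  forall (d : measure_display) (X : measurableType d) (mu : probability X R)
         (b : G -> X -> X),
    standard_borel R X -> measure_preserving_action mu b ->
    weakly_contained mu b h (@profinite_translation G).

Definition property_MD (R : realType) (G : groupType) : Prop :=
  forall h : probability (profinite_borel G) R, normalized_haar h ->
  forall (dZ : measure_display) (Z : measurableType dZ) (eta : probability Z R),
    standard_borel R Z -> non_atomic eta ->
  forall (d : measure_display) (X : measurableType d) (mu : probability X R)
         (b : G -> X -> X),
    standard_borel R X -> measure_preserving_action mu b ->
    weakly_contained mu b (eta \x h)%E
      (product_action (@identity_action G Z) (@profinite_translation G)).

Definition hilbert_inner_product (R : realType)
    (H : completeNormedModType R[i]) (dot : {dot H for Num.conj}) : Prop :=
  forall v : H, dot v v = `|v| ^+ 2.

Definition unitary_representation (R : realType) (G : groupType)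
    (H : completeNormedModType R[i]) (dot : {dot H for Num.conj})
    (rho : G -> {linear H -> H}) : Prop :=
  [/\ forall v, rho 1%g v = v,
      forall g h v, rho (g * h)%g v = rho g (rho h v) &
      forall g v w, dot (rho g v) (rho g w) = dot v w].

Definition property_T (R : realType) (G : groupType) : Prop :=
  exists (Q : set G) (eps : R), [/\ finite_set Q, 0 < eps &
    forall (H : completeNormedModType R[i]) (dot : {dot H for Num.conj})
           (rho : G -> {linear H -> H}),
      hilbert_inner_product dot -> unitary_representation dot rho ->
      (exists2 v : H, v != 0 &
         forall g, Q g -> `|rho g v - v| < eps%:C%C * `|v|) ->
      exists2 w : H, w != 0 & forall g, rho g w = w].

(* Main.v *)
(** EMD implies MD because the left translation action is a factor of its
    product with the identity action. Conversely assume MD. Without property (T)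
    there is a unit vector of a unitary representation that is almost invariant
    on a given finite set although its orbit has convex combinations of small
    norm. Independent coins whose conditional means are the sines of the
    Gaussian process attached to the orbit give a measure preserving shift with
    an almost invariant but far from constant average of coins. MD carries it to
    the product of the identity action with the profinite completion; on a
    suitable slice, one of its upper level sets is an almost invariant set of
    Haar measure bounded away from 0 and 1. Almost invariant sets are
    asymptotically independent of every measurable set: the cosets of a normal
    subgroup of finite index are permuted transitively, and unions of cosets
    approximate all measurable sets. Splicing two partitions along such a set
    therefore averages their correlations [h (g E_i `&` E_j)], so the closure of
    the set of correlation vectors of partitions of the profinite completion is
    convex. The correlations of a partition of the product are the integral of
    those of its slices, hence lie in this closure, and MD gives EMD. *)

From HB Require Import structures.
Require Import Defs.
From mathcomp Require Import all_boot all_order all_algebra.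
From mathcomp Require Import sesquilinear complex finmap.
From mathcomp Require Import all_classical all_reals all_analysis.
From mathcomp Require Import measurable_realfun ring lra zify.
Set Implicit Arguments.
Unset Strict Implicit.
Unset Printing Implicit Defensive.
Import Order.TTheory GRing.Theory Num.Theory.
Import numFieldNormedType.Exports.
Local Open Scope classical_set_scope.
Local Open Scope ring_scope.

(** * Expectations of bounded functions *)

(** MD controls the correlations of a partition of the product only on average over the slices, and
    the squared mean of a slice is not linear in them: all the variance of the transferred function
    might sit in the identity factor. The remedy is to bound the squared mean by the second moment
    of an average of translates, which is linear in the correlations. Variance and almost invariance
    then combine into one linear functional, bounded below on the coins by an absolute constant;
    integrated over the slices, it must be positive on one of them. The constant does not depend on
    the finite set or the tolerance, and it survives in the measures of the almost invariant sets;
    hence a single ratio in which partitions can be spliced at any precision. The Gaussian process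
    is never constructed: products of [(1 +- sin) / 2] integrate to explicit combinations of its
    characteristic functional, and only these numbers, nonnegative by positive definiteness, define
    the measure on coins. Many coins are kept over each group element so that their average has
    finite range and yet nearly the correlations of the conditional means. *)

Section Expectation.
Context d (T : measurableType d) (R : realType) (P : probability T R).
Implicit Types (f g : T -> R) (A : set T).

(** This class is closed under the operations used below and makes every integral finite, so that
    expectations can be handled as real numbers. *)
Definition bounded_mfun f : Prop :=
  measurable_fun [set: T] f /\ exists M, forall x, `|f x| <= M.

Definition Ex f : R := \int[P]_x f x.

Definition pr A : R := fine (P A).

Lemma bounded_mfun_cst r : bounded_mfun (fun=> r).
Proof. by split; [exact: measurable_cst|exists `|r|]. Qed.

Lemma bounded_mfunD f g :
  bounded_mfun f -> bounded_mfun g -> bounded_mfun (fun x => f x + g x).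
Proof.
move=> [fm [M fM]] [gm [N gN]]; split; first exact: measurable_funD.
by exists (M + N) => x; rewrite (le_trans (ler_normD _ _)) // lerD.
Qed.

Lemma bounded_mfunM f g :
  bounded_mfun f -> bounded_mfun g -> bounded_mfun (fun x => f x * g x).
Proof.
move=> [fm [M fM]] [gm [N gN]]; split; first exact: measurable_funM.
by exists (M * N) => x; rewrite normrM ler_pM.
Qed.

Lemma bounded_mfunZ r f : bounded_mfun f -> bounded_mfun (fun x => r * f x).
Proof. by apply: bounded_mfunM; exact: bounded_mfun_cst. Qed.

Lemma bounded_mfunB f g :
  bounded_mfun f -> bounded_mfun g -> bounded_mfun (fun x => f x - g x).
Proof.
move=> fb gb; rewrite (_ : (fun x => f x - g x) = (fun x => f x + (-1) * g x)).
  by apply: bounded_mfunD => //; exact: bounded_mfunZ.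
by apply/funext => x; rewrite mulN1r.
Qed.

Lemma bounded_mfun_norm f : bounded_mfun f -> bounded_mfun (fun x => `|f x|).
Proof.
move=> [fm [M fM]]; split; first exact: measurableT_comp.
by exists M => x; rewrite normr_id.
Qed.

Lemma bounded_mfun_sum (I : Type) (s : seq I) (F : I -> T -> R) :
  (forall i, bounded_mfun (F i)) -> bounded_mfun (fun x => \sum_(i <- s) F i x).
Proof.
move=> Fb; elim: s => [|i s ih].
  by under eq_fun do rewrite big_nil; exact: bounded_mfun_cst.
by under eq_fun do rewrite big_cons; exact: bounded_mfunD.
Qed.

Lemma bounded_mfun_indic A : measurable A -> bounded_mfun (\1_A : T -> R).
Proof.
move=> mA; split; first exact: measurable_indic.
by exists 1 => x; rewrite indicE ger0_norm // lern1 leq_b1.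
Qed.

Lemma bounded_mfun_comp (a : T -> T) f :
  measurable_fun [set: T] a -> bounded_mfun f -> bounded_mfun (fun x => f (a x)).
Proof.
move=> am [fm [M fM]]; split; last by exists M.
exact: measurableT_comp.
Qed.

Lemma bounded_mfun_integrable f : bounded_mfun f -> P.-integrable [set: T] (EFin \o f).
Proof.
move=> [fm [M fM]]; apply: measurable_bounded_integrable => //.
  by rewrite (le_lt_trans (probability_le1 _ _)) ?ltry.
exists M; split; first exact: num_real.
by move=> x Mx y _; apply: le_trans (fM y) _; exact: ltW.
Qed.

Lemma ExD f g : bounded_mfun f -> bounded_mfun g ->
  Ex (fun x => f x + g x) = Ex f + Ex g.
Proof. by move=> fb gb; rewrite /Ex RintegralD //; exact: bounded_mfun_integrable. Qed.

Lemma ExB f g : bounded_mfun f -> bounded_mfun g ->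
  Ex (fun x => f x - g x) = Ex f - Ex g.
Proof. by move=> fb gb; rewrite /Ex RintegralB //; exact: bounded_mfun_integrable. Qed.

Lemma ExZ r f : bounded_mfun f -> Ex (fun x => r * f x) = r * Ex f.
Proof. by move=> fb; rewrite /Ex RintegralZl //; exact: bounded_mfun_integrable. Qed.

Lemma Ex_cst r : Ex (fun=> r) = r.
Proof.
transitivity (r * fine (P [set: T])); last by rewrite probability_setT mulr1.
exact: Rintegral_cst.
Qed.

Lemma Ex_sum (I : Type) (s : seq I) (F : I -> T -> R) :
  (forall i, bounded_mfun (F i)) ->
  Ex (fun x => \sum_(i <- s) F i x) = \sum_(i <- s) Ex (F i).
Proof.
move=> Fb; elim: s => [|i s ih].
  by under eq_fun do rewrite big_nil; rewrite big_nil Ex_cst.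
under eq_fun do rewrite big_cons.
by rewrite ExD // ?big_cons ?ih //; exact: bounded_mfun_sum.
Qed.

Lemma Ex_indic A : measurable A -> Ex \1_A = pr A.
Proof. by move=> mA; rewrite /Ex /Rintegral integral_indic // setIT. Qed.

Lemma Ex_le f g : bounded_mfun f -> bounded_mfun g ->
  (forall x, f x <= g x) -> Ex f <= Ex g.
Proof.
move=> fb gb fg; apply: le_Rintegral => //; exact: bounded_mfun_integrable.
Qed.

Lemma Ex_ge0 f : (forall x, 0 <= f x) -> 0 <= Ex f.
Proof. by move=> f0; apply: Rintegral_ge0. Qed.

Lemma Ex_sqr f : bounded_mfun f -> Ex f ^+ 2 <= Ex (fun x => f x ^+ 2).
Proof.
move=> fb; have f2 : bounded_mfun (fun x => f x ^+ 2).
  by under eq_fun do rewrite expr2; exact: bounded_mfunM.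
have : 0 <= Ex (fun x => (f x - Ex f) ^+ 2).
  by apply: Ex_ge0 => x; exact: sqr_ge0.
rewrite (_ : (fun x => _) = (fun x => f x ^+ 2 + (- (2 * Ex f) * f x + Ex f ^+ 2))).
  have b1 : bounded_mfun (fun x => - (2 * Ex f) * f x) by exact: bounded_mfunZ.
  have b2 : bounded_mfun (fun=> Ex f ^+ 2) by exact: bounded_mfun_cst.
  rewrite (ExD f2 (bounded_mfunD b1 b2)) (ExD b1 b2) ExZ // Ex_cst; lra.
by apply/funext => x; ring.
Qed.

Lemma prE A : measurable A -> P A = (pr A)%:E.
Proof. by move=> mA; rewrite /pr fineK // fin_num_measure. Qed.

Lemma pr_ge0 A : 0 <= pr A.
Proof. by rewrite /pr fine_ge0. Qed.

Lemma pr_le1 A : measurable A -> pr A <= 1.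
Proof. by move=> mA; rewrite -lee_fin -prE // probability_le1. Qed.

Lemma prT : pr [set: T] = 1.
Proof. by rewrite /pr probability_setT. Qed.

Lemma pr0 : pr set0 = 0.
Proof. by rewrite /pr measure0. Qed.

Lemma le_pr A A' : measurable A -> measurable A' -> A `<=` A' -> pr A <= pr A'.
Proof. by move=> mA mA' AA'; rewrite -lee_fin -!prE // le_measure // inE. Qed.

Lemma prU A A' : measurable A -> measurable A' -> A `&` A' = set0 ->
  pr (A `|` A') = pr A + pr A'.
Proof.
move=> mA mA' AA'; apply: EFin_inj; rewrite EFinD -!prE //; last exact: measurableU.
by rewrite measureU.
Qed.

Lemma prID A C : measurable A -> measurable C -> pr A = pr (C `&` A) + pr (~` C `&` A).
Proof.
move=> mA mC; rewrite -prU.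
- by rewrite -setIUl setUv setTI.
- exact: measurableI.
- by apply: measurableI => //; exact: measurableC.
- by rewrite setIACA setICr set0I.
Qed.

Lemma prC A : measurable A -> pr (~` A) = 1 - pr A.
Proof.
move=> mA; have := prID measurableT mA; rewrite prT !setIT => ->; lra.
Qed.

Lemma pr_bigcup (I : finType) (F : I -> set T) : (forall i, measurable (F i)) ->
  trivIset [set: I] F -> pr (\bigcup_i F i) = \sum_i pr (F i).
Proof.
move=> mF tF.
rewrite -Ex_indic; last by apply: fin_bigcup_measurable.
under [RHS]eq_bigr => i _ do rewrite -Ex_indic //.
rewrite -(Ex_sum _ (F := fun i => \1_(F i))); last by move=> i; exact: bounded_mfun_indic.
congr Ex; apply/funext => x; rewrite indicE.
case: (pselect ((\bigcup_i F i) x)) => [/[dup] xF [i _ Fix]|xF].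
  rewrite mem_set // (bigD1 i) //= indicE mem_set // big1 ?addr0 // => j ji.
  rewrite indicE memNset // => Fjx; move/eqP: ji; apply.
  by apply: (tF j i) => //; exists x.
rewrite memNset // big1 // => i _; rewrite indicE memNset // => Fix.
by apply: xF; exists i.
Qed.

End Expectation.

(** * Almost invariant orbits with small means *)

Section HilbertReal.
Variables (R : realType) (H : completeNormedModType R[i])
  (dot : {dot H for Num.conj}).
Hypothesis dotE : hilbert_inner_product dot.

(** A Gaussian process needs a real covariance. The real part makes [H] a real Hilbert space with
    the same norm, on which unitary operators act orthogonally. *)
Definition rdot (a b : H) : R := complex.Re (dot a b).

Lemma Re_conj (x : R[i]) : complex.Re (Num.conj x) = complex.Re x.
Proof. by apply: (@complexI R); rewrite !complexRe Re_conj. Qed.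

Lemma rdotC a b : rdot a b = rdot b a.
Proof. by rewrite /rdot hermC expr0 mul1r Re_conj. Qed.

Lemma rdotDl a b c : rdot (a + b) c = rdot a c + rdot b c.
Proof. by rewrite /rdot linearDl raddfD. Qed.

Lemma rdotNl a c : rdot (- a) c = - rdot a c.
Proof. by rewrite /rdot linearNl raddfN. Qed.

Lemma rdotZl (r : R) a c : rdot (r%:C%C *: a) c = r * rdot a c.
Proof.
rewrite /rdot linearZl_LR /=; case: (dot a c) => x y.
by rewrite /= mul0r subr0.
Qed.

Lemma rdot0l c : rdot 0 c = 0.
Proof. by rewrite /rdot linear0l. Qed.

(** The norm over [R[i]] takes its values in [R[i]]; being nonnegative, they are recovered from
    their real parts. *)
Definition rnorm (a : H) : R := complex.Re `|a|.

Lemma rnormE a : `|a| = (rnorm a)%:C%C.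
Proof.
have /ger0_Im : 0 <= `|a| by exact: normr_ge0.
by rewrite /rnorm; case: `|a| => x y /= ->.
Qed.

Lemma rnorm_ge0 a : 0 <= rnorm a.
Proof. by rewrite -ler0c -rnormE normr_ge0. Qed.

Lemma rdotE a : rdot a a = rnorm a ^+ 2.
Proof.
by rewrite /rdot dotE rnormE -[_ ^+ 2](rmorphXn (real_complex R)).
Qed.

Lemma rnormD a b : rnorm (a + b) <= rnorm a + rnorm b.
Proof. by rewrite -lecR rmorphD /= -!rnormE ler_normD. Qed.

Lemma rnorm_eq0 a : rnorm a = 0 -> a = 0.
Proof. by move=> a0; apply/eqP; rewrite -normr_eq0 rnormE a0. Qed.

Lemma rnormN a : rnorm (- a) = rnorm a.
Proof. by rewrite /rnorm normrN. Qed.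

Lemma rnorm_complete (w : nat -> H) :
  (forall e, 0 < e -> exists n0, forall n m, (n0 <= n)%N -> (n0 <= m)%N ->
     rnorm (w n - w m) < e) ->
  exists l, forall e, 0 < e -> exists n0, forall n, (n0 <= n)%N ->
     rnorm (w n - l) < e.
Proof.
move=> hw.
have cw : cvg (w @ \oo).
  apply/cauchy_cvgP/cauchy_exP => e e0.
  have e0' : 0 < complex.Re e by move: e0; rewrite ltcE => /andP[].
  have ee : e = (complex.Re e)%:C%C.
    by move: e0; rewrite ltcE => /andP[/eqP]; case: (e) => x y /= ->.
  have [n0 hn0] := hw _ e0'.
  exists (w n0); exists n0 => // n /= n0n.
  by rewrite -ball_normE /ball_ /= ee rnormE ltcR hn0.
exists (lim (w @ \oo)) => e e0.
have e0' : 0 < e%:C%C by rewrite ltcR.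
have /cvgr_dist_lt /(_ _ e0') [n0 _ hn0] := cw.
exists n0 => n n0n; have := hn0 n n0n.
by rewrite /= rnormE ltcR -rnormN opprB.
Qed.

Lemma rdotBB a b : rnorm (a - b) ^+ 2 =
  rdot a a + rdot b b - 2 * rdot a b.
Proof.
rewrite -rdotE rdotDl rdotNl [rdot a _]rdotC [rdot b (a - b)]rdotC.
rewrite !rdotDl !rdotNl (rdotC b a); ring.
Qed.

Lemma parallelogram a b : rnorm (a - b) ^+ 2 =
  2 * rdot a a + 2 * rdot b b - rdot (a + b) (a + b).
Proof.
rewrite rdotBB rdotDl [rdot a (a + b)]rdotC [rdot b (a + b)]rdotC !rdotDl.
rewrite (rdotC b a); ring.
Qed.

End HilbertReal.

(** * Convex combinations of an orbit *)

Section MinimalNorm.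
Variables (R : realType) (G : groupType) (H : completeNormedModType R[i])
  (dot : {dot H for Num.conj}) (rho : G -> {linear H -> H}).
Hypotheses (dotE : hilbert_inner_product dot)
  (rhoU : unitary_representation dot rho).

(** Nonnegativity is stated by index because membership in [s] would require decidable equality on
    [T]. *)
Definition convex_weights (T : Type) (s : seq (R * T)) : Prop :=
  (forall i, (i < size s)%N -> 0 <= nth 0 (map fst s) i) /\
  \sum_(p <- s) p.1 = 1.

Definition orbit_comb (v : H) (s : seq (R * G)) : H :=
  \sum_(p <- s) (p.1)%:C%C *: rho p.2 v.

Lemma rdot_suml (T : Type) (s : seq T) (f : T -> H) c :
  rdot dot (\sum_(p <- s) f p) c = \sum_(p <- s) rdot dot (f p) c.
Proof.
elim: s => [|p s ih]; first by rewrite !big_nil rdot0l.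
by rewrite !big_cons rdotDl ih.
Qed.

Lemma rdot_comb (T : Type) (s : seq (R * T)) (f : T -> H) :
  let w := \sum_(p <- s) (p.1)%:C%C *: f p.2 in
  rdot dot w w =
  \sum_(p <- s) \sum_(q <- s) p.1 * q.1 * rdot dot (f p.2) (f q.2).
Proof.
rewrite /= rdot_suml; apply: eq_bigr => p _.
rewrite rdotC rdot_suml; apply: eq_bigr => q _.
by rewrite rdotZl rdotC rdotZl; ring.
Qed.

Lemma rho_rdot g a b : rdot dot (rho g a) (rho g b) = rdot dot a b.
Proof. by case: rhoU => _ _ h; rewrite /rdot h. Qed.

Lemma rho_rnorm g a : rnorm (rho g a) = rnorm a.
Proof.
apply/eqP; rewrite -(@eqrXn2 _ 2%N) ?rnorm_ge0 //.
by rewrite -!(rdotE dotE) rho_rdot.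
Qed.

(** Concatenating the two combinations with halved weights gives their midpoint; the factor 4 comes
    from [a + b] being twice the midpoint. *)
Lemma orbit_comb_mid v s t : convex_weights s -> convex_weights t ->
  exists u, convex_weights u /\
    rdot dot (orbit_comb v s + orbit_comb v t) (orbit_comb v s + orbit_comb v t)
    = 4 * rdot dot (orbit_comb v u) (orbit_comb v u).
Proof.
move=> [s0 s1] [t0 t1]; exists [seq (2^-1 * p.1, p.2) | p <- s ++ t]; split.
  split.
    move=> i; rewrite size_map -map_comp => hi.
    rewrite (_ : [seq _ | p <- _] = [seq 2^-1 * x | x <- map fst (s ++ t)]);
      last by rewrite -map_comp; apply: eq_map.
    rewrite (nth_map 0) ?size_map // mulr_ge0 // map_cat nth_cat size_map.
    case: ltnP => his; first exact: s0.
    by apply: t0; rewrite ltn_subLR // -size_cat.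
  by rewrite big_map -mulr_sumr big_cat /= s1 t1; lra.
have -> : orbit_comb v [seq (2^-1 * p.1, p.2) | p <- s ++ t] =
    (2^-1)%:C%C *: (orbit_comb v s + orbit_comb v t).
  rewrite /orbit_comb -big_cat /= big_map scaler_sumr; apply: eq_bigr => p _.
  by rewrite scalerA rmorphM.
by rewrite rdotZl rdotC rdotZl; field.
Qed.

Lemma orbit_comb_transl v g s : convex_weights s ->
  exists t, convex_weights t /\ orbit_comb v t = rho g (orbit_comb v s).
Proof.
move=> [s0 s1]; exists [seq (p.1, (g * p.2)%g) | p <- s]; split.
  split; last by rewrite big_map.
  by move=> i; rewrite size_map -map_comp; exact: s0.
rewrite /orbit_comb big_map raddf_sum; apply: eq_bigr => p _ /=.
by case: rhoU => _ rM _; rewrite linearZ /= rM.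
Qed.

(** Otherwise the closed convex hull of the orbit stays away from 0. By the parallelogram law its
    element of least norm is unique, hence fixed by [G], and it is a nonzero invariant vector. *)
Lemma orbit_comb_small (v : H) :
  (forall w, w != 0 -> ~ forall g, rho g w = w) ->
  forall d : R, 0 < d -> exists s, convex_weights s /\
    rdot dot (orbit_comb v s) (orbit_comb v s) < d.
Proof.
move=> noinv d d0; apply: contrapT => /forallNP hs.
have {}hs s : convex_weights s -> d <= rdot dot (orbit_comb v s) (orbit_comb v s).
  by move=> sc; rewrite leNgt; apply/negP => sd; apply: (hs s).
pose E := [set rdot dot (orbit_comb v s) (orbit_comb v s) | s in @convex_weights G].
have E0 : E !=set0.
  exists (rdot dot (orbit_comb v [:: (1, 1%g)]) (orbit_comb v [:: (1, 1%g)])).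
  exists [:: (1, 1%g)] => //; split; last by rewrite big_seq1.
  by case => [|[|]] //= _; rewrite ler01.
have Elb : lbound E d by move=> _ [s /hs sd <-].
have Einf : has_inf E by split => //; exists d.
have dE : d <= inf E by exact: lb_le_inf.
have infE s : convex_weights s -> inf E <= rdot dot (orbit_comb v s) (orbit_comb v s).
  by move=> sc; apply: ge_inf; [exists d|exists s].
have /choice[s hsn] : forall n : nat, exists s, convex_weights s /\
    rdot dot (orbit_comb v s) (orbit_comb v s) < inf E + n.+1%:R^-1.
  move=> n; have [] := @inf_adherent _ E n.+1%:R^-1 _ Einf; first by rewrite invr_gt0.
  by move=> _ [s sc <-] h; exists s.
(* The midpoint of two nearly minimal combinations has squared norm at least [inf E], so the
   parallelogram law forces them to be close. *)
have near a b e : convex_weights a -> convex_weights b ->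
    rdot dot (orbit_comb v a) (orbit_comb v a) < inf E + e ->
    rdot dot (orbit_comb v b) (orbit_comb v b) < inf E + e ->
    rnorm (orbit_comb v a - orbit_comb v b) ^+ 2 <= 4 * e.
  move=> ac bc ha hb; rewrite (parallelogram dotE).
  have [u [uc ->]] := orbit_comb_mid v ac bc.
  have := infE _ uc; lra.
have inv_small (e : R) : 0 < e -> exists n0, forall n, (n0 <= n)%N -> n.+1%:R^-1 < e.
  move=> e0; have [n0 _ h] := near_infty_natSinv_lt (PosNum e0).
  by exists n0 => n /h.
have [w hw] : exists l, forall e, 0 < e -> exists n0, forall n, (n0 <= n)%N ->
    rnorm (orbit_comb v (s n) - l) < e.
  apply: rnorm_complete => e e0.
  have [n0 hn0] := inv_small (e ^+ 2 / 5) ltac:(by rewrite divr_gt0 ?exprn_gt0).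
  exists n0 => n m n0n n0m; rewrite -(@ltr_pXn2r _ 2%N) ?nnegrE ?rnorm_ge0 ?ltW //.
  have [sn hn] := hsn n; have [sm hm] := hsn m.
  apply: le_lt_trans (near _ _ (e ^+ 2 / 5) sn sm _ _) _.
  - by apply: lt_trans hn _; rewrite ltrD2l hn0.
  - by apply: lt_trans hm _; rewrite ltrD2l hn0.
  - have : 0 < e ^+ 2 by rewrite exprn_gt0.
    lra.
have w0 : w != 0.
  (* A norm below both 1 and [d] has its square below [d]. *)
  apply/eqP => w0; have [n0 /(_ n0 (leqnn _))] := hw (Num.min d 1)
    ltac:(by rewrite lt_min d0 ltr01).
  rewrite w0 subr0 lt_min => /andP[h1 h2].
  have := hs _ (hsn n0).1; rewrite (rdotE dotE) expr2 => h3.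
  have := rnorm_ge0 (orbit_comb v (s n0)); nra.
apply: (noinv w w0) => g; apply/eqP; rewrite -subr_eq0; apply/eqP/rnorm_eq0.
apply: le_anti; rewrite rnorm_ge0 andbT leNgt; apply/negP => e0.
set e := rnorm _ in e0.
(* With [e / 4] for the distance to [w] and [e ^+ 2 / 64] for the excess over the infimum, [e] would
   be less than three times [e / 4]. *)
have [n0 h0] := hw (e / 4) ltac:(by rewrite divr_gt0).
have [n1 h1] := inv_small (e ^+ 2 / 64) ltac:(by rewrite divr_gt0 ?exprn_gt0).
pose n := maxn n0 n1.
have {}h0 := h0 n (leq_maxl _ _); have {}h1 := h1 n (leq_maxr _ _).
have [sn hn] := hsn n.
have [t [tc tE]] := orbit_comb_transl v g sn.
have ht : rdot dot (orbit_comb v t) (orbit_comb v t) < inf E + n.+1%:R^-1.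
  by rewrite tE rho_rdot.
have := near _ _ _ tc sn ht hn.
have -> : orbit_comb v t - orbit_comb v (s n) =
    (rho g w - w) - (rho g (w - orbit_comb v (s n)) + (orbit_comb v (s n) - w)).
  rewrite tE linearB /=; set A := rho g w; set B := rho g _; set C := orbit_comb _ _.
  by rewrite opprD !opprB addrA [A - w + _]addrC [B - A + (A - w)]addrA subrK addrA subrK.
move=> hh.
have : e <= rnorm ((rho g w - w) - (rho g (w - orbit_comb v (s n)) +
      (orbit_comb v (s n) - w))) +
    (rnorm (w - orbit_comb v (s n)) + rnorm (orbit_comb v (s n) - w)).
  rewrite -(rho_rnorm g (w - _)).
  apply: le_trans (lerD (lexx _) (rnormD _ _)).
  by apply: le_trans (rnormD _ _); rewrite subrK.
rewrite -(rnormN (w - _)) opprB.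
set x := rnorm _ in hh *; have := rnorm_ge0 (orbit_comb v (s n) - w).
have : 0 <= x by exact: rnorm_ge0.
move=> x0 y0 h2.
have xe : e / 2 < x by lra.
have hx : e / 2 * (e / 2) <= x * x.
  by apply: ler_pM; rewrite ?ltW // divr_gt0.
have ee : 0 < e * e by rewrite mulr_gt0.
rewrite !expr2 in hh h1.
by move: (n.+1%:R^-1) hh h1 => k; lra.
Qed.

End MinimalNorm.

(* The orbit of a unit vector, seen through the real part of its inner product. *)
Lemma almost_invariant_orbit (R : realType) (G : groupType) :
  ~ property_T R G ->
  forall (Q : set G) (e : R), finite_set Q -> 0 < e ->
  exists (V : zmodType) (B : V -> V -> R) (rho : G -> V -> V) (v : V),
  [/\ (forall a b, B a b = B b a),
      (forall a b c, B (a + b) c = B a c + B b c),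
      (forall (T : Type) (f : T -> V) (s : seq (R * T)),
         0 <= \sum_(p <- s) \sum_(q <- s) p.1 * q.1 * B (f p.2) (f q.2)) &
      [/\ (forall g h a, rho (g * h)%g a = rho g (rho h a)),
          (forall g a b, rho g (a + b) = rho g a + rho g b) &
          forall g a b, B (rho g a) (rho g b) = B a b]] /\
  [/\ rho 1%g v = v, B v v = 1,
      (forall g, Q g -> 1 - B (rho g v) v <= e) &
      forall d, 0 < d -> exists s, convex_weights s /\
        \sum_(p <- s) \sum_(q <- s) p.1 * q.1 * B (rho p.2 v) (rho q.2 v) < d].
Proof.
move=> nT Q e Qfin e0.
have [H [dot [rho [dotE rhoU [v0 v00 hv] noinv]]]] :
  exists (H : completeNormedModType R[i]) (dot : {dot H for Num.conj})
    (rho : G -> {linear H -> H}),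
  [/\ hilbert_inner_product dot, unitary_representation dot rho,
     (exists2 v : H, v != 0 &
         forall g, Q g -> `|rho g v - v| < (Num.min 1 e)%:C%C * `|v|) &
     forall w : H, w != 0 -> ~ forall g, rho g w = w].
  (* The cap at 1 is for squaring: for the unit vector [v], the squared displacement is
     [2 - 2 * B (rho g v) v], and it stays below [e]. *)
  apply: contrapT => h; apply: nT; exists Q, (Num.min 1 e); split => //.
    by rewrite lt_min ltr01.
  move=> H dot rho dotE rhoU hv; apply: contrapT => hw; apply: h.
  exists H, dot, rho; split => // w w0 gw; apply: hw; by exists w.
have nv0 : 0 < rnorm v0.
  rewrite lt_neqAle rnorm_ge0 andbT eq_sym; apply: contra v00 => /eqP.
  by move=> /rnorm_eq0 ->.
pose v := ((rnorm v0)^-1)%:C%C *: v0.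
have vv : rdot dot v v = 1.
  by rewrite rdotZl rdotC rdotZl rdotE //; field; rewrite gt_eqF.
exists H, (rdot dot), (fun g => rho g), v; split; split.
- exact: rdotC.
- exact: rdotDl.
- by move=> T f s; rewrite -(rdot_comb dot s f) /= (rdotE dotE) exprn_ge0 // rnorm_ge0.
- split=> [g h a|g a b|g a b]; [by case: rhoU => _ -> _|by rewrite linearD|].
  exact: rho_rdot.
- by case: rhoU => -> _ _.
- exact: vv.
- move=> g Qg.
  have := hv g Qg.
  rewrite !rnormE -rmorphM ltcR => h.
  have : rnorm (rho g v - v) < Num.min 1 e.
    rewrite (_ : rho g v - v = ((rnorm v0)^-1)%:C%C *: (rho g v0 - v0)); last first.
      by rewrite /v linearZ /= scalerBr.
    have -> : rnorm (((rnorm v0)^-1)%:C%C *: (rho g v0 - v0)) =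
        (rnorm v0)^-1 * rnorm (rho g v0 - v0).
      apply: (@complexI R); rewrite -rnormE normrZ rnormE rmorphM; congr (_ * _).
      by rewrite ger0_norm // ler0c invr_ge0 ltW.
    by rewrite mulrC ltr_pdivrMr.
  rewrite lt_min => /andP[h1 h2].
  have := rdotBB dotE (rho g v) v; rewrite (rho_rdot rhoU) vv.
  have := rnorm_ge0 (rho g v - v); nra.
- move=> d d0; have [s [sc hs]] := orbit_comb_small dotE rhoU v noinv d0.
  by exists s; split => //; rewrite -(rdot_comb dot s (fun g => rho g v)).
Qed.

(** * Positive kernels and sign weights *)

Section PositiveKernels.
Variable R : realType.

Definition psd (T : Type) (K : T -> T -> R) : Prop := forall s : seq (R * T),
  0 <= \sum_(p <- s) \sum_(q <- s) p.1 * q.1 * K p.2 q.2.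

Lemma psd_comp (T U : Type) (f : U -> T) (K : T -> T -> R) :
  psd K -> psd (fun x y => K (f x) (f y)).
Proof.
move=> Kpsd s; have := Kpsd [seq (p.1, f p.2) | p <- s].
by rewrite big_map; under eq_bigr do rewrite big_map.
Qed.

Lemma psd_diag_ge0 (T : Type) (K : T -> T -> R) x : psd K -> 0 <= K x x.
Proof. by move=> /(_ [:: (1, x)]); rewrite !big_seq1 /= !mul1r. Qed.

Lemma psd_diag0 (T : Type) (K : T -> T -> R) x y :
  (forall a b, K a b = K b a) -> psd K -> K x x = 0 -> K x y = 0.
Proof.
move=> Kc Kpsd Kx0; have Kyy := psd_diag_ge0 y Kpsd.
have h l : 0 <= 2 * l * K x y + K y y.
  have := Kpsd [:: (l, x); (1, y)].
  by rewrite !big_cons !big_nil /= Kx0 (Kc y x); lra.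
apply: contrapT => /eqP Kxy0.
have := h (- (K y y + 1) / (2 * K x y)).
rewrite (_ : 2 * _ * _ = - (K y y + 1)); first lra.
by field.
Qed.

(** Test [K] on [s] with the point [t] adjoined, its weight [- S / K t t] minimizing the form. If
    [K t t = 0], then [0^-1 = 0] makes the correction vanish. *)
Lemma psd_schur_complement (T : Type) (K : T -> T -> R) t :
  (forall a b, K a b = K b a) -> psd K ->
  psd (fun x y => K x y - K t x * K t y / K t t).
Proof.
move=> Kc Kpsd s; have [Kt0|Kt0] := eqVneq (K t t) 0.
  under eq_bigr do under eq_bigr do rewrite Kt0 invr0 mulr0 subr0.
  exact: Kpsd.
pose S := \sum_(p <- s) p.1 * K t p.2.
pose c := S / K t t.
have := Kpsd ((- c, t) :: s).
rewrite big_cons big_cons /=; under [X in _ <= _ + X]eq_bigr do rewrite big_cons /=.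
rewrite big_split /=.
have -> : \sum_(j <- s) - c * j.1 * K t j.2 = - c * (c * K t t).
  rewrite /c divfK // mulr_sumr; apply: eq_bigr => p _; ring.
have -> : \sum_(i <- s) i.1 * - c * K i.2 t = - c * (c * K t t).
  rewrite /c divfK // mulr_sumr; apply: eq_bigr => p _; rewrite (Kc p.2); ring.
have -> : \sum_(p <- s) \sum_(q <- s) p.1 * q.1 * (K p.2 q.2 - K t p.2 * K t q.2 / K t t) =
   \sum_(p <- s) \sum_(q <- s) p.1 * q.1 * K p.2 q.2 - c ^+ 2 * K t t.
  have -> : c ^+ 2 * K t t = \sum_(p <- s) \sum_(q <- s) p.1 * q.1 * (K t p.2 * K t q.2 / K t t).
    rewrite /c.
    rewrite (_ : (S / K t t) ^+ 2 * K t t = S * (S / K t t)); last by field.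
    rewrite [in LHS]mulr_suml; apply: eq_bigr => p _.
    rewrite [S / _]mulr_suml mulr_sumr; apply: eq_bigr => q _; field; exact: Kt0.
  rewrite -sumrB; apply: eq_bigr => p _; rewrite -sumrB; apply: eq_bigr => q _.
  ring.
set X := \sum_(_ <- _) _; lra.
Qed.

(** Cholesky factorization: split off the rank-one kernel of the last index and recurse on the Schur
    complement. The recursive factors are cut off at [n], where the complement vanishes but the
    induction hypothesis says nothing. *)
Lemma psd_factor n (K : nat -> nat -> R) :
  (forall a b, K a b = K b a) -> psd K ->
  exists phi : seq (nat -> R), forall i j, (i < n)%N -> (j < n)%N ->
    K i j = \sum_(f <- phi) f i * f j.
Proof.
elim: n K => [|n ih] K Kc Kpsd; first by exists [::].
have [||phi hphi] := ih (fun x y => K x y - K n x * K n y / K n n).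
- by move=> a b; rewrite Kc; ring.
- exact: psd_schur_complement.
exists ((fun i => K n i / Num.sqrt (K n n)) ::
  [seq (fun i => if (i < n)%N then f i else 0) | f <- phi]) => i j.
rewrite !ltnS big_cons big_map => hi hj.
have -> : K n i / Num.sqrt (K n n) * (K n j / Num.sqrt (K n n)) = K n i * K n j / K n n.
  have {3}-> : K n n = Num.sqrt (K n n) * Num.sqrt (K n n).
    by rewrite -expr2 sqr_sqrtr // psd_diag_ge0.
  by rewrite invfM mulrACA.
have Kn0 y : K n y - K n n * K n y / K n n = 0.
  have [Kn0|Kn0] := eqVneq (K n n) 0.
    by rewrite (psd_diag0 _ Kc Kpsd Kn0) Kn0; ring.
  by field.
move: hi hj; rewrite (leq_eqVlt i) (leq_eqVlt j) => /orP[/eqP->|hi] /orP[/eqP->|hj].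
- rewrite big1 ?addr0; first by have := Kn0 n; lra.
  by move=> f _; rewrite ltnn mul0r.
- rewrite big1 ?addr0; first by have := Kn0 j; lra.
  by move=> f _; rewrite ltnn mul0r.
- rewrite big1 ?addr0; first by have := Kn0 i; rewrite (Kc i); lra.
  by move=> f _; rewrite ltnn mulr0.
- under eq_bigr do rewrite hi hj.
  by rewrite -hphi //; lra.
Qed.

(** Schur product theorem: on the finitely many points of [s], [L] is a sum of rank-one kernels, and
    multiplying [K] by such a kernel only changes the weights. *)
Lemma psd_mul (T : Type) (K L : T -> T -> R) :
  (forall a b, L a b = L b a) -> psd K -> psd L -> psd (fun x y => K x y * L x y).
Proof.
move=> Lc Kpsd Lpsd [|p0 s0]; first by rewrite big_nil.
set s := p0 :: s0.
have [phi hphi] := @psd_factor (size s) (fun i j => L (nth p0 s i).2 (nth p0 s j).2)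
  (fun _ _ => Lc _ _) (psd_comp _ Lpsd).
rewrite (big_nth p0) big_mkord.
rewrite (_ : \sum_(i < _) _ = \sum_(f <- phi) \sum_(i < size s) \sum_(j < size s)
   ((nth p0 s i).1 * f i) * ((nth p0 s j).1 * f j) * K (nth p0 s i).2 (nth p0 s j).2).
  apply: sumr_ge0 => f _.
  have := Kpsd [seq ((nth p0 s i).1 * f i, (nth p0 s i).2) | i : 'I_(size s)].
  by rewrite big_image /=; under eq_bigr do rewrite big_image /=.
rewrite [RHS]exchange_big; apply: eq_bigr => i _ /=.
rewrite [RHS]exchange_big (big_nth p0) big_mkord; apply: eq_bigr => j _ /=.
rewrite hphi // !mulr_sumr; apply: eq_bigr => f _; ring.
Qed.

Lemma cvg_sumr (T : Type) (s : seq T) (f : T -> nat -> R) (l : T -> R) :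
  (forall p, f p n @[n --> \oo] --> l p) ->
  \sum_(p <- s) f p n @[n --> \oo] --> \sum_(p <- s) l p.
Proof.
move=> fl; elim: s => [|p s ih].
  by under eq_fun do rewrite big_nil; rewrite big_nil; exact: cvg_cst.
under eq_fun do rewrite big_cons; rewrite big_cons.
by apply: cvgD => //; exact: fl.
Qed.

(** The partial sums of the exponential series are nonnegative combinations of entrywise powers, and
    positivity passes to the limit. *)
Lemma psd_exp (T : Type) (L : T -> T -> R) :
  (forall a b, L a b = L b a) -> psd L -> psd (fun x y => expR (L x y)).
Proof.
move=> Lc Lpsd.
have Lpow n : psd (fun x y => L x y ^+ n).
  elim: n => [|n ih].
    move=> s; rewrite (_ : \sum_(_ <- _) _ = (\sum_(p <- s) p.1) ^+ 2) ?sqr_ge0 //.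
    rewrite expr2 mulr_suml; apply: eq_bigr => p _; rewrite mulr_sumr.
    by apply: eq_bigr => q _; rewrite expr0 mulr1.
  have := psd_mul Lc ih Lpsd.
  by under eq_fun do under eq_fun do rewrite -exprSr.
have Lser n : psd (fun x y => series (exp_coeff (L x y)) n).
  move=> s; rewrite (_ : \sum_(_ <- _) _ = \sum_(0 <= k < n) k`!%:R^-1 *
    \sum_(p <- s) \sum_(q <- s) p.1 * q.1 * L p.2 q.2 ^+ k).
    by apply: sumr_ge0 => k _; rewrite mulr_ge0 ?invr_ge0 // Lpow.
  under [RHS]eq_bigr do rewrite mulr_sumr.
  rewrite [RHS]exchange_big; apply: eq_bigr => p _ /=.
  under [RHS]eq_bigr do rewrite mulr_sumr.
  rewrite [RHS]exchange_big; apply: eq_bigr => q _ /=.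
  rewrite /series /= mulr_sumr; apply: eq_bigr => k _.
  by rewrite /exp_coeff /=; ring.
move=> s.
have hc : (fun n => \sum_(p <- s) \sum_(q <- s) p.1 * q.1 *
    series (exp_coeff (L p.2 q.2)) n) @ \oo -->
    \sum_(p <- s) \sum_(q <- s) p.1 * q.1 * expR (L p.2 q.2).
  apply: (@cvg_sumr _ s (fun p n => \sum_(q <- s) p.1 * q.1 *
    series (exp_coeff (L p.2 q.2)) n)) => p.
  apply: (@cvg_sumr _ s (fun q n => p.1 * q.1 *
    series (exp_coeff (L p.2 q.2)) n)) => q.
  by apply: cvgMl_tmp; exact: is_cvg_series_exp_coeff.
rewrite -(cvg_lim _ hc) //; apply: limr_ge; first by apply/cvg_ex; eexists; exact: hc.
by apply: nearW => n; exact: Lser.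
Qed.

End PositiveKernels.

(** * The Gaussian characteristic functional and weights of signs *)

Section PositiveDefinite.
Variables (R : realType) (V : zmodType) (B : V -> V -> R).
Hypotheses (Bc : forall a b, B a b = B b a)
  (BD : forall a b c, B (a + b) c = B a c + B b c) (Bpsd : psd B).

Definition pos_def (F : V -> R[i]) : Prop := forall s : seq (R[i] * V),
  0 <= \sum_(p <- s) \sum_(q <- s) p.1 * (q.1^*)%C * F (p.2 - q.2).

(** The characteristic functional [E exp (i X a)] of the centered Gaussian process [X] with
    covariance [B]. *)
Definition gauss (a : V) : R[i] := (expR (- (B a a / 2)))%:C%C.

Lemma B0 c : B 0 c = 0.
Proof. by have := BD 0 0 c; rewrite addr0; lra. Qed.

Lemma BN a c : B (- a) c = - B a c.
Proof. by have := BD a (- a) c; rewrite subrr B0; lra. Qed.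

Lemma BBB a b : B (a - b) (a - b) = B a a + B b b - 2 * B a b.
Proof. by rewrite BD BN !(Bc _ (a - b)) !BD !BN (Bc b a); ring. Qed.

Lemma BDD a b : B (a + b) (a + b) = B a a + B b b + 2 * B a b.
Proof. by rewrite BD !(Bc _ (a + b)) !BD (Bc b a); ring. Qed.

(** At [a - b] it equals [expR (B a b)] up to factors depending on [a] and on [b] alone, which are
    absorbed in the weights. For complex weights, the real and imaginary parts contribute
    separately, the cross terms cancelling by symmetry. *)
Lemma gauss_pos_def : pos_def gauss.
Proof.
pose K a b := expR (- (B (a - b) (a - b) / 2)).
have Kc a b : K a b = K b a by rewrite /K !BBB (Bc a b); congr expR; ring.
have Kpsd : psd K.
  move=> s; have := psd_exp Bc Bpsd [seq (p.1 * expR (- (B p.2 p.2 / 2)), p.2) | p <- s].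
  rewrite big_map; congr (_ <= _); apply: eq_bigr => p _.
  rewrite big_map; apply: eq_bigr => q _ /=.
  rewrite /K (_ : - (B (_ - _) _ / 2) = - (B p.2 p.2 / 2) + (- (B q.2 q.2 / 2)) + B p.2 q.2).
    by rewrite !expRD; ring.
  by rewrite BBB; field.
move=> s.
have -> : \sum_(p <- s) \sum_(q <- s) p.1 * (q.1^*)%C * gauss (p.2 - q.2) =
  (\sum_(p <- s) \sum_(q <- s) complex.Re p.1 * complex.Re q.1 * K p.2 q.2 +
   \sum_(p <- s) \sum_(q <- s) complex.Im p.1 * complex.Im q.1 * K p.2 q.2)%:C%C +
  'i%C * (\sum_(p <- s) \sum_(q <- s) complex.Im p.1 * complex.Re q.1 * K p.2 q.2 -
   \sum_(p <- s) \sum_(q <- s) complex.Re p.1 * complex.Im q.1 * K p.2 q.2)%:C%C.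
  rewrite rmorphD rmorphB /= !rmorph_sum mulrBr !mulr_sumr -!sumrB -!big_split /=.
  apply: eq_bigr => p _.
  rewrite !rmorph_sum !mulr_sumr -!sumrB -!big_split /=.
  apply: eq_bigr => q _.
  rewrite /gauss -/(K p.2 q.2); case: p.1 q.1 => [a b] [c d] /=.
  by apply/eqP; rewrite eq_complex /=; apply/andP; split; apply/eqP; ring.
rewrite (_ : _ - _ = 0) ?mulr0 ?addr0.
  rewrite ler0c addr_ge0 //.
  + have := Kpsd [seq (complex.Re p.1, p.2) | p <- s].
    by rewrite big_map; under eq_bigr do rewrite big_map.
  + have := Kpsd [seq (complex.Im p.1, p.2) | p <- s].
    by rewrite big_map; under eq_bigr do rewrite big_map.
apply/eqP; rewrite subr_eq0; apply/eqP; rewrite exchange_big.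
by apply: eq_bigr => p _; apply: eq_bigr => q _; rewrite Kc; ring.
Qed.

(** If [F a] is thought of as an expectation of [exp (i X a)], this inserts the density
    [(1 + Re (c exp (i X e))) / 2]. *)
Definition twist (c : R[i]) (e : V) (F : V -> R[i]) (a : V) : R[i] :=
  4^-1 * (2 * F a + c * F (a + e) + (c^*)%C * F (a - e)).

(** For unimodular [z], [2 + c z + c^* z^-1] is the square of [|1 + c z|]. Accordingly the sum for
    the twist is a quarter of the sum for [F] over [s] and its translate by [e], the latter with
    weights multiplied by [c]. *)
Lemma twist_pos_def c e F : c * (c^*)%C = 1 -> pos_def F -> pos_def (twist c e F).
Proof.
move=> c1 Fpd s.
have := Fpd (s ++ [seq (c * p.1, p.2 + e) | p <- s]).
rewrite big_cat big_map /=.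
under eq_bigr do rewrite big_cat big_map /=.
under [X in _ + X]eq_bigr do rewrite big_cat big_map /=.
rewrite -big_split /= => h.
rewrite (_ : \sum_(_ <- _) _ = 4^-1 * (\sum_(p <- s)
  (\sum_(q <- s) p.1 * (q.1^*)%C * F (p.2 - q.2) +
   \sum_(q <- s) p.1 * ((c * q.1)^*)%C * F (p.2 - (q.2 + e)) +
   (\sum_(q <- s) c * p.1 * (q.1^*)%C * F (p.2 + e - q.2) +
    \sum_(q <- s) c * p.1 * ((c * q.1)^*)%C * F (p.2 + e - (q.2 + e)))))).
  by rewrite mulr_ge0 // invr_ge0.
rewrite mulr_sumr; apply: eq_bigr => p _; rewrite -!big_split mulr_sumr /=.
apply: eq_bigr => q _; rewrite /twist rmorphM.
have -> : p.2 - (q.2 + e) = p.2 - q.2 - e by rewrite opprD addrA.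
have -> : p.2 + e - q.2 = p.2 - q.2 + e by rewrite addrAC.
have -> : p.2 + e - (q.2 + e) = p.2 - q.2 by rewrite opprD addrACA subrr addr0.
rewrite (_ : c * p.1 * ((c^*)%C * (q.1^*)%C) = (c * (c^*)%C) * (p.1 * (q.1^*)%C)); last ring.
by rewrite c1; ring.
Qed.

(** Chosen so that [Re (phase b * exp (i x))] is [sin x] for [true] and [- sin x] for [false]. *)
Definition phase (b : bool) : R[i] := if b then - 'i%C else 'i%C.

Lemma phaseK b : phase b * ((phase b)^*)%C = 1.
Proof.
by case: b; apply/eqP; rewrite eq_complex /=; apply/andP; split; apply/eqP; ring.
Qed.

Variables (I : eqType) (e : I -> V).

(* Formally the expectation of [exp (i X a) \prod (1 +- sin (X (e s))) / 2] over
   the signed sites [(s, +-)] in [L], for the Gaussian process [X] with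
   covariance [B]; [weight L] is then the probability that independent signs
   with conditional means [sin (X (e s))] take the prescribed values. *)
Definition cyl (L : seq (I * bool)) : V -> R[i] :=
  foldr (fun p => twist (phase p.2) (e p.1)) gauss L.

Definition weight (L : seq (I * bool)) : R := complex.Re (cyl L 0).

Lemma cyl_pos_def L : pos_def (cyl L).
Proof.
elim: L => [|p L ih]; first exact: gauss_pos_def.
by apply: twist_pos_def => //; exact: phaseK.
Qed.

Lemma weight_ge0 L : 0 <= weight L.
Proof.
have := cyl_pos_def L [:: (1, 0)].
rewrite !big_seq1 [(_, _).1]/(1) [(_, _).2]/(0) conjc1 !mul1r subrr /weight.
by rewrite lecE => /andP[].
Qed.

Lemma weight_nil : weight [::] = 1.
Proof. by rewrite /weight /= /gauss B0 mul0r oppr0 expR0. Qed.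

Lemma cyl_split s L a : cyl ((s, true) :: L) a + cyl ((s, false) :: L) a = cyl L a.
Proof.
rewrite /= /twist -mulrDr /phase.
rewrite rmorphN (_ : _ + _ + (_ + _) = 4 * cyl L a); last by ring.
by rewrite mulrA mulVf ?mul1r // pnatr_eq0.
Qed.

Lemma weight_split s L : weight L = weight ((s, true) :: L) + weight ((s, false) :: L).
Proof. by rewrite /weight -raddfD /= -(cyl_split s). Qed.

Lemma twistC c e1 c' e2 F : twist c e1 (twist c' e2 F) = twist c' e2 (twist c e1 F).
Proof.
apply/funext => a; rewrite /twist.
rewrite (addrAC a e2 e1) (addrAC a e2 (- e1)) (addrAC a (- e2) e1) (addrAC a (- e2) (- e1)).
ring.
Qed.

Lemma cyl_rem p L : p \in L -> cyl L = twist (phase p.2) (e p.1) (cyl (rem p L)).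
Proof.
elim: L => //= q L ih; rewrite inE; case: eqVneq => [->|qp] //=.
by move=> /ih ->; rewrite twistC.
Qed.

Lemma cyl_perm L L' : perm_eq L L' -> cyl L = cyl L'.
Proof.
elim: L L' => [|p L ih] L'; first by rewrite perm_sym => /perm_nilP ->.
move=> pL; have pL' : p \in L' by rewrite -(perm_mem pL) mem_head.
rewrite (cyl_rem pL') /= (ih (rem p L')) //.
by rewrite -(perm_cons p) (perm_trans pL) // perm_to_rem.
Qed.

Lemma weight_perm L L' : perm_eq L L' -> weight L = weight L'.
Proof. by rewrite /weight => /cyl_perm ->. Qed.

Lemma cyl_transl (r : V -> V) (t : I -> I) L a :
  (forall a b, r (a + b) = r a + r b) -> (forall a b, B (r a) (r b) = B a b) ->
  (forall s, e (t s) = r (e s)) ->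
  cyl [seq (t p.1, p.2) | p <- L] (r a) = cyl L a.
Proof.
move=> rD rB et.
have rN x : r (- x) = - r x.
  have r0 : r 0 = 0 by have := rD 0 0; rewrite addr0 => /eqP;
    rewrite -subr_eq0 opprD addNKr oppr_eq0 => /eqP.
  by apply/eqP; rewrite -addr_eq0 -rD addNr r0.
elim: L a => [|p L ih] a; first by rewrite /= /gauss rB.
by rewrite /= /twist et -rN -!rD !ih.
Qed.

Lemma weight_transl (r : V -> V) (t : I -> I) L :
  (forall a b, r (a + b) = r a + r b) -> (forall a b, B (r a) (r b) = B a b) ->
  (forall s, e (t s) = r (e s)) ->
  weight [seq (t p.1, p.2) | p <- L] = weight L.
Proof.
move=> rD rB et; rewrite /weight -(cyl_transl L 0 rD rB et).
have r0 : r 0 = 0 by have := rD 0 0; rewrite addr0 => /eqP;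
    rewrite -subr_eq0 opprD addNKr oppr_eq0 => /eqP.
by rewrite r0.
Qed.

Lemma twist_diff c F a : twist (phase true) c F a - twist (phase false) c F a =
  2^-1 * 'i%C * (F (a - c) - F (a + c)).
Proof.
have ci : ('i^*)%C = - 'i%C :> R[i] by apply/eqP; rewrite eq_complex /= oppr0 !eqxx.
have cNi : ((- 'i%C)^*)%C = 'i%C :> R[i] by apply/eqP; rewrite eq_complex /= opprK oppr0 !eqxx.
by rewrite /twist /phase cNi ci; field.
Qed.

(** The left side is the correlation of the signs at [s] and [s'], that is, the expectation of a
    product of sines; the right side comes from [sin x sin y = (cos (x - y) - cos (x + y)) / 2]. *)
Lemma weight_pair s s' :
  weight [:: (s, true); (s', true)] + weight [:: (s, false); (s', false)] -
  weight [:: (s, true); (s', false)] - weight [:: (s, false); (s', true)] =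
  (expR (- (B (e s - e s') (e s - e s') / 2)) -
   expR (- (B (e s + e s') (e s + e s') / 2))) / 2.
Proof.
rewrite /weight -raddfD -!raddfB.
have gN a : gauss (- a) = gauss a by rewrite /gauss BN Bc BN opprK.
have -> : cyl [:: (s, true); (s', true)] 0 + cyl [:: (s, false); (s', false)] 0 -
    cyl [:: (s, true); (s', false)] 0 - cyl [:: (s, false); (s', true)] 0 =
  2^-1 * (gauss (e s - e s') - gauss (e s + e s')).
  have E b : cyl [:: (s, true); (s', b)] 0 - cyl [:: (s, false); (s', b)] 0 =
      2^-1 * 'i%C * (cyl [:: (s', b)] (0 - e s) - cyl [:: (s', b)] (0 + e s)).
    exact: twist_diff.
  have E' a : cyl [:: (s', true)] a - cyl [:: (s', false)] a =
      2^-1 * 'i%C * (gauss (a - e s') - gauss (a + e s')).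
    exact: twist_diff.
  have h1 := E true; have h2 := E false.
  rewrite sub0r add0r in h1 h2.
  have h3 := E' (- e s); have h4 := E' (e s).
  have e1 : gauss (- e s - e s') = gauss (e s + e s') by rewrite -opprD gN.
  have e2 : gauss (- e s + e s') = gauss (e s - e s') by rewrite -gN opprD opprK.
  rewrite e1 e2 in h3.
  transitivity ((cyl [:: (s, true); (s', true)] 0 - cyl [:: (s, false); (s', true)] 0)
     - (cyl [:: (s, true); (s', false)] 0 - cyl [:: (s, false); (s', false)] 0)); first by ring.
  rewrite h1 h2.
  transitivity (2^-1 * 'i%C * ((cyl [:: (s', true)] (- e s) - cyl [:: (s', false)] (- e s)) -
    (cyl [:: (s', true)] (e s) - cyl [:: (s', false)] (e s)))); first by ring.
  rewrite h3 h4.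
  have ii : 'i%C * 'i%C = -1 :> R[i] by rewrite -expr2 sqr_i.
  set x := gauss _; set y := gauss _.
  transitivity ('i%C * 'i%C * (2^-1 * 2^-1 * 2 * (x - y)) : R[i]); first by ring.
  by rewrite ii; field.
rewrite /gauss -rmorphB (_ : 2^-1 = (2^-1)%:C%C); last by rewrite fmorphV rmorph_nat.
by rewrite -rmorphM /= mulrC.
Qed.

End PositiveDefinite.

(** * Measures on binary sequences *)

(** Cantor space, tagged with the field over which [standard_borel R] asks for a complete
    pseudometric. *)
Definition binseq (R : realType) : Type := prod_topology (fun _ : nat => bool).

HB.instance Definition _ (R : realType) := Pointed.on (binseq R).
HB.instance Definition _ (R : realType) := PseudoMetric.copy (binseq R)
  (prod_topology (fun _ : nat => (bool : pseudoMetricType R))).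

Lemma binseq_complete (R : realType) (F : set_system (binseq R)) :
  ProperFilter F -> cauchy F -> cvg F.
Proof.
move=> PF cF; apply: (@compact_cauchy_cvg _ setT) => //; first exact: filterT.
exact: cantor_space_compact.
Qed.

HB.instance Definition _ (R : realType) :=
  Uniform_isComplete.Build (binseq R) (@binseq_complete R).

Definition borel_binseq (R : realType) := g_sigma_algebraType (@open (binseq R)).

Section BinarySequences.
Variable R : realType.
Local Notation X := (borel_binseq R).

Definition prefix_set (w : seq bool) : set X :=
  [set x | forall i, (i < size w)%N -> (x : nat -> bool) i = nth false w i].

(** Otherwise points outside [O] that agree with [x] on longer and longer prefixes converge to
    [x]. *)
Lemma open_prefix_set (O : set (binseq R)) x : open O -> O x ->
  exists n, prefix_set (mkseq (x : nat -> bool) n) `<=` O.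
Proof.
move=> Oo Ox; apply: contrapT => /forallNP h.
have /choice[y hy] : forall n, exists y : binseq R,
    prefix_set (mkseq (x : nat -> bool) n) y /\ ~ O y.
  by move=> n; move: (h n) => /existsNP[y /not_implyP yO]; exists y.
have yx : y n @[n --> \oo] --> x.
  apply/(@pointwise_cvgP nat bool) => t A /nbhs_singleton At.
  exists t.+1 => // n /= tn; have [+ _] := hy n.
  by move=> /(_ t); rewrite size_mkseq nth_mkseq // => ->.
have /yx [n _ hn] : nbhs x O by apply: open_nbhs_nbhs.
by have [_] := hy n; apply; exact: hn n (leqnn n).
Qed.

Lemma open_coord n b : open [set x : binseq R | (x : nat -> bool) n = b].
Proof.
have /continuousP h : continuous (fun x : binseq R => (x : nat -> bool) n).
  exact: (@proj_continuous nat (fun _ => bool) n).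
exact: (h [set b] (discrete_open _)).
Qed.

Lemma measurable_coord n b : measurable [set x : X | (x : nat -> bool) n = b].
Proof. by apply: sub_sigma_algebra; exact: open_coord. Qed.

Lemma measurable_prefix_set w : measurable (prefix_set w).
Proof.
rewrite (_ : prefix_set w = \bigcap_(i in [set i | (i < size w)%N])
  [set x : X | (x : nat -> bool) i = nth false w i]) //.
by apply: fin_bigcap_measurable; [exact: finite_II|move=> i _; exact: measurable_coord].
Qed.

Lemma open_bigcup_prefix_set (O : set X) : open (O : set (binseq R)) ->
  O = \bigcup_w (if `[< prefix_set w `<=` O >] then prefix_set w else set0).
Proof.
move=> Oo; apply/seteqP; split=> x.
  move=> Ox; have [n hn] := open_prefix_set Oo Ox.
  exists (mkseq (x : nat -> bool) n) => //; rewrite asboolT //.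
  by move=> i; rewrite size_mkseq => ni; rewrite nth_mkseq.
by move=> [w _]; case: asboolP => // h /h.
Qed.

Lemma measurable_fun_binseq d (T : measurableType d) (f : T -> X) :
  (forall n, measurable [set t | (f t : nat -> bool) n = true]) ->
  measurable_fun [set: T] f.
Proof.
move=> fm.
have h := @measurability _ _ _ _ setT f (@open (binseq R)).
apply: h => //.
move=> _ [U Uo <-]; rewrite setTI (open_bigcup_prefix_set Uo) preimage_bigcup.
apply: countable_bigcupT_measurable => // w.
case: asboolP => _; last by rewrite preimage_set0.
rewrite (_ : _ @^-1` _ = \bigcap_(i in [set i | (i < size w)%N])
  [set t | (f t : nat -> bool) i = nth false w i]) //.
apply: fin_bigcap_measurable; first exact: finite_II.
move=> i _; case: nth; first exact: fm.
rewrite (_ : [set t | _] = ~` [set t | (f t : nat -> bool) i = true]).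
  exact/measurableC/fm.
by apply/seteqP; split=> t /=; case: (f t i).
Qed.

Lemma standard_borel_binseq : standard_borel R X.
Proof.
exists (binseq R), id; split.
- split; first exact: cantor_space_hausdorff.
  exists (range (fun w : seq bool => (nth false w : binseq R))).
    exact: (sub_countable (card_image_le _ _) (countableP _)).
  move=> O [x Ox] Oo; have [n hn] := open_prefix_set Oo Ox.
  exists (nth false (mkseq (x : nat -> bool) n)); split; last by exists (mkseq (x : nat -> bool) n).
  exact: hn.
- by exists id.
- by move=> A; rewrite image_id.
Qed.

End BinarySequences.

(** * The measure with prescribed weights of prefixes *)

Section TreeMeasure.
Variables (R : realType) (p : seq bool -> R).
Hypotheses (p1 : p [::] = 1) (p0 : forall w, 0 <= p w)
  (pS : forall w, p w = p (rcons w true) + p (rcons w false)).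

(** Split [[0, 1)] successively in the proportions given by [p], the [false] branch on the left. The
    interval attached to [w] has length [p w], and its left endpoint is the total length of the
    [false] branches that the path leaves on its left. *)
Definition tree_left (w : seq bool) : R :=
  \sum_(k < size w) if nth false w k then p (rcons (take k w) false) else 0.

Lemma tree_left_rcons w b :
  tree_left (rcons w b) = tree_left w + if b then p (rcons w false) else 0.
Proof.
rewrite /tree_left size_rcons big_ord_recr /= nth_rcons ltnn eqxx.
rewrite -cats1 take_size_cat // cats1; congr (_ + _).
apply: eq_bigr => k _; rewrite nth_rcons ltn_ord.
by have -> : take k (rcons w b) = take k w by rewrite -cats1 takel_cat // ltnW.
Qed.

Fixpoint digits (u : R) (n : nat) : seq bool := if n is m.+1 then
  let w := digits u m in rcons w (tree_left w + p (rcons w false) <= u) else [::].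

Lemma size_digits u n : size (digits u n) = n.
Proof. by elim: n => //= n ih; rewrite size_rcons ih. Qed.

Definition digit (u : R) : borel_binseq R := fun n => nth false (digits u n.+1) n.

Lemma digitsE u n : digits u n = mkseq (digit u) n.
Proof.
elim: n => // n ih; rewrite mkseqS -ih /digit /=.
by congr rcons; rewrite nth_rcons size_digits ltnn eqxx.
Qed.

Lemma digitsP u w : 0 <= u < 1 ->
  digits u (size w) = w <-> tree_left w <= u < tree_left w + p w.
Proof.
move=> u01; elim/last_ind: w => [|w b ih].
  by rewrite /tree_left big_ord0 add0r p1 u01.
rewrite size_rcons tree_left_rcons /=; split.
  move=> /rcons_inj[e]; rewrite e; move/ih: e => /andP[h1 h2] hb.
  have pw := pS w; case: b hb => [hb|/negbT]; last first.
    by rewrite -ltNge => hb; apply/andP; split; lra.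
  by apply/andP; split; lra.
move=> h; have hw : digits u (size w) = w.
  apply/ih; move: h; have := pS w; have := p0 (rcons w true); have := p0 (rcons w false).
  by case: b => h1 h2 h3 /andP[h4 h5]; apply/andP; split; lra.
rewrite hw; congr rcons; move: h; case: b => /andP[h1 h2] //.
by apply/negbTE; rewrite -ltNge; move: h2; rewrite addr0.
Qed.

Lemma measurable_digits n w : measurable [set u : measurableTypeR R | digits u n = w].
Proof.
elim: n w => [|n ih] w /=.
  have [->|/eqP w0] := eqVneq [::] w.
    by rewrite (_ : [set _ | _] = setT) //; apply/seteqP.
  by rewrite (_ : [set _ | _] = set0) //; apply/seteqP; split.
case/lastP: w => [|w b].
  rewrite (_ : [set _ | _] = set0) //; apply/seteqP; split=> // u /= /(congr1 size).
  by rewrite size_rcons.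
pose c := tree_left w + p (rcons w false).
rewrite (_ : [set _ | _] = [set u | digits u n = w] `&`
   (if b then `[c, +oo[%classic else `]-oo, c[%classic)).
  by apply: measurableI => //; case: b; exact: measurable_itv.
apply/seteqP; split=> u /=.
  move=> /rcons_inj[e]; rewrite e => <-; split=> //.
  by case: leP => h; rewrite /= in_itv /= ?h ?andbT.
move=> [e]; rewrite e => h; congr rcons; move: h.
by case: b => /=; rewrite in_itv /= ?andbT // => h; apply/negbTE; rewrite -ltNge.
Qed.

Lemma measurable_digit : measurable_fun [set: measurableTypeR R] digit.
Proof.
apply: measurable_fun_binseq => n.
rewrite (_ : [set _ | _] = \bigcup_(w : seq bool)
  [set u | digits u n.+1 = rcons (take n w) true]).
  by apply: countable_bigcupT_measurable => // w; exact: measurable_digits.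
apply/seteqP; split=> u.
  rewrite /= /digit => h; exists (digits u n) => //=.
  rewrite take_oversize ?size_digits //; congr rcons.
  by move: h; rewrite /= nth_rcons size_digits ltnn eqxx.
move=> [w _] /= h; rewrite /digit /= h nth_rcons.
have : size (take n w) = n.
  by have /(congr1 size) := h; rewrite !size_rcons size_digits => -[].
by move=> ->; rewrite ltnn eqxx.
Qed.

Definition digit_mfun : {mfun measurableTypeR R >-> borel_binseq R} :=
  HB.pack digit
    (@isMeasurableFun.Build _ _ (measurableTypeR R) (borel_binseq R) digit measurable_digit).

Lemma uniform_prob01 (A : set (measurableTypeR R)) : measurable A ->
  uniform_prob (@ltr01 R) A = lebesgue_measure (A `&` `[0, 1]%classic).
Proof.
move=> mA; rewrite /uniform_prob integral_uniform_pdf.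
rewrite (eq_integral (fun=> 1%:E)); last first.
  move=> x; rewrite inE /= => -[_]; rewrite in_itv /= /uniform_pdf => ->.
  by rewrite subr0 invr1.
rewrite integral_cst ?mul1e //.
by apply: measurableI => //; exact: measurable_itv.
Qed.

Lemma tree_left_ge0 w : 0 <= tree_left w.
Proof. by apply: sumr_ge0 => k _; case: nth. Qed.

Lemma tree_right_le1 w : tree_left w + p w <= 1.
Proof.
elim/last_ind: w => [|w b]; first by rewrite /tree_left big_ord0 add0r p1.
rewrite tree_left_rcons; have := pS w; have := p0 (rcons w true).
by have := p0 (rcons w false); case: b; lra.
Qed.

(** The image of Lebesgue measure under the map sending a point to its address in the successive
    splittings: the points with prefix [w] form the interval attached to [w]. *)
Lemma tree_measure : exists mu : probability (borel_binseq R) R,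
  forall w, mu (@prefix_set R w) = (p w)%:E.
Proof.
exists (distribution (uniform_prob (@ltr01 R)) digit_mfun) => w.
have E (u : R) : @prefix_set R w (digit u) <-> digits u (size w) = w.
  rewrite digitsE; split => [h|h i iw].
    apply: (@eq_from_nth _ false); rewrite size_mkseq // => i iw.
    by rewrite nth_mkseq // h.
  by rewrite -[in RHS]h nth_mkseq.
change (uniform_prob (@ltr01 R) (digit @^-1` @prefix_set R w) = (p w)%:E).
rewrite uniform_prob01; last first.
  rewrite -[_ @^-1` _]setTI; apply: measurable_digit => //.
  exact: measurable_prefix_set.
(* [uniform_prob] lives on the closed interval, while addresses are described on [[0, 1)]; the null
   point 1 is split off. *)
have -> : (digit @^-1` @prefix_set R w) `&` `[0, 1]%classic =
    `[tree_left w, tree_left w + p w[%classic `|`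
    ([set 1] `&` (digit @^-1` @prefix_set R w)) :> set R.
  have l0 := tree_left_ge0 w; have r1 := tree_right_le1 w.
  apply/seteqP; split=> u /=.
    move=> [/E hu]; rewrite in_itv /= => /andP[u0]; rewrite le_eqVlt => /orP[/eqP u1|u1].
      by right; split; [exact: u1|exact/E].
    by left; rewrite in_itv /=; apply/digitsP; rewrite ?u0.
  rewrite !in_itv /= => -[h|[-> h]]; last by rewrite ler01 lexx.
  have u01 : 0 <= u < 1 by move: h => /andP[h1 h2]; apply/andP; split; lra.
  split; first by apply/E/digitsP.
  by case/andP: u01 => -> /ltW ->.
rewrite measureU0; last 3 first.
- exact: measurable_itv.
- apply: measurableI => //; rewrite -[_ @^-1` _]setTI; apply: measurable_digit => //.
  exact: measurable_prefix_set.
- apply: (@subset_measure0 _ _ _ lebesgue_measure _ [set 1]) => //.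
  + apply: measurableI => //; rewrite -[_ @^-1` _]setTI; apply: measurable_digit => //.
    exact: measurable_prefix_set.
  + exact: lebesgue_measure_set1.
etransitivity; first exact: (lebesgue_measure_itv `[tree_left w, tree_left w + p w[).
rewrite /= lte_fin ltrDl; case: ltP => h.
  by rewrite -EFinB addrAC subrr add0r.
by have := p0 w; move=> h'; congr EFin; apply/eqP; rewrite eq_le h' h.
Qed.
End TreeMeasure.

(** * The shift on coins indexed by an orbit *)

(** Coins are indexed by [G * nat], so that each group element has many coins with the same
    conditional mean; the bijection turns configurations of coins into binary sequences. *)
Lemma prod_nat_bij (G : Type) : [set: G] !=set0 -> countable [set: G] ->
  exists (site : nat -> G * nat) (index : G * nat -> nat),
    cancel site index /\ cancel index site.
Proof.
move=> [g0 _] Gc.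
have /card_set_bijP[f fb] : ([set: G * nat] #= [set: nat])%card.
  rewrite card_eq_le; apply/andP; split.
    by rewrite -setXTT; apply: countableX.
  apply/infiniteP => /(sub_finite_set _) h.
  have := @infinite_nat; apply.
  have -> : [set: nat] = snd @` [set: G * nat].
    by apply/seteqP; split => // n _; exists (g0, n).
  by apply: finite_image; apply: h.
move: fb; rewrite setTT_bijective => -[site c1 c2].
by exists site, f.
Qed.

Section Process.
Variables (R : realType) (G : groupType) (V : zmodType) (B : V -> V -> R).
Variables (rho : G -> V -> V) (v : V).
Hypotheses (Bc : forall a b, B a b = B b a)
  (BD : forall a b c, B (a + b) c = B a c + B b c)
  (Bpsd : psd B)
  (rhoM : forall g h a, rho (g * h)%g a = rho g (rho h a))
  (rhoD : forall g a b, rho g (a + b) = rho g a + rho g b)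
  (rhoB : forall g a b, B (rho g a) (rho g b) = B a b).
Variables (site : nat -> G * nat) (index : G * nat -> nat).
Hypotheses (siteK : cancel site index) (indexK : cancel index site).

Local Notation X := (borel_binseq R).
Local Notation wt := (weight B (fun s : G * nat => rho s.1 v)).

Definition signed_sites (w : seq bool) : seq ((G * nat) * bool) :=
  zip (mkseq site (size w)) w.

Lemma signed_sites_rcons w b :
  signed_sites (rcons w b) = rcons (signed_sites w) (site (size w), b).
Proof. by rewrite /signed_sites size_rcons mkseqS zip_rcons // size_mkseq. Qed.

Definition coin (s : G * nat) (x : X) : bool := (x : nat -> bool) (index s).

Lemma measurable_coin s b : measurable [set x | coin s x = b].
Proof. exact: measurable_coord. Qed.

Definition cylinder (L : seq ((G * nat) * bool)) : set X :=
  [set x | forall p, p \in L -> coin p.1 x = p.2].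

Lemma prefix_setE w : @prefix_set R w = cylinder (signed_sites w).
Proof.
apply/seteqP; split=> x /= h.
  move=> p /(nthP (site 0, false))[j]; rewrite size_zip size_mkseq minnn => iw <-.
  by rewrite nth_zip ?size_mkseq //= nth_mkseq // /coin siteK h.
move=> i iw; have := h (site i, nth false w i).
rewrite /coin /= siteK; apply; apply/(nthP (site 0, false)); exists i.
  by rewrite size_zip size_mkseq minnn.
by rewrite nth_zip ?size_mkseq //= nth_mkseq.
Qed.

Lemma measurable_cylinder L : measurable (cylinder L).
Proof.
elim: L => [|p L ih].
  by rewrite (_ : cylinder _ = setT) //; apply/seteqP; split.
rewrite (_ : cylinder _ = [set x | coin p.1 x = p.2] `&` cylinder L).
  by apply: measurableI => //; exact: measurable_coin.
apply/seteqP; split=> x /= h.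
  split; first by apply: h; exact: mem_head.
  by move=> q qL; apply: h; rewrite inE qL orbT.
by move=> q; rewrite inE => /orP[/eqP->|qL]; [exact: h.1|exact: h.2].
Qed.

(** Induction on the number of sites of an initial segment that [L] omits: split along an omitted
    site, until [L] is a permutation of a prefix. The sites must be distinct, since a repeated one
    is twisted twice in [wt] but constrains the set only once. *)
Lemma cylinder_measure (mu : probability X R) :
  (forall w, mu (@prefix_set R w) = (wt (signed_sites w))%:E) ->
  forall L, uniq (map fst L) -> mu (cylinder L) = (wt L)%:E.
Proof.
move=> muE L.
have [N hN] : exists N, forall s, s \in map fst L -> (index s < N)%N.
  exists (\max_(s <- map fst L) index s).+1 => s sL.
  by rewrite ltnS; apply: leq_bigmax_seq.
move: {2}(N - size L)%N (leqnn (N - size L)) => k.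
elim: k L hN => [|k ih] L hN hk uL; last first.
  have [LN|LN] := leqP N (size L); first by apply: ih => //; lia.
  have [i iN iL] : exists2 i, (i < N)%N & site i \notin map fst L.
    apply: contrapT => h.
    have : (size (mkseq site N) <= size (map fst L))%N.
      apply: uniq_leq_size; first by rewrite mkseq_uniq //; exact: (can_inj siteK).
      move=> s /mapP[j]; rewrite mem_iota add0n => /andP[_ jN] ->.
      by apply: contrapT => /negP jL; apply: h; exists j.
    by rewrite size_mkseq size_map leqNgt LN.
  have e b : mu (cylinder ((site i, b) :: L)) = (wt ((site i, b) :: L))%:E.
    apply: ih; rewrite /= ?iL ?uL //; last by rewrite subnS; move: hk; case: subn.
    by move=> s; rewrite inE => /orP[/eqP ->|]; [rewrite siteK|exact: hN].
  rewrite (weight_split _ _ (site i)) EFinD -!e -measureU; try exact: measurable_cylinder.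
    congr (mu _); apply/seteqP; split=> x /=.
      move=> h; case E : (coin (site i) x); [left|right] => q;
      by rewrite inE => /orP[/eqP -> //|]; exact: h.
    by move=> [] h q qL; apply: h; rewrite inE qL orbT.
  apply/seteqP; split=> // x [] /(_ (site i, true) (mem_head _ _)) /= h1.
  by move=> /(_ (site i, false) (mem_head _ _)) /=; rewrite h1.
have sLN : (N <= size L)%N by lia.
have pL : perm_eq (map fst L) (mkseq site N).
  apply: uniq_perm => //; first by rewrite mkseq_uniq //; exact: (can_inj siteK).
  apply: (uniq_min_size uL _ _).2; last by rewrite size_mkseq size_map.
  move=> s sL; apply/mapP; exists (index s); last by rewrite indexK.
  by rewrite mem_iota add0n hN.
(* Now [L] lists exactly the first [N] sites, each once, so it is the graph of a function on
   them. *)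
pose val s := (s, true) \in L.
pose w := [seq val s | s <- mkseq site N].
have Lv p : p \in L -> p.2 = val p.1.
  case: p => s [] pL0 /=; first by rewrite /val pL0.
  apply/esym/negP; rewrite /val => tL.
  have [i iL ei] := nthP (s, true) pL0; have [j jL ej] := nthP (s, true) tL.
  have := nth_uniq s (s := map fst L) (i := i) (j := j); rewrite !size_map => /(_ iL jL uL).
  rewrite !(nth_map (s, true)) // ei ej eqxx => /esym/eqP ij.
  by move: ei; rewrite ij ej.
have LE : L = [seq (s, val s) | s <- map fst L].
  rewrite -map_comp -[LHS]map_id; apply/eq_in_map => p /Lv /= <-.
  by case: p.
have pw : perm_eq L (signed_sites w).
  have -> : signed_sites w = [seq (s, val s) | s <- mkseq site N].
    rewrite /signed_sites /w size_map size_mkseq.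
    by rewrite -[X in zip X _]map_id zip_map.
  by rewrite {1}LE; exact: perm_map.
rewrite (weight_perm _ _ pw) -muE prefix_setE; congr (mu _).
by apply/seteqP; split=> x /= h q qL; apply: h; rewrite ?(perm_mem pw) // -(perm_mem pw).
Qed.

Definition transl_site (g : G) (s : G * nat) : G * nat := ((g * s.1)%g, s.2).

Definition shift (g : G) (x : X) : X := fun n => coin (transl_site g^-1%g (site n)) x.

Lemma coin_shift g s x : coin s (shift g x) = coin (transl_site g^-1%g s) x.
Proof. by rewrite /coin /shift indexK. Qed.

Lemma shift_preimage_cylinder g L :
  shift g @^-1` cylinder L = cylinder [seq (transl_site g^-1%g p.1, p.2) | p <- L].
Proof.
apply/seteqP; split=> x /= h p.
  by move=> /mapP[q qL ->] /=; rewrite -coin_shift; exact: h.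
by move=> pL /=; rewrite coin_shift; have := h _ (map_f _ pL).
Qed.

Lemma transl_site_inj g : injective (transl_site g).
Proof. by move=> [a m] [b n] [/mulgI -> ->]. Qed.

Lemma uniq_signed_sites w : uniq (map fst (signed_sites w)).
Proof.
rewrite -/(unzip1 _) unzip1_zip ?size_mkseq // mkseq_uniq //.
exact: can_inj siteK.
Qed.

Lemma measurable_shift g : measurable_fun [set: X] (shift g).
Proof. by apply: measurable_fun_binseq => n; exact: measurable_coin. Qed.

Lemma measurable_prefix_sets :
  @measurable _ X = <<s [set A | A = set0 \/ exists w, A = @prefix_set R w] >>.
Proof.
apply/seteqP; split.
  apply: smallest_sub; first exact: smallest_sigma_algebra.
  move=> A Ao; pose T := g_sigma_algebraType
    [set A : set X | A = set0 \/ exists w, A = @prefix_set R w].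
  suff : @measurable _ T A by [].
  rewrite (open_bigcup_prefix_set Ao).
  apply: (@countable_bigcupT_measurable _ T) => // w; case: asboolP => _.
    by apply: sub_sigma_algebra; right; exists w.
  exact: measurable0.
apply: smallest_sub; first exact: sigma_algebra_measurable.
by move=> _ [->|[w ->]]; [exact: measurable0|exact: measurable_prefix_set].
Qed.

Lemma prefix_setI_closed :
  setI_closed [set A : set X | A = set0 \/ exists w, A = prefix_set w].
Proof.
have sub w w' : (size w <= size w')%N -> prefix_set w `&` prefix_set w' = set0 \/
    exists u, prefix_set w `&` prefix_set w' = @prefix_set R u.
  move=> ww'; have [e|e] := eqVneq (take (size w) w') w.
    right; exists w'; apply/setIidPr => x h i iw.
    by rewrite h ?(leq_trans iw) // -e nth_take.
  left; rewrite -subset0 => x [h h']; move/eqP: e; apply.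
  have sz : size (take (size w) w') = size w by rewrite size_takel.
  apply: (@eq_from_nth _ false) => // i; rewrite sz => iw.
  by rewrite nth_take // -h // h' // (leq_trans iw).
move=> A A' [->|[w ->]]; first by left; rewrite set0I.
move=> [->|[w' ->]]; first by left; rewrite setI0.
case: (leqP (size w) (size w')) => [/sub h|/ltnW/sub h]; first exact: h.
by rewrite setIC; exact: h.
Qed.

(** A shift carries the measure of a cylinder to the weight of translated sites, which is unchanged
    because [rho] preserves [B]. Prefix sets are nested or disjoint, so with the empty set they form
    a generating family closed under intersection. *)
Lemma shift_measure_preserving (mu : probability X R) :
  (forall w, mu (@prefix_set R w) = (wt (signed_sites w))%:E) ->
  measure_preserving_action mu shift.
Proof.
move=> muE; split.
- move=> x; apply/funext => n; rewrite /shift /coin /transl_site invg1 mul1g.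
  by rewrite -surjective_pairing siteK.
- move=> g h x; apply/funext => n; rewrite [in RHS]/shift coin_shift /shift.
  by rewrite /transl_site /= invgM mulgA.
- exact: measurable_shift.
- move=> g A mA; apply: (measure_unique
    [set A | A = set0 \/ exists w, A = prefix_set w] (fun _ => prefix_set [::])
    measurable_prefix_sets prefix_setI_closed _ _
    (pushforward mu (shift g)) mu) => //.
  + by move=> i; right; exists [::].
  + by apply/seteqP; split => // x _; exists 0%N.
  + exact: measurable_shift.
  + move=> mf A' [->|[w ->]]; first by rewrite !measure0.
    change (mu (shift g @^-1` @prefix_set R w) = mu (@prefix_set R w)).
    rewrite prefix_setE shift_preimage_cylinder !(cylinder_measure muE).
    * congr EFin; apply: (weight_transl (r := rho g^-1%g)) => //.
      by move=> s; rewrite /transl_site /= rhoM.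
    * exact: uniq_signed_sites.
    * rewrite -map_comp.
      rewrite (_ : [seq _ | p <- _] = map (transl_site g^-1%g) (map fst (signed_sites w))).
        by rewrite map_inj_uniq ?uniq_signed_sites //; exact: transl_site_inj.
      by rewrite -map_comp; apply: eq_map.
  + move=> mf i; rewrite /pushforward (le_lt_trans (probability_le1 _ _)) ?ltry //.
    by rewrite -[_ @^-1` _]setTI; apply: mf => //; exact: measurable_prefix_set.
Qed.
End Process.

(** * Levels of a partition *)

Lemma indicM (R : realType) (T : Type) (A B : set T) x :
  \1_(A `&` B) x = \1_A x * \1_B x :> R.
Proof. by rewrite !indicE in_setI -natrM mulnb. Qed.

Section ActionLevels.
Variables (R : realType) (G : groupType) (d : measure_display)
  (T : measurableType d) (P : probability T R) (act : G -> T -> T).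
Hypothesis actP : measure_preserving_action P act.

Let act1 x : act 1%g x = x. Proof. by case: actP. Qed.
Let actM g h x : act (g * h)%g x = act g (act h x). Proof. by case: actP. Qed.
Let mact g : measurable_fun [set: T] (act g). Proof. by case: actP. Qed.

Lemma act_image g (A : set T) : act g @` A = act g^-1%g @^-1` A.
Proof.
apply/seteqP; split=> x /=; first by move=> [y Ay <-]; rewrite -actM mulVg act1.
by move=> Ax; exists (act g^-1%g x) => //; rewrite -actM mulgV act1.
Qed.

Lemma measurable_act_preimage g A : measurable A -> measurable (act g @^-1` A).
Proof. by move=> mA; rewrite -[_ @^-1` _]setTI; exact: mact. Qed.

Lemma measurable_act_image g A : measurable A -> measurable (act g @` A).
Proof. by rewrite act_image; exact: measurable_act_preimage. Qed.

Lemma pr_preimage g A : measurable A -> pr P (act g @^-1` A) = pr P A.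
Proof. by move=> mA; rewrite /pr; case: actP => _ _ _ ->. Qed.

Lemma pr_image g A : measurable A -> pr P (act g @` A) = pr P A.
Proof. by move=> mA; rewrite act_image pr_preimage. Qed.

(** The measure of the symmetric difference of [A] and its image under [act g], written as an
    integral so that it can be summed over level sets. *)
Definition displacement g (A : set T) : R :=
  Ex P (fun x => `|\1_A (act g^-1%g x) - \1_A x|).

Lemma displacement_ge0 g A : 0 <= displacement g A.
Proof. by apply: Ex_ge0. Qed.

Lemma bounded_mfun_act g (f : T -> R) :
  bounded_mfun f -> bounded_mfun (fun x => f (act g x)).
Proof. by apply: bounded_mfun_comp. Qed.

Section Levels.
Variables (n : nat) (E : 'I_n -> set T) (val : 'I_n -> R).
Hypothesis Epart : measurable_partition E.

Let mE i : measurable (E i). Proof. by case: Epart. Qed.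

Definition level (x : T) : R := \sum_i val i * \1_(E i) x.

Lemma levelE i x : E i x -> level x = val i.
Proof.
move=> Eix; rewrite /level (bigD1 i) //= indicE mem_set // mulr1 big1 ?addr0 // => j ji.
rewrite indicE memNset ?mulr0 // => Ejx; move/eqP: ji; apply.
by case: Epart => _ tE _; apply: (tE j i) => //; exists x.
Qed.

Lemma partition_ex x : exists i, E i x.
Proof.
case: Epart => _ _ /seteqP[_ /(_ x)] [//|i _ Eix]; by exists i.
Qed.

Lemma bounded_mfun_level : bounded_mfun level.
Proof.
apply: bounded_mfun_sum => i; apply: bounded_mfunZ; exact: bounded_mfun_indic.
Qed.

(** The inner product of the level function with its translate, expressed through the quantities
    that weak containment controls. *)
Definition level_corr (g : G) : R :=
  \sum_i \sum_j val i * val j * pr P ((act g @` E i) `&` E j).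

Lemma level_corrE g k : level_corr (k^-1 * g)%g =
  Ex P (fun x => level (act g^-1%g x) * level (act k^-1%g x)).
Proof.
rewrite (_ : (fun x => _) = (fun x => \sum_i \sum_j val i * val j *
  \1_((act g @` E i) `&` (act k @` E j)) x)); last first.
  apply/funext => x; rewrite /level mulr_suml; apply: eq_bigr => i _.
  rewrite mulr_sumr; apply: eq_bigr => j _; rewrite indicM !act_image /=.
  by rewrite mulrACA.
have b i j : bounded_mfun (\1_((act g @` E i) `&` (act k @` E j)) : T -> R).
  by apply/bounded_mfun_indic/measurableI; exact: measurable_act_image.
rewrite Ex_sum; last first.
  by move=> i; apply: bounded_mfun_sum => j; exact: bounded_mfunZ.
apply: eq_bigr => i _; rewrite Ex_sum; last by move=> j; exact: bounded_mfunZ.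
apply: eq_bigr => j _; rewrite ExZ // Ex_indic; last first.
  by apply: measurableI; exact: measurable_act_image.
congr (_ * _); rewrite -(pr_preimage k^-1%g); last first.
  by apply: measurableI; [exact: measurable_act_image|exact: mE].
congr pr; rewrite preimage_setI !act_image; apply/seteqP.
by split=> x; rewrite /= -!actM invgM invgK mulgK.
Qed.

Lemma Ex_level g : Ex P (fun x => level (act g x)) = Ex P level.
Proof.
have b A i : measurable A -> bounded_mfun (fun x : T => val i * \1_A x).
  by move=> mA; apply/bounded_mfunZ/bounded_mfun_indic.
rewrite /level (Ex_sum _ _ (F := fun i x => val i * \1_(E i) x)); last by move=> i; exact: b.
rewrite (Ex_sum _ _ (F := fun i x => val i * \1_(E i) (act g x))); last first.
  by move=> i; apply: (bounded_mfun_act g (f := fun x => val i * \1_(E i) x)); exact: b.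
apply: eq_bigr => i _.
rewrite (_ : (fun x => val i * \1_(E i) (act g x)) =
  (fun x => val i * \1_(act g @^-1` E i) x)) //.
have mg := measurable_act_preimage g (mE i).
by rewrite !ExZ ?Ex_indic ?pr_preimage //; exact: bounded_mfun_indic.
Qed.

(** An average of translates has the same mean as the level function, and the right side is its
    second moment. Unlike the squared mean, that side is linear in the correlations. *)
Lemma level_corr_avg (c : seq (R * G)) : \sum_(p <- c) p.1 = 1 ->
  Ex P level ^+ 2 <=
  \sum_(p <- c) \sum_(q <- c) p.1 * q.1 * level_corr (q.2^-1 * p.2)%g.
Proof.
move=> c1.
have bg (p : R * G) : bounded_mfun (fun x => p.1 * level (act p.2^-1%g x)).
  exact/bounded_mfunZ/bounded_mfun_act/bounded_mfun_level.
have -> : Ex P level = Ex P (fun x => \sum_(p <- c) p.1 * level (act p.2^-1%g x)).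
  rewrite (Ex_sum _ _ bg); transitivity ((\sum_(p <- c) p.1) * Ex P level).
    by rewrite c1 mul1r.
  rewrite mulr_suml; apply: eq_bigr => p _.
  by rewrite ExZ ?Ex_level //; exact/bounded_mfun_act/bounded_mfun_level.
apply: le_trans (Ex_sqr _ _) _; first exact: bounded_mfun_sum.
rewrite (_ : (fun x => _) = (fun x => \sum_(p <- c) \sum_(q <- c)
  (p.1 * q.1) * (level (act p.2^-1%g x) * level (act q.2^-1%g x)))); last first.
  apply/funext => x; rewrite expr2 mulr_suml; apply: eq_bigr => p _.
  by rewrite mulr_sumr; apply: eq_bigr => q _; rewrite mulrACA.
have bb (p q : R * G) : bounded_mfun (fun x => level (act p.2^-1%g x) * level (act q.2^-1%g x)).
  by apply: bounded_mfunM; exact/bounded_mfun_act/bounded_mfun_level.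
rewrite Ex_sum; last by move=> p; apply: bounded_mfun_sum => q; exact: bounded_mfunZ.
apply: ler_sum => p _; rewrite Ex_sum; last by move=> q; exact: bounded_mfunZ.
by apply: ler_sum => q _; rewrite ExZ // level_corrE.
Qed.

Lemma Ex_level_sqr : Ex P (fun x => level x ^+ 2) = level_corr 1%g.
Proof.
have := level_corrE 1%g 1%g; rewrite !invg1 mulg1 => ->.
by congr Ex; apply/funext => x; rewrite !act1 expr2.
Qed.

Lemma Ex_level_diff_sqr g :
  Ex P (fun x => (level (act g^-1%g x) - level x) ^+ 2) =
  2 * (level_corr 1%g - level_corr g).
Proof.
have bl : bounded_mfun level by exact: bounded_mfun_level.
have bg : bounded_mfun (fun x => level (act g^-1%g x)) by exact: bounded_mfun_act.
rewrite (_ : (fun x => _) = (fun x => level (act g^-1%g x) * level (act g^-1%g x) +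
   (level x ^+ 2 + (- 2) * (level (act g^-1%g x) * level x)))); last first.
  by apply/funext => x; ring.
have b1 : bounded_mfun (fun x => level (act g^-1%g x) * level (act g^-1%g x)).
  exact: bounded_mfunM.
have b2 : bounded_mfun (fun x => level x ^+ 2).
  by under eq_fun do rewrite expr2; exact: bounded_mfunM.
have b3 : bounded_mfun (fun x => level (act g^-1%g x) * level x) by exact: bounded_mfunM.
rewrite (ExD _ b1 (bounded_mfunD b2 (bounded_mfunZ _ b3))) (ExD _ b2 (bounded_mfunZ _ b3)).
rewrite ExZ // Ex_level_sqr -level_corrE mulVg.
have -> : Ex P (fun x => level (act g^-1%g x) * level x) = level_corr g.
  have := level_corrE g 1%g; rewrite !invg1 mul1g => ->.
  by congr Ex; apply/funext => x; rewrite act1.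
ring.
Qed.

End Levels.

(** * Upper level sets of an average of signs *)

Section UpperLevels.
Variables (N : nat) (E : 'I_N.+1 -> set T).
Hypotheses (N0 : (0 < N)%N) (Epart : measurable_partition E).

(* The values [2 i / N - 1] are those of the average of [N] signs. *)
Definition sign_avg (i : 'I_N.+1) : R := 2 * i%:R / N%:R - 1.

Definition upper (j : 'I_N) : set T :=
  \bigcup_(i in [set i : 'I_N.+1 | (j < i)%N]) E i.

Let mE i : measurable (E i). Proof. by case: Epart. Qed.
Let NR : (0 : R) < N%:R. Proof. by rewrite ltr0n. Qed.

Lemma measurable_upper j : measurable (upper j).
Proof. by apply: fin_bigcup_measurable => // i _. Qed.

Lemma indic_upper i j x : E i x -> \1_(upper j) x = (j < i)%N%:R :> R.
Proof.
move=> Eix; rewrite indicE; congr (nat_of_bool _)%:R; apply/idP/idP.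
  rewrite inE => -[k /= jk Ekx]; suff -> : i = k by [].
  by case: Epart => _ tE _; apply: (tE i k) => //; exists x.
by move=> ji; rewrite inE; exists i.
Qed.

(** Layer-cake decomposition: a point of [E i] lies in exactly the [i] sets [upper j] with
    [j < i]. *)
Lemma sum_upper x : \sum_(j < N) \1_(upper j) x = N%:R / 2 * (level E sign_avg x + 1).
Proof.
have [i Eix] := partition_ex Epart x.
rewrite (levelE _ Epart Eix) /sign_avg subrK.
under eq_bigr do rewrite (indic_upper _ Eix).
rewrite -natr_sum.
have -> : (\sum_(j < N) (j < i)%N)%N = i.
  have h m : (\sum_(j < m) (j < i)%N)%N = minn i m.
    elim: m => [|m ih]; first by rewrite big_ord0 minn0.
    by rewrite big_ord_recr /= ih; lia.
  by rewrite h; apply/minn_idPl; rewrite -ltnS.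
by field; rewrite gt_eqF.
Qed.

Lemma upper_mono (j l : 'I_N) : (j <= l)%N -> upper l `<=` upper j.
Proof. by move=> jl x [i /= li Eix]; exists i => //=; exact: leq_ltn_trans li. Qed.

(** The sets [upper j] are nested, so for given [x] and [y] the differences of indicators all have
    the same sign and their absolute values add up. *)
Lemma sum_upper_dist x y : \sum_(j < N) `|\1_(upper j) y - \1_(upper j) x| =
  N%:R / 2 * `|level E sign_avg y - level E sign_avg x|.
Proof.
have -> : N%:R / 2 * `|level E sign_avg y - level E sign_avg x| =
    `|\sum_(j < N) (\1_(upper j) y - \1_(upper j) x)|.
  rewrite sumrB !sum_upper -mulrBr normrM ger0_norm ?divr_ge0 ?ltW //.
  by congr (_ * `|_|); ring.
have [a Eax] := partition_ex Epart x; have [b Eby] := partition_ex Epart y.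
have [ab|/ltnW ba] := leqP a b.
  have h j : 0 <= \1_(upper j) y - \1_(upper j) x :> R.
    rewrite (indic_upper _ Eax) (indic_upper _ Eby) subr_ge0 ler_nat.
    by case: ltnP => // ja; rewrite (leq_trans ja ab).
  rewrite ger0_norm; last by apply: sumr_ge0.
  by apply: eq_bigr => j _; rewrite ger0_norm.
have h j : \1_(upper j) y - \1_(upper j) x <= 0 :> R.
  rewrite (indic_upper _ Eax) (indic_upper _ Eby) subr_le0 ler_nat.
  by case: ltnP => // jb; rewrite (leq_trans jb ba).
rewrite ler0_norm; last by apply: sumr_le0.
by rewrite -sumrN; apply: eq_bigr => j _; rewrite ler0_norm.
Qed.

Let blevel : bounded_mfun (level E sign_avg).
Proof. exact: bounded_mfun_level. Qed.

Let bupper j : bounded_mfun (\1_(upper j) : T -> R).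
Proof. exact/bounded_mfun_indic/measurable_upper. Qed.

(** The level function is affine in the sum of [N] nested indicators. By nestedness the covariance
    of two of them is at most the variance of either, so the variance of the sum is at most [N]
    times the sum of the variances. *)
Lemma level_variance :
  level_corr E sign_avg 1%g - Ex P (level E sign_avg) ^+ 2 <=
  4 / N%:R * \sum_j pr P (upper j) * (1 - pr P (upper j)).
Proof.
rewrite -(Ex_level_sqr sign_avg Epart).
set S := fun x => \sum_(j < N) \1_(upper j) x : R.
have SE x : level E sign_avg x = 2 / N%:R * S x + (-1).
  by rewrite /S sum_upper; field; rewrite gt_eqF.
have bS : bounded_mfun S by exact: bounded_mfun_sum.
have bSS : bounded_mfun (fun x => S x * S x) by exact: bounded_mfunM.
have ES : Ex P S = \sum_j pr P (upper j).
  by rewrite Ex_sum //; apply: eq_bigr => j _; rewrite Ex_indic //; exact: measurable_upper.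
have ESS : Ex P (fun x => S x * S x) = \sum_j \sum_l pr P (upper j `&` upper l).
  rewrite (_ : (fun x => _) = (fun x => \sum_j \sum_l \1_(upper j `&` upper l) x)); last first.
    apply/funext => x; rewrite /S mulr_suml; apply: eq_bigr => j _.
    by rewrite mulr_sumr; apply: eq_bigr => l _; rewrite indicM.
  have mm j l : measurable (upper j `&` upper l) by apply: measurableI; exact: measurable_upper.
  rewrite Ex_sum; last by move=> j; apply: bounded_mfun_sum => l; exact: bounded_mfun_indic.
  apply: eq_bigr => j _; rewrite Ex_sum; last by move=> l; exact: bounded_mfun_indic.
  by apply: eq_bigr => l _; rewrite Ex_indic.
have -> : Ex P (fun x => level E sign_avg x ^+ 2) =
    4 / N%:R ^+ 2 * Ex P (fun x => S x * S x) - 4 / N%:R * Ex P S + 1.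
  rewrite (_ : (fun x => _) = (fun x => 4 / N%:R ^+ 2 * (S x * S x) +
     (- (4 / N%:R) * S x + 1))); last first.
    by apply/funext => x; rewrite SE; field; rewrite gt_eqF.
  have b1 := bounded_mfunZ (4 / N%:R ^+ 2) bSS.
  have b2 := bounded_mfunZ (- (4 / N%:R)) bS.
  have b3 := @bounded_mfun_cst _ T R 1.
  rewrite (ExD _ b1 (bounded_mfunD b2 b3)) (ExD _ b2 b3) !ExZ // Ex_cst; ring.
have -> : Ex P (level E sign_avg) = 2 / N%:R * Ex P S - 1.
  rewrite (_ : level E sign_avg = (fun x => 2 / N%:R * S x + (-1))); last first.
    by apply/funext => x; rewrite SE.
  have b2 := bounded_mfunZ (2 / N%:R) bS.
  by rewrite (ExD _ b2 (@bounded_mfun_cst _ T R (-1))) ExZ // Ex_cst.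
have cov j l : pr P (upper j `&` upper l) - pr P (upper j) * pr P (upper l) <=
    pr P (upper j) * (1 - pr P (upper j)).
  have mu := measurable_upper.
  have pj0 := pr_ge0 P (upper j); have pj1 := pr_le1 P (mu j).
  have pl0 := pr_ge0 P (upper l); have pl1 := pr_le1 P (mu l).
  have [jl|/ltnW lj] := leqP j l.
    have -> : upper j `&` upper l = upper l by apply/setIidPr; exact: upper_mono.
    have := le_pr P (mu l) (mu j) (upper_mono jl); nra.
  have -> : upper j `&` upper l = upper j by apply/setIidPl; exact: upper_mono.
  have := le_pr P (mu j) (mu l) (upper_mono lj); nra.
have -> : 4 / N%:R * \sum_j pr P (upper j) * (1 - pr P (upper j)) =
    4 / N%:R ^+ 2 * \sum_(j < N) \sum_(l < N) pr P (upper j) * (1 - pr P (upper j)).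
  under [in RHS]eq_bigr do rewrite sumr_const card_ord -[X in X *+ _]mulr1 -mulrnAr.
  by rewrite -mulr_suml; field; rewrite gt_eqF.
have -> : 4 / N%:R ^+ 2 * Ex P (fun x => S x * S x) - 4 / N%:R * Ex P S + 1 -
    (2 / N%:R * Ex P S - 1) ^+ 2 =
    4 / N%:R ^+ 2 * (Ex P (fun x => S x * S x) - Ex P S * Ex P S).
  by field; rewrite gt_eqF.
apply: ler_wpM2l; first by rewrite divr_ge0 ?exprn_ge0 ?ltW.
rewrite ESS ES mulr_suml -sumrB; apply: ler_sum => j _.
by rewrite mulr_sumr -sumrB; apply: ler_sum => l _; exact: cov.
Qed.

Lemma sum_displacement g : \sum_j displacement g (upper j) =
  N%:R / 2 * Ex P (fun x => `|level E sign_avg (act g^-1%g x) - level E sign_avg x|).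
Proof.
have bg j : bounded_mfun (fun x => `|\1_(upper j) (act g^-1%g x) - \1_(upper j) x| : R).
  by apply/bounded_mfun_norm/bounded_mfunB => //; exact: bounded_mfun_act.
rewrite -Ex_sum // -ExZ; last first.
  by apply/bounded_mfun_norm/bounded_mfunB => //; exact: bounded_mfun_act.
by congr Ex; apply/funext => x; rewrite sum_upper_dist.
Qed.

Lemma level_corr_le1 : level_corr E sign_avg 1%g <= 1.
Proof.
rewrite -(Ex_level_sqr sign_avg Epart) -(Ex_cst P 1).
apply: Ex_le; first by under eq_fun do rewrite expr2; exact: bounded_mfunM.
  exact: bounded_mfun_cst.
move=> x; have [i Eix] := partition_ex Epart x.
rewrite (levelE _ Epart Eix) /sign_avg -mulrA.
have : 0 <= i%:R / N%:R :> R by rewrite divr_ge0.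
have : i%:R / N%:R <= 1 :> R by rewrite ler_pdivrMr // mul1r ler_nat -ltnS.
set y := _ / _; nra.
Qed.

(** The last hypothesis is a lower bound on [corr_gap]. It makes the variance at least [kappa] and,
    correlations being at most 1, makes each translate of the level function within [t^-1] of it in
    mean square norm. Averaging over the upper level sets then finds one with both properties. *)
Lemma almost_invariant_level (Q : seq G) (c : seq (R * G)) (kappa t delta : R) :
  0 < kappa -> 0 < t -> 0 < delta -> (size Q)%:R < kappa * delta * t ->
  \sum_(p <- c) p.1 = 1 ->
  kappa <= level_corr E sign_avg 1%g
    - \sum_(p <- c) \sum_(q <- c) p.1 * q.1 * level_corr E sign_avg (q.2^-1 * p.2)%g
    - 2 * t ^+ 2 * \sum_(g <- Q) (level_corr E sign_avg 1%g - level_corr E sign_avg g) ->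
  exists D : set T, [/\ measurable D, kappa / 8 <= pr P D * (1 - pr P D) &
    forall g, g \in Q -> displacement g D <= delta].
Proof.
move=> k0 t0 d0 Qsmall c1.
have bg g : bounded_mfun (fun x => level E sign_avg (act g^-1%g x)) by exact: bounded_mfun_act.
have diff_ge0 g : 0 <= level_corr E sign_avg 1%g - level_corr E sign_avg g.
  rewrite -(pmulr_rge0 _ (ltr0Sn R 1)) -(Ex_level_diff_sqr sign_avg Epart).
  by apply: Ex_ge0 => x; exact: sqr_ge0.
have avg := level_corr_avg sign_avg Epart c1.
have := level_variance; have := level_corr_le1.
set Q1 := level_corr E sign_avg 1%g in diff_ge0 *.
set A := \sum_(p <- c) _ in avg *; set L := \sum_(g <- Q) _.
move=> Q1le var hyp.
have A0 : 0 <= A by apply: le_trans avg; exact: sqr_ge0.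
have L0 : 0 <= L by apply: sumr_ge0.
have Lle : 2 * t ^+ 2 * L <= 1 by lra.
have step g : g \in Q -> \sum_j displacement g (upper j) <= N%:R / 2 * t^-1.
  move=> gQ; rewrite sum_displacement ler_wpM2l ?divr_ge0 ?(ltW NR) //.
  have gL : 2 * t ^+ 2 * (Q1 - level_corr E sign_avg g) <= 1.
    apply: le_trans Lle; rewrite ler_wpM2l ?mulr_ge0 ?exprn_ge0 ?(ltW t0) //.
    by rewrite /L (big_rem g) //= lerDl; apply: sumr_ge0.
  have bd : bounded_mfun (fun x => level E sign_avg (act g^-1%g x) - level E sign_avg x).
    exact: bounded_mfunB.
  have bd2 : bounded_mfun (fun x => (level E sign_avg (act g^-1%g x) - level E sign_avg x) ^+ 2).
    by under eq_fun do rewrite expr2; exact: bounded_mfunM.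
  (* AM-GM: [2 |u| <= t u^2 + 1 / t] *)
  apply: le_trans (_ : Ex P (fun x => t / 2 *
    (level E sign_avg (act g^-1%g x) - level E sign_avg x) ^+ 2 + (2 * t)^-1) <= _).
    apply: Ex_le; first exact: bounded_mfun_norm.
      by apply: bounded_mfunD; [exact: bounded_mfunZ|exact: bounded_mfun_cst].
    move=> x; set u := _ - _.
    have : 0 <= (t * `|u| - 1) ^+ 2 / (2 * t) by rewrite divr_ge0 ?sqr_ge0 ?mulr_ge0 ?ltW.
    rewrite (_ : _ / _ = t / 2 * `|u| ^+ 2 + (2 * t)^-1 - `|u|); last by field; rewrite gt_eqF.
    by rewrite real_normK ?num_real // subr_ge0.
  rewrite (ExD _ (bounded_mfunZ _ bd2) (@bounded_mfun_cst _ T R _)) ExZ // Ex_cst.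
  rewrite (Ex_level_diff_sqr sign_avg Epart) -/Q1.
  have : t / 2 * (2 * (Q1 - level_corr E sign_avg g)) <= (2 * t)^-1.
    rewrite -(ler_pM2l (_ : 0 < 2 * t)) ?mulr_gt0 // mulfV ?gt_eqF ?mulr_gt0 //.
    by apply: le_trans gL; rewrite le_eqVlt; apply/orP; left; apply/eqP; field.
  have : (2 * t)^-1 + (2 * t)^-1 = t^-1 by field; rewrite gt_eqF.
  lra.
(* On average over [j], the first term is at least [kappa / 4] and the last is less than
   [kappa / 8]. *)
have [j hj] : exists j : 'I_N, 0 < pr P (upper j) * (1 - pr P (upper j)) - kappa / 8 -
    (4 * delta)^-1 * \sum_(g <- Q) displacement g (upper j).
  apply: contrapT => /forallNP h.
  have : \sum_(j < N) (pr P (upper j) * (1 - pr P (upper j)) - kappa / 8 -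
      (4 * delta)^-1 * \sum_(g <- Q) displacement g (upper j)) <= 0.
    by apply: sumr_le0 => j _; rewrite leNgt; apply/negP/h.
  rewrite !sumrB sumr_const card_ord -mulr_sumr exchange_big /=.
  have s1 : \sum_(g <- Q) \sum_j displacement g (upper j) <= (size Q)%:R * (N%:R / 2 * t^-1).
    rewrite -sum1_size natr_sum mulr_suml big_seq [leRHS]big_seq.
    by apply: ler_sum => g gQ; rewrite mul1r step.
  have s2 : kappa * N%:R / 4 <= \sum_j pr P (upper j) * (1 - pr P (upper j)).
    have : kappa <= 4 / N%:R * \sum_j pr P (upper j) * (1 - pr P (upper j)).
      apply: le_trans var; have := mulr_ge0 (mulr_ge0 (ler0n R 2) (exprn_ge0 2 (ltW t0))) L0.
      lra.
    set X := \sum_j _; rewrite mulrAC ler_pdivlMr // => h'; lra.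
  have s3 : (4 * delta)^-1 * \sum_(g <- Q) \sum_j displacement g (upper j) < kappa * N%:R / 8.
    apply: le_lt_trans (ler_wpM2l _ s1) _; first by rewrite invr_ge0 mulr_ge0 ?ltW.
    rewrite (_ : (4 * delta)^-1 * ((size Q)%:R * (N%:R / 2 * t^-1)) =
      (size Q)%:R * (N%:R / (8 * delta * t))); last first.
      by field; rewrite !gt_eqF.
    rewrite (_ : kappa * N%:R / 8 = kappa * delta * t * (N%:R / (8 * delta * t))); last first.
      by field; rewrite !gt_eqF.
    by rewrite ltr_pM2r // divr_gt0 // !mulr_gt0.
  rewrite -mulr_natr; lra.
have disp0 : 0 <= \sum_(g <- Q) displacement g (upper j).
  by apply: sumr_ge0 => g _; exact: displacement_ge0.
have mj := measurable_upper j.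
have i0 : 0 < (4 * delta)^-1 by rewrite invr_gt0 mulr_gt0.
exists (upper j); split => //.
  have := mulr_ge0 (ltW i0) disp0; lra.
move=> g gQ; apply: le_trans (_ : \sum_(g <- Q) displacement g (upper j) <= _).
  by rewrite (big_rem g) //= lerDl; apply: sumr_ge0 => h _; exact: displacement_ge0.
(* Since [x (1 - x)] is at most 1/4, the choice of [j] bounds the whole sum of displacements by
   [delta]. *)
have : (4 * delta)^-1 * \sum_(g <- Q) displacement g (upper j) <= 4^-1.
  have := sqr_ge0 (pr P (upper j) - 2^-1); lra.
rewrite -(ler_pM2l (_ : 0 < 4 * delta)) ?mulr_gt0 // mulrA mulfV ?gt_eqF ?mulr_gt0 // mul1r.
by move=> h; apply: le_trans h _; rewrite mulrC mulKf.
Qed.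

End UpperLevels.
End ActionLevels.

(** * The correlation gap *)

Section CorrelationProfile.
Variable R : realType.

(** This is [sinh x / e], the expectation of [sin X sin Y] for centered Gaussian variables of
    variance 1 and covariance [x]. *)
Definition profile (x : R) : R := (expR (x - 1) - expR (- x - 1)) / 2.

(** This bound transfers almost invariance from the orbit to the coins; the reverse bound
    [profile_lower] transfers the distance to constants. *)
Lemma profile_upper x : -1 <= x <= 1 -> profile 1 - profile x <= 1 - x.
Proof.
move=> /andP[x1 x2]; rewrite /profile subrr expR0.
have h1 := expR_ge1Dx (x - 1).
have -> : expR (- x - 1) = expR (- 1 - 1) * expR (1 - x).
  by rewrite -expRD; congr expR; ring.
have h2 := expR_ge1Dx (- (1 - x)).
have e0 : 0 < expR (1 - x) :> R by exact: expR_gt0.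
have h3 : expR (1 - x) - 1 <= expR (1 - x) * (1 - x).
  have : expR (1 - x) * (1 + - (1 - x)) <= expR (1 - x) * expR (- (1 - x)).
    by rewrite ler_pM2l.
  by rewrite -expRD subrr expR0; lra.
have h4 : expR (- 1 - 1) * (expR (1 - x) - 1) <= 1 - x.
  apply: le_trans (ler_wpM2l (expR_ge0 _) h3) _.
  rewrite mulrA -expRD -[leRHS]mul1r ler_wpM2r ?subr_ge0 //.
  by rewrite -[leRHS]expR0 ler_expR; lra.
rewrite mulrBr mulr1 in h4; lra.
Qed.

Lemma profile_lower x : -1 <= x <= 1 -> expR (- 2) / 2 * (1 - x) <= profile 1 - profile x.
Proof.
move=> /andP[x1 x2]; rewrite /profile subrr expR0.
have -> : expR (- x - 1) = expR (- 2) * expR (1 - x).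
  by rewrite -expRD; congr expR; ring.
have -> : expR (- 1 - 1) = expR (- 2) :> R by congr expR; ring.
have h1 : expR (x - 1) <= 1 by rewrite -[leRHS]expR0 ler_expR; lra.
have h2 := expR_ge1Dx (1 - x).
have h3 : expR (- 2) * (1 + (1 - x)) <= expR (- 2) * expR (1 - x) by rewrite ler_pM2l ?expR_gt0.
rewrite mulrDr mulr1 in h3; lra.
Qed.

Lemma profile1_bounds : 0 <= profile 1 <= 1.
Proof.
rewrite /profile subrr expR0; have := expR_ge0 (- 1 - 1 : R).
have : expR (- 1 - 1 : R) <= 1 by rewrite -[leRHS]expR0 ler_expR; lra.
by move=> h1 h2; apply/andP; split; lra.
Qed.

End CorrelationProfile.

(* Positive when [q] is far from constant on average while [q g] is close to
   [q 1] for [g] in [Q]. *)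
Definition corr_gap (R : realType) (G : groupType) (q : G -> R) (Q : seq G)
    (c : seq (R * G)) (t : R) : R :=
  q 1%g - \sum_(p <- c) \sum_(p' <- c) p.1 * p'.1 * q (p'.2^-1 * p.2)%g
  - 2 * t ^+ 2 * \sum_(g <- Q) (q 1%g - q g).

Lemma convex_weights_ge0 (R : realType) (T : eqType) (c : seq (R * T)) p :
  convex_weights c -> p \in c -> 0 <= p.1.
Proof.
move=> [c0 _] /(nthP p)[j jc <-]; rewrite -(nth_map _ 0) //; exact: c0.
Qed.

Lemma convex_weights_sum2 (R : realType) (T : Type) (c : seq (R * T)) :
  convex_weights c -> \sum_(p <- c) \sum_(q <- c) p.1 * q.1 = 1.
Proof.
move=> [_ c1]; under eq_bigr do rewrite -mulr_sumr c1 mulr1.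
exact: c1.
Qed.

Lemma convex_weights_le (R : realType) (T : eqType) (c : seq (R * T))
    (f f' : T -> T -> R) : convex_weights c ->
  (forall p q, p \in c -> q \in c -> f p.2 q.2 <= f' p.2 q.2) ->
  \sum_(p <- c) \sum_(q <- c) p.1 * q.1 * f p.2 q.2 <=
  \sum_(p <- c) \sum_(q <- c) p.1 * q.1 * f' p.2 q.2.
Proof.
move=> cc ff'; rewrite big_seq [leRHS]big_seq; apply: ler_sum => p pc.
rewrite big_seq [leRHS]big_seq; apply: ler_sum => q qc.
by rewrite ler_wpM2l ?ff' // mulr_ge0 // (convex_weights_ge0 cc).
Qed.

Lemma convex_weights_affine (R : realType) (T : eqType) (c : seq (R * T))
    (f : T -> T -> R) (a b : R) : convex_weights c ->
  \sum_(p <- c) \sum_(q <- c) p.1 * q.1 * (a + b * f p.2 q.2) =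
  a + b * \sum_(p <- c) \sum_(q <- c) p.1 * q.1 * f p.2 q.2.
Proof.
move=> cc; rewrite -{2}[a]mulr1 -(convex_weights_sum2 cc) !mulr_sumr -big_split /=.
apply: eq_bigr => p _; rewrite !mulr_sumr -big_split /=; apply: eq_bigr => q _; ring.
Qed.

(** The first two terms each move by at most [e], the weights [c] summing to 1; each difference in
    the penalty moves by at most [2 * e]. *)
Lemma corr_gap_close (R : realType) (G : groupType) (q q' : G -> R) Q c t e :
  convex_weights c ->
  (forall g, g \in Q -> `|q g - q' g| <= e) -> `|q 1%g - q' 1%g| <= e ->
  (forall p p', p \in c -> p' \in c ->
    `|q (p'.2^-1 * p.2)%g - q' (p'.2^-1 * p.2)%g| <= e) ->
  corr_gap q Q c t <= corr_gap q' Q c t + (2 + 4 * t ^+ 2 * (size Q)%:R) * e.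
Proof.
move=> cc hQ h1 hc; rewrite /corr_gap.
have s1 : \sum_(p <- c) \sum_(p' <- c) p.1 * p'.1 * q' (p'.2^-1 * p.2)%g <=
    e + 1 * \sum_(p <- c) \sum_(p' <- c) p.1 * p'.1 * q (p'.2^-1 * p.2)%g.
  rewrite -(convex_weights_affine (fun g g' => q (g'^-1 * g)%g) _ _ cc).
  apply: (convex_weights_le (f := fun g g' => q' (g'^-1 * g)%g)
    (f' := fun g g' => e + 1 * q (g'^-1 * g)%g)) => // p p' pc pc'.
  by have := hc p p' pc pc'; rewrite ler_norml mul1r => /andP[h _]; lra.
have s2 : \sum_(g <- Q) (q' 1%g - q' g) <= \sum_(g <- Q) (q 1%g - q g) + (size Q)%:R * (2 * e).
  rewrite -sum1_size natr_sum mulr_suml -big_split /= big_seq [leRHS]big_seq.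
  apply: ler_sum => g gQ; have := hQ g gQ; have := h1.
  by rewrite !ler_norml => /andP[a b] /andP[a' b']; lra.
have t2 : 0 <= t ^+ 2 by exact: sqr_ge0.
have := ler_wpM2l t2 s2; rewrite mulrDr.
by move: h1; rewrite ler_norml => /andP[_ h1]; lra.
Qed.

(** * Correlations of the average of coins *)

Section SignLevels.
Variables (R : realType) (G : groupType) (V : zmodType) (B : V -> V -> R).
Variables (rho : G -> V -> V) (v : V).
Hypotheses (Bc : forall a b, B a b = B b a)
  (BD : forall a b c, B (a + b) c = B a c + B b c)
  (Bpsd : psd B)
  (rhoM : forall g h a, rho (g * h)%g a = rho g (rho h a))
  (rhoD : forall g a b, rho g (a + b) = rho g a + rho g b)
  (rhoB : forall g a b, B (rho g a) (rho g b) = B a b)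
  (rho1v : rho 1%g v = v) (Bvv : B v v = 1).
Variables (site : nat -> G * nat) (index : G * nat -> nat).
Hypotheses (siteK : cancel site index) (indexK : cancel index site).

Local Notation X := (borel_binseq R).
Local Notation wt := (weight B (fun s : G * nat => rho s.1 v)).

Lemma coin_measure : exists mu : probability X R,
  forall w, mu (@prefix_set R w) = (wt (signed_sites site w))%:E.
Proof.
apply: tree_measure => [|w|w].
- by rewrite /signed_sites /= weight_nil.
- exact: weight_ge0.
- rewrite !signed_sites_rcons (weight_split _ _ (site (size w))).
  by congr (_ + _); apply: weight_perm; rewrite // perm_sym perm_rcons.
Qed.

Variable mu : probability X R.
Hypothesis muE : forall w, mu (@prefix_set R w) = (wt (signed_sites site w))%:E.

Let shiftP := shift_measure_preserving rhoM rhoD rhoB siteK indexK muE.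

Definition sgb (b : bool) : R := if b then 1 else -1.

Local Notation Y s := (fun x : X => sgb (coin index s x)).

Lemma bounded_mfun_coin s : bounded_mfun (Y s).
Proof.
rewrite (_ : Y s = fun x => 2 * \1_[set x | coin index s x = true] x + (-1)); last first.
  apply/funext => x; rewrite indicE; case E : (coin index s x).
    by rewrite mem_set //= /sgb; ring.
  by rewrite memNset //= ?E // /sgb; ring.
apply: bounded_mfunD; last exact: bounded_mfun_cst.
by apply/bounded_mfunZ/bounded_mfun_indic; exact: measurable_coin.
Qed.

Definition covar (g h : G) : R := B (rho g v) (rho h v).

Lemma covar_gg g : covar g g = 1.
Proof. by rewrite /covar rhoB. Qed.

Lemma covarV g h : covar (h^-1 * g)%g 1%g = covar g h.
Proof. by rewrite /covar -(rhoB h) -!rhoM mulVKg mulg1. Qed.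

Lemma covar_bounds g h : -1 <= covar g h <= 1.
Proof.
have psd2 l := Bpsd [:: (1, rho g v); (l, rho h v)].
have h1 := psd2 1; have h2 := psd2 (-1).
rewrite !big_cons !big_nil /= !rhoB !Bvv (Bc (rho h v)) -/(covar g h) in h1 h2.
by apply/andP; split; lra.
Qed.

(** Distinct coins over one group element share their conditional mean but are tossed separately, so
    they have correlation [profile 1]; only a coin with itself gives 1. *)
Lemma coin_corr s s' : Ex mu (fun x : X => sgb (coin index s x) * sgb (coin index s' x)) =
  if s == s' then 1 else profile (covar s.1 s'.1).
Proof.
case: eqP => [->|ss].
  rewrite -(Ex_cst mu 1); congr Ex; apply/funext => x; rewrite /sgb.
  by case: coin; rewrite ?mulrNN mulr1.
pose C b b' : set X := cylinder index [:: (s, b); (s', b')].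
have mC b b' : measurable (C b b') by exact: measurable_cylinder.
have CE b b' x : \1_(C b b') x = ((coin index s x == b) && (coin index s' x == b'))%:R :> R.
  rewrite indicE; congr (nat_of_bool _)%:R; apply/idP/idP.
    rewrite inE => h; rewrite (h (s, b)) ?(h (s', b')) ?inE ?eqxx ?orbT //.
  move=> /andP[/eqP h1 /eqP h2]; rewrite inE => p.
  by rewrite !inE => /orP[] /eqP ->.
have prC b b' : pr mu (C b b') = wt [:: (s, b); (s', b')].
  rewrite /pr (cylinder_measure siteK indexK muE) //=.
  by rewrite inE andbT; apply/eqP.
rewrite (_ : (fun x => _) = (fun x => (\1_(C true true) x + \1_(C false false) x) -
   (\1_(C true false) x + \1_(C false true) x))); last first.
  apply/funext => x; rewrite !CE /sgb.
  by case: (coin index s x); case: (coin index s' x) => /=; ring.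
have bC b b' : bounded_mfun (\1_(C b b') : X -> R) by exact: bounded_mfun_indic.
rewrite ExB ?ExD ?Ex_indic ?prC //; try exact: bounded_mfunD.
have := weight_pair Bc BD (fun s : G * nat => rho s.1 v) s s'.
rewrite (BBB Bc BD) (BDD Bc BD) !rhoB Bvv -/(covar s.1 s'.1) /profile.
rewrite (_ : - ((1 + 1 - 2 * covar s.1 s'.1) / 2) = covar s.1 s'.1 - 1); last by field.
rewrite (_ : - ((1 + 1 + 2 * covar s.1 s'.1) / 2) = - covar s.1 s'.1 - 1); last by field.
by move=> <-; ring.
Qed.

Variable N : nat.
Hypothesis N0 : (0 < N)%N.
Let NR : (0 : R) < N%:R. Proof. by rewrite ltr0n. Qed.

Definition heads (x : X) : nat := \sum_(k < N) coin index (1%g, k : nat) x.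

Lemma heads_lt x : (heads x < N.+1)%N.
Proof.
rewrite ltnS /heads; apply: leq_trans (_ : \sum_(k < N) 1 <= _)%N.
  by apply: leq_sum => k _; exact: leq_b1.
by rewrite sum1_card card_ord.
Qed.

(** Weak containment speaks of finite partitions, which is why the average of finitely many coins
    replaces their conditional mean. *)
Definition heads_set (j : 'I_N.+1) : set X := [set x | heads x = j].

Lemma measurable_heads_set j : measurable (heads_set j).
Proof.
have mh : measurable_fun [set: X]
    (fun x => \sum_(k < N) \1_[set x | coin index (1%g, k : nat) x = true] x : R).
  apply: (bounded_mfun_sum _ _).1 => k; apply: bounded_mfun_indic.
  exact: measurable_coin.
rewrite (_ : heads_set j = (fun x => \sum_(k < N)
    \1_[set x | coin index (1%g, k : nat) x = true] x : R) @^-1` [set j%:R]).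
  by rewrite -[_ @^-1` _]setTI; apply: mh => //; exact: measurable_set1.
have E x : \sum_(k < N) \1_[set x | coin index (1%g, k : nat) x = true] x = (heads x)%:R :> R.
  rewrite /heads natr_sum; apply: eq_bigr => k _; rewrite indicE.
  case E : (coin index (1%g, k : nat) x); first by rewrite mem_set.
  by rewrite memNset //= E.
apply/seteqP; split=> x /=; rewrite E; first by move=> ->.
by move=> /eqP; rewrite eqr_nat => /eqP.
Qed.

Lemma heads_partition : measurable_partition heads_set.
Proof.
split; first exact: measurable_heads_set.
  by move=> i j _ _ [x [/= hi hj]]; apply: val_inj; rewrite /= -hi -hj.
by apply/seteqP; split=> // x _; exists (Ordinal (heads_lt x)).
Qed.

Lemma level_heads x : level heads_set (@sign_avg R N) x =
  N%:R^-1 * \sum_(k < N) sgb (coin index (1%g, k : nat) x).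
Proof.
rewrite (levelE _ heads_partition (i := Ordinal (heads_lt x))) //.
rewrite /sign_avg /= /heads natr_sum.
have -> : \sum_(k < N) sgb (coin index (1%g, k : nat) x) =
    2 * (\sum_(k < N) (coin index (1%g, k : nat) x)%:R) - N%:R.
  have -> : N%:R = \sum_(k < N) 1 :> R by rewrite sumr_const card_ord.
  rewrite mulr_sumr -sumrB; apply: eq_bigr => k _.
  by rewrite /sgb; case: coin => /=; ring.
by field; rewrite gt_eqF.
Qed.

Local Notation lc := (level_corr mu (@shift R G site index) heads_set (@sign_avg R N)).

(** The product of two averages runs over [N ^ 2] pairs of coins. For [g = 1] the [N] diagonal pairs
    repeat one coin, an excess over [profile] that tends to 0 as [N] grows. *)
Lemma level_corr_heads g : lc g = profile (covar g 1%g) +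
  (g == 1%g)%:R * (1 - profile (covar g 1%g)) / N%:R.
Proof.
have := level_corrE shiftP (@sign_avg R N) heads_partition g 1%g.
rewrite !invg1 mul1g => ->.
have E x : level heads_set (@sign_avg R N) (shift site index g^-1%g x) *
    level heads_set (@sign_avg R N) (shift site index 1%g x) =
    \sum_(k < N) \sum_(l < N) N%:R^-1 ^+ 2 *
      (sgb (coin index (g, k : nat) x) * sgb (coin index (1%g, l : nat) x)).
  rewrite !level_heads mulrACA -expr2 mulr_suml mulr_sumr; apply: eq_bigr => k _.
  rewrite mulr_sumr mulr_sumr; apply: eq_bigr => l _.
  by rewrite !(coin_shift indexK) /transl_site /= invgK invg1 mulg1 mul1g.
rewrite (_ : (fun x => _) = (fun x => \sum_(k < N) \sum_(l < N) N%:R^-1 ^+ 2 *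
      (sgb (coin index (g, k : nat) x) * sgb (coin index (1%g, l : nat) x)))); last first.
  by apply/funext => x; rewrite E.
have bb (k l : nat) : bounded_mfun
    (fun x : X => sgb (coin index (g, k) x) * sgb (coin index (1%g, l) x)).
  by apply: bounded_mfunM; exact: bounded_mfun_coin.
rewrite Ex_sum; last by move=> k; apply: bounded_mfun_sum => l; exact: bounded_mfunZ.
rewrite (eq_bigr (fun k : 'I_N => \sum_(l < N) N%:R^-1 ^+ 2 *
   (profile (covar g 1%g) + (g == 1%g)%:R * (1 - profile (covar g 1%g)) *
     (l == k)%:R))); last first.
  move=> k _; rewrite Ex_sum; last by move=> l; exact: bounded_mfunZ.
  apply: eq_bigr => l _; rewrite ExZ // coin_corr xpair_eqE /=; congr (_ * _).
  have -> : (k == l :> nat) = (l == k) by rewrite eq_sym.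
  by case: eqP => _; case: eqP => _ /=; ring.
rewrite (eq_bigr (fun=> N%:R^-1 ^+ 2 * (profile (covar g 1%g) * N%:R +
   (g == 1%g)%:R * (1 - profile (covar g 1%g))))); last first.
  move=> k _; have s1 : \sum_(l < N) (l == k)%:R = 1 :> R.
    by rewrite (bigD1 k) //= eqxx big1 ?addr0 // => l /negbTE ->.
  rewrite -mulr_sumr big_split /= sumr_const card_ord mulr_natr.
  by rewrite -[X in _ * (_ + X) = _]mulr_sumr s1 mulr1.
by rewrite sumr_const card_ord -[X in X = _]mulr_natr; field; rewrite gt_eqF.
Qed.

(** Let [e2] be [expR (- 2)]. By [profile_lower] the averaged correlations fall below [profile 1] by
    at least [e2 / 2 - e2 / 8 - N^-1], hence by [e2 / 4], and the penalty takes away at most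
    [e2 / 8]. *)
Lemma corr_gap_heads (Q : seq G) (c : seq (R * G)) (t e : R) :
  convex_weights c -> (forall g, g \in Q -> 1 - covar g 1%g <= e) ->
  \sum_(p <- c) \sum_(q <- c) p.1 * q.1 * covar p.2 q.2 <= 4^-1 ->
  N%:R^-1 <= @expR R (- 2) / 8 -> N%:R^-1 <= e -> 0 <= e ->
  2 * t ^+ 2 * (size Q)%:R * (2 * e) <= @expR R (- 2) / 8 ->
  @expR R (- 2) / 8 <= corr_gap lc Q c t.
Proof.
move=> cc Qe csmall N1 N2 e0 te; rewrite /corr_gap.
have Ninv : 0 < N%:R^-1 :> R by rewrite invr_gt0.
have /andP[p1 p2] := profile1_bounds R.
have lc1 : lc 1%g = profile 1 + (1 - profile 1) / N%:R.
  by rewrite level_corr_heads covar_gg eqxx mul1r.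
have lc1_ge : profile 1 <= lc 1%g by rewrite lc1 lerDl divr_ge0 ?subr_ge0 // ltW.
have pN : (1 - profile 1) / N%:R <= N%:R^-1 :> R.
  by rewrite ler_piMl ?(ltW Ninv) // lerBlDr lerDl.
have lc_ge g : profile (covar g 1%g) <= lc g.
  rewrite level_corr_heads; case: eqP => [->|_]; last by rewrite !mul0r addr0.
  by rewrite covar_gg mul1r lerDl divr_ge0 ?subr_ge0 // ltW.
have lc_le g : lc g <= profile (covar g 1%g) + N%:R^-1.
  rewrite level_corr_heads; case: eqP => [->|_].
    by rewrite covar_gg mul1r lerD2l.
  by rewrite !mul0r addr0 lerDl ltW.
have s1 : \sum_(p <- c) \sum_(p' <- c) p.1 * p'.1 * lc (p'.2^-1 * p.2)%g <=
    (profile 1 - @expR R (- 2) / 2 + N%:R^-1) + @expR R (- 2) / 2 *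
    \sum_(p <- c) \sum_(q <- c) p.1 * q.1 * covar p.2 q.2.
  rewrite -(convex_weights_affine covar _ _ cc).
  apply: (convex_weights_le (f := fun g g' => lc (g'^-1 * g)%g)
    (f' := fun g g' => profile 1 - @expR R (- 2) / 2 + N%:R^-1 +
       @expR R (- 2) / 2 * covar g g')) => //.
  move=> p q pc qc; apply: le_trans (lc_le _) _; rewrite covarV.
  have := profile_lower (covar_bounds p.2 q.2); rewrite mulrBr mulr1; lra.
have s2 : \sum_(g <- Q) (lc 1%g - lc g) <= (size Q)%:R * (2 * e).
  rewrite -sum1_size natr_sum mulr_suml big_seq [leRHS]big_seq.
  apply: ler_sum => g gQ; have := profile_upper (covar_bounds g 1%g).
  have := Qe g gQ; have := lc_ge g; lra.
have t2 : 0 <= t ^+ 2 by exact: sqr_ge0.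
have := ler_wpM2l t2 s2.
have := ler_wpM2l (ltW (expR_gt0 (- 2))) csmall.
lra.
Qed.

End SignLevels.

(** * Almost invariant sets *)

Section ProductAction.
Variables (R : realType) (G : groupType).
Variables (dY : measure_display) (Y : measurableType dY) (P : probability Y R)
  (act : G -> Y -> Y).
Hypothesis actP : measure_preserving_action P act.
Variables (dZ : measure_display) (Z : measurableType dZ) (eta : probability Z R).

Local Notation PP := ((eta \x P)%E : probability (Z * Y)%type R).
Local Notation iact := (product_action (@identity_action G Z) act).

Lemma pr_xsection_bounded (S : set (Z * Y)) : measurable S ->
  bounded_mfun (fun z => pr P (xsection S z)).
Proof.
move=> mS; split; last first.
  exists 1 => z; rewrite ger0_norm ?pr_ge0 // pr_le1 //; exact: measurable_xsection.
apply/measurable_EFinP.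
rewrite (_ : _ \o _ = (fun z => P (xsection S z))).
  exact: measurable_fun_xsection.
by apply/funext => z /=; rewrite -prE //; exact: measurable_xsection.
Qed.

Lemma pr_product (S : set (Z * Y)) : measurable S ->
  pr PP S = Ex eta (fun z => pr P (xsection S z)).
Proof.
move=> mS; rewrite /pr /Ex /Rintegral; congr fine.
change (\int[eta]_z (P (xsection S z)) = \int[eta]_z (fine (P (xsection S z)))%:E)%E.
apply: eq_integral => z _; rewrite fineK // fin_num_measure //.
exact: measurable_xsection.
Qed.

Lemma measurable_partition_xsection k (B : 'I_k -> set (Z * Y)) z :
  measurable_partition B -> measurable_partition (fun i => xsection (B i) z).
Proof.
move=> [mB tB cB]; split.
- by move=> i; exact: measurable_xsection.
- move=> i j _ _ [y [/xsectionP h1 /xsectionP h2]].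
  by apply: (tB i j) => //; exists (z, y).
- apply/seteqP; split=> // y _.
  have : (\bigcup_i B i) (z, y) by rewrite cB.
  by move=> [i _ Bi]; exists i => //; apply/xsectionP.
Qed.

Lemma product_act_image g (S : set (Z * Y)) :
  iact g @` S = [set p | S (p.1, act g^-1%g p.2)].
Proof.
case: actP => act1 actM _ _.
apply/seteqP; split=> [_ [[z y] Szy <-]|[z y] /= Szy].
  by rewrite /product_action /identity_action /= -actM mulVg act1.
by exists (z, act g^-1%g y) => //; rewrite /product_action /identity_action /= -actM mulgV act1.
Qed.

Lemma xsection_act_image g (S S' : set (Z * Y)) z :
  xsection ((iact g @` S) `&` S') z = (act g @` xsection S z) `&` xsection S' z.
Proof.
by rewrite product_act_image (act_image actP) xsectionI; congr (_ `&` _).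
Qed.

Lemma measurable_product_act_image g (S : set (Z * Y)) :
  measurable S -> measurable (iact g @` S).
Proof.
move=> mS; rewrite product_act_image.
have mact : measurable_fun [set: (Z * Y)%type] (fun p : Z * Y => (p.1, act g^-1%g p.2)).
  apply: measurable_fun_pair; first exact: measurable_fst.
  by case: actP => _ _ mg _; apply: measurableT_comp (mg _) measurable_snd.
by rewrite -[X in measurable X]setTI; exact: mact.
Qed.

Lemma level_corr_product k (B : 'I_k -> set (Z * Y)) (val : 'I_k -> R) g :
  measurable_partition B ->
  bounded_mfun (fun z => level_corr P act (fun i => xsection (B i) z) val g) /\
  level_corr PP iact B val g =
  Ex eta (fun z => level_corr P act (fun i => xsection (B i) z) val g).
Proof.
move=> [mB _ _].
have mS i j : measurable ((iact g @` B i) `&` B j).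
  by apply: measurableI => //; exact: measurable_product_act_image.
have bS i j : bounded_mfun (fun z => val i * val j *
    pr P ((act g @` xsection (B i) z) `&` xsection (B j) z)).
  apply: bounded_mfunZ; have := pr_xsection_bounded (mS i j).
  by under eq_fun do rewrite xsection_act_image.
split; first by apply: bounded_mfun_sum => i; exact: bounded_mfun_sum.
rewrite /level_corr Ex_sum; last by move=> i; exact: bounded_mfun_sum.
apply: eq_bigr => i _; rewrite Ex_sum; last by move=> j; exact: bS.
apply: eq_bigr => j _; rewrite pr_product //.
under eq_fun do rewrite xsection_act_image.
rewrite ExZ //; have := pr_xsection_bounded (mS i j).
by under eq_fun do rewrite xsection_act_image.
Qed.

(** [corr_gap] is linear in the correlations, and those of a partition of the product are the
    integrals of those of its slices. *)
Lemma corr_gap_product k (B : 'I_k -> set (Z * Y)) (val : 'I_k -> R) Q c t :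
  measurable_partition B ->
  let q z := level_corr P act (fun i => xsection (B i) z) val in
  bounded_mfun (fun z => corr_gap (q z) Q c t) /\
  corr_gap (level_corr PP iact B val) Q c t = Ex eta (fun z => corr_gap (q z) Q c t).
Proof.
move=> Bp q.
have bq g : bounded_mfun (fun z => q z g) by exact: (level_corr_product val g Bp).1.
have Eq g : level_corr PP iact B val g = Ex eta (fun z => q z g).
  exact: (level_corr_product val g Bp).2.
have b1 : bounded_mfun (fun z => \sum_(p <- c) \sum_(p' <- c) p.1 * p'.1 * q z (p'.2^-1 * p.2)%g).
  by apply: bounded_mfun_sum => p; apply: bounded_mfun_sum => p'; exact: bounded_mfunZ.
have b2 : bounded_mfun (fun z => \sum_(g <- Q) (q z 1%g - q z g)).
  by apply: bounded_mfun_sum => g; exact: bounded_mfunB.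
have b3 := bounded_mfunZ (2 * t ^+ 2) b2.
split; first by apply: bounded_mfunB => //; exact: bounded_mfunB.
rewrite /corr_gap (ExB _ (bounded_mfunB (bq 1%g) b1) b3) (ExB _ (bq 1%g) b1) Eq ExZ //.
congr (_ - _ - _ * _).
  rewrite Ex_sum; last by move=> p; apply: bounded_mfun_sum => p'; exact: bounded_mfunZ.
  apply: eq_bigr => p _; rewrite Ex_sum; last by move=> p'; exact: bounded_mfunZ.
  by apply: eq_bigr => p' _; rewrite ExZ // Eq.
rewrite Ex_sum; last by move=> g; exact: bounded_mfunB.
by apply: eq_bigr => g _; rewrite ExB // Eq.
Qed.

Lemma weakly_contained_pr d (X : measurableType d) (mu : probability X R)
    (a : G -> X -> X) d' (W : measurableType d') (nu : probability W R)
    (b : G -> W -> W) (k : nat) (A : 'I_k -> set X) (F : seq G) (eps : R) :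
  (forall g S, measurable S -> measurable (a g @` S)) ->
  (forall g S, measurable S -> measurable (b g @` S)) ->
  weakly_contained mu a nu b -> measurable_partition A -> 0 < eps ->
  exists B : 'I_k -> set W, measurable_partition B /\
    forall g, g \in F -> forall i j,
      `|pr mu ((a g @` A i) `&` A j) - pr nu ((b g @` B i) `&` B j)| < eps.
Proof.
move=> ma mb wc Ap e0.
have [B [Bp hB]] := wc k A Ap [set` F] (finite_seq F) eps e0.
exists B; split => // g gF i j; have := hB g gF i j.
case: Ap Bp => mA _ _ [mB _ _].
rewrite (prE mu) ?(prE nu);
  [|by apply: measurableI => //; exact: mb|by apply: measurableI => //; exact: ma].
by rewrite -EFinB abse_EFin lte_fin.
Qed.

End ProductAction.

(** * From the coins to a slice of the product *)

Section AlmostInvariantSets.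
Variables (R : realType) (G : groupType).
Variables (dY : measure_display) (Y : measurableType dY) (P : probability Y R)
  (act : G -> Y -> Y).
Hypotheses (actP : measure_preserving_action P act)
  (Gc : countable [set: G]) (nT : ~ property_T R G).
Variables (dZ : measure_display) (Z : measurableType dZ) (eta : probability Z R).

Local Notation PP := ((eta \x P)%E : probability (Z * Y)%type R).
Local Notation iact := (product_action (@identity_action G Z) act).

Hypothesis wc : forall (d : measure_display) (X : measurableType d)
    (mu : probability X R) (b : G -> X -> X),
  standard_borel R X -> measure_preserving_action mu b ->
  weakly_contained mu b PP iact.

Lemma sign_avg_norm N i : (0 < N)%N -> `|@sign_avg R N i| <= 1.
Proof.
move=> N0; have NR : (0 : R) < N%:R by rewrite ltr0n.
rewrite /sign_avg -mulrA ler_norml.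
have : 0 <= i%:R / N%:R :> R by rewrite divr_ge0.
have : i%:R / N%:R <= 1 :> R by rewrite ler_pdivrMr // mul1r ler_nat -ltnS.
by move=> h1 h2; apply/andP; split; lra.
Qed.

(** The coins have gap [e2 / 8]; weak containment costs half of it and the choice of a slice half of
    the rest. The last factor 8 is that of [almost_invariant_level]. Thus [kappa] is fixed before
    [Q] and [delta]. *)
Lemma almost_invariant_sets : exists2 kappa : R, 0 < kappa &
  forall (Q : seq G) (delta : R), 0 < delta -> exists D : set Y,
    [/\ measurable D, kappa <= pr P D * (1 - pr P D) &
      forall g, g \in Q -> displacement P act g D <= delta].
Proof.
pose e2 : R := expR (- 2); have e20 : 0 < e2 by exact: expR_gt0.
exists (e2 / 32 / 8); first by rewrite !divr_gt0.
move=> Q delta d0.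
pose m : R := (size Q)%:R; have m0 : 0 <= m by exact: ler0n.
(* Makes [e2 / 32 * delta * t] equal to [m + 1], which exceeds the size of [Q]. *)
pose t := (m + 1) / (e2 / 32 * delta).
have t0 : 0 < t by rewrite divr_gt0 ?ltr_wpDl // mulr_gt0 // divr_gt0.
have t2 : 0 < t ^+ 2 by rewrite exprn_gt0.
(* Keeps the penalty of the coins, at most [4 * t ^+ 2 * m * e], below [e2 / 8]. *)
pose e := e2 / 32 / (t ^+ 2 * (m + 1)).
have m1 : 0 < m + 1 by rewrite ltr_wpDl.
have e0 : 0 < e by rewrite !divr_gt0 // mulr_gt0.
have te : 2 * t ^+ 2 * m * (2 * e) <= e2 / 8.
  have : t ^+ 2 * (m + 1) * e = e2 / 32 by rewrite /e; field; rewrite !gt_eqF.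
  have : 0 <= t ^+ 2 * e by rewrite mulr_ge0 // ltW.
  by rewrite -!mulrA (mulrC m) !mulrA mulrDr mulr1 mulrDl => h1; rewrite (mulrAC _ m) => h2; lra.
have [V [B [rho [v [[Bc BD Bpsd [rhoM rhoD rhoB]] [rho1v Bvv Qe cex]]]]]] :=
  almost_invariant_orbit nT (finite_seq Q) e0.
have [c [cc csmall]] := cex 4^-1 ltac:(by rewrite invr_gt0).
have [site [index [siteK indexK]]] := prod_nat_bij (ex_intro _ 1%g I) Gc.
have [mu muE] := coin_measure rho v Bc BD (Bpsd V id) site.
have shiftP := shift_measure_preserving rhoM rhoD rhoB siteK indexK muE.
have [N [N0 N1 N2]] : exists N, [/\ (0 < N)%N, N%:R^-1 <= e2 / 8 & N%:R^-1 <= e].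
  have h0 : 0 < Num.min (e2 / 8) e by rewrite lt_min e0 divr_gt0.
  have [n _ hn] := near_infty_natSinv_lt (PosNum h0).
  by have := hn n (leqnn n); rewrite /= lt_min => /andP[/ltW h1 /ltW h2]; exists n.+1.
have Ap := heads_partition R index N; set A := heads_set index (N := N) in Ap.
pose lam := 2 + 4 * t ^+ 2 * m.
have lam0 : 0 < lam by rewrite ltr_wpDr // mulr_ge0 // mulr_ge0 // (ltW t2).
(* [lam] is the constant of [corr_gap_close], so an error [gap] in the correlations costs [e2 / 16];
   the tolerance requested per pair of pieces is [gap] divided by the number of pairs. *)
pose gap := e2 / 16 / lam; have gap0 : 0 < gap by rewrite !divr_gt0.
have NN0 : 0 < N.+1%:R * N.+1%:R :> R by rewrite mulr_gt0 ?ltr0n.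
(* All the group elements at which [corr_gap] evaluates the correlations. *)
pose F := 1%g :: Q ++ [seq (q.2^-1 * p.2)%g | p <- c, q <- c].
have [C [Cp hC]] := weakly_contained_pr F
  (measurable_act_image shiftP) (measurable_product_act_image actP (Z := Z))
  (wc (standard_borel_binseq R) shiftP) Ap (divr_gt0 gap0 NN0).
pose lmu : G -> R := level_corr mu (@shift R G site index) A (@sign_avg R N).
pose lnu : G -> R := level_corr PP iact C (@sign_avg R N).
have close g : g \in F -> `|lmu g - lnu g| <= gap.
  move=> gF; rewrite /lmu /lnu /level_corr -sumrB (le_trans (ler_norm_sum _ _ _)) //.
  apply: le_trans (_ : \sum_(i < N.+1) \sum_(j < N.+1) gap / (N.+1%:R * N.+1%:R) <= _).
    apply: ler_sum => i _; rewrite -sumrB (le_trans (ler_norm_sum _ _ _)) //.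
    apply: ler_sum => j _; rewrite -mulrBr !normrM.
    have h := ltW (hC g gF i j).
    rewrite -[leRHS]mul1r ler_pM ?mulr_ge0 //.
    by rewrite -[leRHS]mul1r ler_pM // sign_avg_norm.
  by rewrite !sumr_const !card_ord -mulrnA -[leLHS]mulr_natr natrM divfK ?gt_eqF.
have gap_mu : e2 / 8 <= corr_gap lmu Q c t.
  apply: (corr_gap_heads Bc BD (Bpsd V id) rhoM rhoD rhoB Bvv siteK indexK muE N0 (e := e)) => //.
  + by move=> g gQ; rewrite /covar rho1v; exact: Qe.
  + exact: ltW csmall.
  + exact: ltW.
have gap_nu : e2 / 16 <= corr_gap lnu Q c t.
  have : corr_gap lmu Q c t <= corr_gap lnu Q c t + lam * gap.
    apply: corr_gap_close => //.
    - by move=> g gQ; apply: close; rewrite inE mem_cat gQ orbT.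
    - by apply: close; exact: mem_head.
    - move=> p p' pc p'c; apply: close; rewrite inE mem_cat; apply/orP; right; apply/orP; right.
      by apply/allpairsP; exists (p, p').
  have : lam * gap = e2 / 16 by rewrite /gap; field; rewrite gt_eqF.
  lra.
have [bgap Egap] := corr_gap_product actP eta (@sign_avg R N) Q c t Cp.
have [z hz] : exists z, e2 / 32 <= corr_gap
    (level_corr P act (fun i => xsection (C i) z) (@sign_avg R N)) Q c t.
  apply: contrapT => /forallNP h.
  have : corr_gap lnu Q c t <= e2 / 32.
    rewrite /lnu Egap -(Ex_cst eta (e2 / 32)); apply: Ex_le => //.
      exact: bounded_mfun_cst.
    by move=> z; rewrite leNgt; apply/negP => /ltW; exact: h.
  lra.
have Czp := measurable_partition_xsection z Cp.
apply: (almost_invariant_level actP N0 Czp _ t0 d0 _ cc.2 hz); first by rewrite divr_gt0.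
by rewrite mulrC divfK ?gt_eqF ?mulr_gt0 ?divr_gt0 // ltrDl.
Qed.

End AlmostInvariantSets.

(** * Independence and convexity *)

Section Independence.
Variables (R : realType) (G : groupType) (d : measure_display)
  (T : measurableType d) (P : probability T R) (act : G -> T -> T).
Hypothesis actP : measure_preserving_action P act.

Definition almost_invariant (Q : seq G) (delta : R) (D : set T) : Prop :=
  measurable D /\ forall g, g \in Q -> displacement P act g D <= delta.

Definition asymp_indep (E : set T) : Prop := forall eps : R, 0 < eps ->
  exists (Q : seq G) (delta : R), 0 < delta /\
    forall D, almost_invariant Q delta D ->
      `|pr P (D `&` E) - pr P D * pr P E| <= eps.

Lemma bounded_mfun_indicB A A' : measurable A -> measurable A' ->
  bounded_mfun (fun x : T => `|\1_A x - \1_A' x| : R).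
Proof.
by move=> mA mA'; apply/bounded_mfun_norm/bounded_mfunB; exact: bounded_mfun_indic.
Qed.

Lemma pr_dist A A' : measurable A -> measurable A' ->
  `|pr P A - pr P A'| <= Ex P (fun x => `|\1_A x - \1_A' x|).
Proof.
move=> mA mA'; rewrite -!Ex_indic // -ExB; try exact: bounded_mfun_indic.
have b := bounded_mfunB (bounded_mfun_indic R mA) (bounded_mfun_indic R mA').
rewrite ler_norml; apply/andP; split.
  rewrite lerNl -mulN1r -ExZ //; apply: Ex_le.
  - exact: bounded_mfunZ.
  - exact: bounded_mfun_indicB.
  - by move=> x; rewrite mulN1r -normrN ler_norm.
by apply: Ex_le => //; [exact: bounded_mfun_indicB|move=> x; exact: ler_norm].
Qed.

Lemma pr_distI D A A' : measurable D -> measurable A -> measurable A' ->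
  `|pr P (D `&` A) - pr P (D `&` A')| <= Ex P (fun x => `|\1_A x - \1_A' x|).
Proof.
move=> mD mA mA'; apply: le_trans (pr_dist (measurableI _ _ mD mA) (measurableI _ _ mD mA')) _.
apply: Ex_le; [|exact: bounded_mfun_indicB|].
  by apply: bounded_mfun_indicB; exact: measurableI.
move=> x; rewrite !indicM -mulrBr normrM ler_piMl // indicE.
by rewrite ger0_norm // lern1 leq_b1.
Qed.

Lemma asymp_indep_approx E : measurable E ->
  (forall eps : R, 0 < eps -> exists U, [/\ measurable U, asymp_indep U &
     Ex P (fun x => `|\1_E x - \1_U x|) <= eps]) -> asymp_indep E.
Proof.
move=> mE hE eps e0.
have [U [mU iU EU]] := hE (eps / 3) ltac:(by rewrite divr_gt0).
have [Q [delta [d0 hD]]] := iU (eps / 3) ltac:(by rewrite divr_gt0).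
exists Q, delta; split => // D Dai; have := hD D Dai.
have mD := Dai.1.
have := pr_distI mD mE mU; have := pr_dist mE mU.
have := pr_ge0 P D; have := pr_le1 P mD.
rewrite !ler_norml => p1 p0 /andP[a1 a2] /andP[b1 b2] /andP[c1 c2].
by apply/andP; split; nra.
Qed.

(** Pulling back by [g] moves the translation from [A] to [D], hence the displacement at [g^-1]. *)
Lemma displacementV_pr g D A : measurable D -> measurable A ->
  `|pr P (D `&` (act g @` A)) - pr P (D `&` A)| <= displacement P act g^-1%g D.
Proof.
move=> mD mA; have mgA := measurable_act_image actP g mA.
rewrite -(pr_preimage actP g (measurableI _ _ mD mgA)).
have -> : act g @^-1` (D `&` act g @` A) = A `&` (act g @^-1` D).
  case: actP => act1 actM _ _.
  rewrite setIC preimage_setI (act_image actP); congr (_ `&` _).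
  by apply/seteqP; split=> x; rewrite /= -actM mulVg act1.
rewrite [D `&` A]setIC.
apply: le_trans (pr_distI mA (measurable_act_preimage actP g mD) mD) _.
by rewrite /displacement invgK.
Qed.

(** Finitely many group elements carry any piece to any other. The pieces thus have equal measure,
    and an almost invariant set meets them in nearly equal amounts. *)
Lemma transitive_partition_indep n (C : 'I_n -> set T) (J : pred 'I_n) :
  measurable_partition C ->
  (forall i j, exists g, act g @` C i = C j) ->
  asymp_indep (\bigcup_(i in [set i | J i]) C i).
Proof.
move=> [mC tC cC] trC eps e0.
have /choice[g hg] : forall p : 'I_n * 'I_n, exists g, act g @` C p.1 = C p.2.
  by move=> p; exact: trC.
pose Q := [seq (g p)^-1%g | p : 'I_n * 'I_n].
(* The union consists of at most [n] pieces, each with error [delta]; the successor rules out a zero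
   denominator. *)
exists Q, (eps / n.+1%:R); split; first by rewrite divr_gt0.
move=> D [mD hD]; set delta := eps / n.+1%:R in hD.
have near i j : `|pr P (D `&` C j) - pr P (D `&` C i)| <= delta.
  rewrite -(hg (i, j)) /=; apply: le_trans (displacementV_pr _ mD (mC i)) _.
  by apply: hD; apply/mapP; exists (i, j); rewrite ?mem_enum.
have eqC i j : pr P (C j) = pr P (C i).
  by rewrite -(hg (i, j)) /= (pr_image actP).
have sumC (A : set T) : measurable A -> pr P A = \sum_i pr P (A `&` C i).
  move=> mA; rewrite -pr_bigcup; first by rewrite -setI_bigcupr cC setIT.
    by move=> i; exact: measurableI.
  by move=> i j _ _ [x [[_ Cix] [_ Cjx]]]; apply: (tC i j) => //; exists x.
have sumT : \sum_i pr P (C i) = 1.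
  by have := sumC setT measurableT; rewrite prT => ->; apply: eq_bigr => i _; rewrite setTI.
have one i : `|pr P (D `&` C i) - pr P D * pr P (C i)| <= delta.
  have nC : n%:R * pr P (C i) = 1.
    rewrite -[RHS]sumT (eq_bigr (fun=> pr P (C i))) => [|j _]; last exact: eqC.
    by rewrite sumr_const card_ord mulr_natl.
  (* As [n * pr P (C i) = 1], the deviation at [i] is the average over [j] of its differences from
     the other pieces. *)
  have -> : pr P (D `&` C i) - pr P D * pr P (C i) =
      pr P (C i) * \sum_j (pr P (D `&` C i) - pr P (D `&` C j)).
    rewrite sumrB sumr_const card_ord -(sumC D mD) mulrBr -mulr_natl mulrCA mulrA nC mul1r.
    by rewrite [_ * pr P D]mulrC.
  rewrite normrM (ger0_norm (pr_ge0 _ _)) -[leRHS]mul1r -nC -mulrA mulrCA ler_wpM2l ?pr_ge0 //.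
  apply: le_trans (ler_norm_sum _ _ _) _.
  apply: le_trans (_ : \sum_(j < n) delta <= _); first by apply: ler_sum => j _; exact: near.
  by rewrite sumr_const card_ord mulr_natl.
have mU : measurable (\bigcup_(i in [set i | J i]) C i).
  by apply: fin_bigcup_measurable => // i _.
have UE (A : set T) : measurable A -> pr P (A `&` \bigcup_(i in [set i | J i]) C i) =
    \sum_(i | J i) pr P (A `&` C i).
  move=> mA; rewrite (sumC _ (measurableI _ _ mA mU)) [RHS]big_mkcond /=.
  apply: eq_bigr => i _; case: ifPn => Ji.
    congr pr; rewrite -setIA; congr (_ `&` _); apply/setIidPr => x Cix; by exists i.
  rewrite (_ : _ `&` C i = set0) ?pr0 //; apply/seteqP; split=> // x [[_ [j /= Jj Cjx]] Cix].
  by move/negP: Ji; apply; suff <- : j = i by []; apply: (tC j i) => //; exists x.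
rewrite UE // -[X in _ * pr P X]setTI UE // mulr_sumr -sumrB.
apply: le_trans (ler_norm_sum _ _ _) _.
apply: le_trans (_ : \sum_(i | J i) delta <= _).
  by apply: ler_sum => i _; rewrite setTI.
rewrite sumr_const -mulr_natl; apply: le_trans (_ : n.+1%:R * delta <= _).
  rewrite ler_wpM2r ?divr_ge0 ?(ltW e0) // ler_nat.
  by apply: leq_trans (max_card _) _; rewrite card_ord.
by rewrite /delta mulrC divfK ?pnatr_eq0.
Qed.

Lemma asymp_indep_seq (s : seq (set T)) : (forall E, E \in s -> asymp_indep E) ->
  forall eps : R, 0 < eps -> exists (Q : seq G) (delta : R), 0 < delta /\
    forall D, almost_invariant Q delta D -> forall E, E \in s ->
      `|pr P (D `&` E) - pr P D * pr P E| <= eps.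
Proof.
elim: s => [|E s ih] hs eps e0; first by exists [::], 1.
have [|Q [delta [d0 h]]] := ih _ eps e0.
  by move=> E' E's; apply: hs; rewrite inE E's orbT.
have [Q' [delta' [d0' h']]] := hs E (mem_head _ _) eps e0.
exists (Q ++ Q'), (Num.min delta delta'); split; first by rewrite lt_min d0.
move=> D [mD hD] E'; rewrite inE => /orP[/eqP ->|E's].
  apply: h'; split => // g gQ'; have := hD g; rewrite mem_cat gQ' orbT le_min.
  by move=> /(_ isT) /andP[].
apply: h => //; split => // g gQ; have := hD g; rewrite mem_cat gQ le_min.
by move=> /(_ isT) /andP[].
Qed.

End Independence.

(** Otherwise [x] lies in a gap of [p]. By closedness both ends of the gap satisfy [p], and mixing
    them in the ratio [r] gives a point of [p] strictly inside the gap. *)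
Lemma gap_fill (R : realType) (p : set R) (r : R) : 0 < r < 1 -> p 0 -> p 1 ->
  (forall x y, p x -> p y -> p ((1 - r) * x + r * y)) ->
  (forall x, 0 <= x <= 1 ->
    (forall e, 0 < e -> exists y, [/\ p y, 0 <= y <= 1 & `|y - x| <= e]) -> p x) ->
  forall x, 0 <= x <= 1 -> p x.
Proof.
move=> /andP[r0 r1] p0 p1 pmix pclosed x /andP[x0 x1]; apply: contrapT => npx.
pose A := [set y | p y /\ 0 <= y <= x]; pose B := [set y | p y /\ x <= y <= 1].
have A0 : A 0 by rewrite /A /= lexx.
have B1 : B 1 by rewrite /B /= lexx x1.
have supA : has_sup A.
  by split; [exists 0|exists x => y [_ /andP[]]].
have infB : has_inf B.
  by split; [exists 1|exists x => y [_ /andP[]]].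
have a0 : 0 <= sup A by apply: sup_upper_bound.
have ax : sup A <= x by apply: ge_sup; [exists 0|move=> y [_ /andP[]]].
have infle y : B y -> inf B <= y by move=> By; apply: ge_inf => //; exact: infB.2.
have b1 : inf B <= 1 by exact: infle.
have xb : x <= inf B by apply: lb_le_inf; [exists 1|move=> y [_ /andP[]]].
have pa : p (sup A).
  apply: pclosed; first by rewrite a0 (le_trans ax).
  move=> e e0; have [y [py /andP[y0 yx]] hy] := sup_adherent e0 supA.
  exists y; split => //; first by rewrite y0 (le_trans yx).
  have : y <= sup A by apply: sup_upper_bound => //; split => //; rewrite y0.
  by move=> h; rewrite ler_norml; apply/andP; split; lra.
have pb : p (inf B).
  apply: pclosed; first by rewrite b1 (le_trans x0).
  move=> e e0; have [y [py /andP[xy y1]] hy] := inf_adherent e0 infB.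
  exists y; split => //; first by rewrite y1 (le_trans x0).
  have : inf B <= y by apply: infle; split => //; rewrite xy.
  by move=> h; rewrite ler_norml; apply/andP; split; lra.
have ltax : sup A < x.
  by rewrite lt_neqAle ax andbT; apply/eqP => h; apply: npx; rewrite -h.
have pc := pmix _ _ pa pb; set c := (1 - r) * _ + _ in pc.
have ac : sup A < c by rewrite /c; nra.
have cb : c < inf B.
  have : 0 < (1 - r) * (inf B - sup A) by rewrite mulr_gt0; lra.
  by rewrite /c; lra.
have [cx|/ltW xc] := leP c x.
  have : c <= sup A by apply: sup_upper_bound => //; split => //; rewrite cx andbT; lra.
  lra.
have : inf B <= c by apply: infle; split => //; rewrite xc /=; lra.
lra.
Qed.

(** * The closure of the correlation vectors *)

Section Achievable.
Variables (R : realType) (G : groupType) (d : measure_display)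
  (T : measurableType d) (P : probability T R) (act : G -> T -> T).
Hypothesis actP : measure_preserving_action P act.
Hypothesis indep : forall E, measurable E -> asymp_indep P act E.
Variables (kappa : R).
Hypothesis kappa0 : 0 < kappa.
Hypothesis AI : forall (Q : seq G) (delta : R), 0 < delta ->
  exists D, almost_invariant P act Q delta D /\ kappa <= pr P D * (1 - pr P D).

(** Measures of almost invariant sets could vary with [Q] and [delta]. As these get finer, the
    measures have a cluster point in [[0, 1]] by compactness, and [kappa] keeps it away from 0 and
    1. *)
Lemma almost_invariant_ratio : exists r : R, 0 < r < 1 /\
  forall (Q : seq G) (delta : R), 0 < delta ->
    exists D, almost_invariant P act Q delta D /\ `|pr P D - r| <= delta.
Proof.
pose S (i : seq G * R) := [set pr P D | D in
  [set D | almost_invariant P act i.1 i.2 D /\ kappa <= pr P D * (1 - pr P D)]].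
pose F := filter_from [set i : seq G * R | 0 < i.2] S.
have FF : ProperFilter F.
  apply: filter_from_proper.
    apply: filter_from_filter; first by exists ([::], 1) => /=.
    move=> [Q e] [Q' e'] /= e0 e0'; exists (Q ++ Q', Num.min e e') => /=.
      by rewrite lt_min e0.
    move=> _ [D [[mD hD] kD] <-]; split; exists D => //=; split => //; split => // g gQ.
      by have := hD g; rewrite mem_cat gQ le_min => /(_ isT) /andP[].
    by have := hD g; rewrite mem_cat gQ orbT le_min => /(_ isT) /andP[].
  by move=> [Q e] /= e0; have [D hD] := AI Q e0; exists (pr P D); exists D.
have [r [_ clr]] : `[(0 : R), 1]%classic `&` cluster F !=set0.
  apply: (@segment_compact R 0 1) => //.
  exists ([::], 1) => //= _ [D [[mD _] _] <-].
  by rewrite /= in_itv /= pr_ge0 pr_le1.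
have near (Q : seq G) (delta : R) : 0 < delta -> exists D,
    [/\ almost_invariant P act Q delta D, kappa <= pr P D * (1 - pr P D) &
      `|pr P D - r| <= delta].
  move=> d0; have [_ [[D [Dai kD] <-] hD]] : S (Q, delta) `&` ball r delta !=set0.
    by apply: clr; [exists (Q, delta)|exact: nbhsx_ballx].
  exists D; split => //; rewrite distrC ltW //; exact: hD.
exists r; split; last first.
  by move=> Q delta d0; have [D [h1 _ h2]] := near Q delta d0; exists D.
(* Both [pr P D] and its complement are at least [kappa], so an error of [kappa / 4] leaves [r]
   strictly between 0 and 1. *)
have [D [[mD _] kD]] := near [::] (kappa / 4) ltac:(by rewrite divr_gt0).
have := pr_ge0 P D; have := pr_le1 P mD.
rewrite ler_norml => h1 h0 /andP[h2 h3].
have p2 : 0 <= pr P D * pr P D by rewrite mulr_ge0.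
have q2 : 0 <= (1 - pr P D) * (1 - pr P D) by rewrite mulr_ge0 // subr_ge0.
have k0 := kappa0; move: (pr P D) kD h1 h0 h2 h3 p2 q2 => x kD h1 h0 h2 h3 p2 q2.
by apply/andP; split; lra.
Qed.

Section Stats.
Variables (F : seq G) (k : nat).
Implicit Types V : G -> 'I_k -> 'I_k -> R.

(** Membership in the closure of the set of correlation vectors over [F]; only the values of [V] on
    [F] matter. *)
Definition achievable V : Prop := forall eps : R, 0 < eps ->
  exists E : 'I_k -> set T, measurable_partition E /\
    forall g, g \in F -> forall i j,
      `|pr P ((act g @` E i) `&` E j) - V g i j| <= eps.

Lemma achievable_ext V V' : (forall g i j, V g i j = V' g i j) ->
  achievable V -> achievable V'.
Proof.
by move=> VV'; congr achievable; apply/funext => g; apply/funext => i; apply/funext.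
Qed.

Lemma achievable_closed V : (forall eps : R, 0 < eps -> exists V', achievable V' /\
    forall g, g \in F -> forall i j, `|V' g i j - V g i j| <= eps) -> achievable V.
Proof.
move=> h eps e0; have e20 : 0 < eps / 2 by rewrite divr_gt0.
have [V' [aV' hV']] := h _ e20; have [E [Ep hE]] := aV' _ e20.
exists E; split => // g gF i j; have := hE g gF i j; have := hV' g gF i j.
by rewrite !ler_norml => /andP[a1 a2] /andP[b1 b2]; apply/andP; split; lra.
Qed.

Lemma achievable_bounds V g i j : achievable V -> g \in F -> 0 <= V g i j <= 1.
Proof.
move=> aV gF.
have h (eps : R) : 0 < eps -> - eps <= V g i j <= 1 + eps.
  move=> e0; have [E [[mE _ _] hE]] := aV _ e0.
  have mS : measurable ((act g @` E i) `&` E j).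
    by apply: measurableI => //; exact: (measurable_act_image actP).
  have := hE g gF i j; have := pr_ge0 P ((act g @` E i) `&` E j); have := pr_le1 P mS.
  by rewrite ler_norml => h1 h0 /andP[h2 h3]; apply/andP; split; lra.
apply/andP; split; rewrite leNgt; apply/negP => hlt.
  have := h (- V g i j / 2) ltac:(lra); lra.
have := h ((V g i j - 1) / 2) ltac:(lra); lra.
Qed.

Definition mix (D : set T) (E E' : 'I_k -> set T) (i : 'I_k) : set T :=
  (D `&` E i) `|` (~` D `&` E' i).

Lemma measurable_partition_mix (D : set T) (E E' : 'I_k -> set T) : measurable D ->
  measurable_partition E -> measurable_partition E' ->
  measurable_partition (mix D E E').
Proof.
move=> mD [mE tE cE] [mE' tE' cE']; split.
- move=> i; apply: measurableU; apply: measurableI => //; exact: measurableC.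
- move=> i j _ _ [x [[[Dx Ei]|[nDx Ei]] [[Dx' Ej]|[nDx' Ej]]]] //.
    by apply: (tE i j) => //; exists x.
  by apply: (tE' i j) => //; exists x.
- apply/seteqP; split=> // x _; have [Dx|nDx] := pselect (D x).
    have : (\bigcup_i E i) x by rewrite cE.
    by move=> [i _ Ei]; exists i => //; left.
  have : (\bigcup_i E' i) x by rewrite cE'.
  by move=> [i _ Ei]; exists i => //; right.
Qed.

(** Where [x] and its preimage under [act g] lie on the same side of [D], the two sets agree; the
    remaining points have measure the displacement. *)
Lemma mix_stats (D : set T) (E E' : 'I_k -> set T) g i j : measurable D ->
  measurable_partition E -> measurable_partition E' ->
  `|pr P ((act g @` mix D E E' i) `&` mix D E E' j) - (pr P (D `&` ((act g @` E i) `&` E j)) +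
     pr P (~` D `&` ((act g @` E' i) `&` E' j)))| <= displacement P act g D.
Proof.
move=> mD Ep Ep'; set M := mix D E E'.
have [mM _ _] := measurable_partition_mix mD Ep Ep'.
case: Ep Ep' => mE _ _ [mE' _ _].
have mg := measurable_act_image actP.
have mS : measurable ((act g @` E i) `&` E j) by apply: measurableI => //; exact: mg.
have mS' : measurable ((act g @` E' i) `&` E' j) by apply: measurableI => //; exact: mg.
have mDS := measurableI _ _ mD mS; have mDS' := measurableI _ _ (measurableC mD) mS'.
rewrite -prU //; last first.
  by apply/seteqP; split=> // x [[Dx _] [nDx _]].
apply: le_trans (pr_dist P _ _) _.
- by apply: measurableI => //; exact: mg.
- exact: measurableU.
apply: Ex_le.
- apply: bounded_mfun_indicB; last exact: measurableU.
  by apply: measurableI => //; exact: mg.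
- have bD := bounded_mfun_indic R mD.
  by apply: bounded_mfun_norm; apply: bounded_mfunB => //; exact: (bounded_mfun_act actP).
move=> x; have le1 (A A' : set T) y : `|\1_A y - \1_A' y| <= 1 :> R.
  rewrite !indicE; case: (y \in A); case: (y \in A');
  by rewrite ?subrr ?subr0 ?sub0r ?normrN ?normr0 ?normr1.
have [Dg|nDg] := pselect (D (act g^-1%g x)); have [Dx|nDx] := pselect (D x).
- rewrite [X in _ <= X](_ : _ = 0); last by rewrite !indicE !mem_set // subrr normr0.
  rewrite (_ : \1_(_ `&` M j) x = \1_(D `&` (act g @` E i `&` E j) `|`
    ~` D `&` (act g @` E' i `&` E' j)) x) ?subrr ?normr0 //.
  rewrite !indicE; congr (nat_of_bool _)%:R; rewrite !(act_image actP) /M /mix.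
  apply/idP/idP; rewrite !inE /=.
    by move=> [[[_ h1]|[//]] [[_ h2]|[//]]]; left.
  by move=> [[_ [h1 h2]]|[//]]; split; left.
- rewrite [X in _ <= X](_ : _ = 1); last first.
    by rewrite !indicE mem_set // memNset // subr0 normr1.
  exact: le1.
- rewrite [X in _ <= X](_ : _ = 1); last first.
    by rewrite !indicE memNset // mem_set // sub0r normrN normr1.
  exact: le1.
- rewrite [X in _ <= X](_ : _ = 0); last by rewrite !indicE !memNset // subrr normr0.
  rewrite (_ : \1_(_ `&` M j) x = \1_(D `&` (act g @` E i `&` E j) `|`
    ~` D `&` (act g @` E' i `&` E' j)) x) ?subrr ?normr0 //.
  rewrite !indicE; congr (nat_of_bool _)%:R; rewrite !(act_image actP) /M /mix.
  apply/idP/idP; rewrite !inE /=.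
    by move=> [[[//]|[_ h1]] [[//]|[_ h2]]]; right.
  by move=> [[//]|[_ [h1 h2]]]; split; right.
Qed.

Lemma achievable_mix (r : R) V V' : 0 < r < 1 ->
  (forall (Q : seq G) (delta : R), 0 < delta ->
    exists D, almost_invariant P act Q delta D /\ `|pr P D - r| <= delta) ->
  achievable V -> achievable V' ->
  achievable (fun g i j => (1 - r) * V g i j + r * V' g i j).
Proof.
(* Seven errors of size [eps / 8] occur: one displacement, two from independence, and two from each
   product of a measure and a correlation. *)
move=> r01 hr aV aV' eps e0; have e80 : 0 < eps / 8 by rewrite divr_gt0.
have [E [Ep hE]] := aV _ e80; have [E' [Ep' hE']] := aV' _ e80.
pose st (E : 'I_k -> set T) := [seq (act p.1 @` E p.2.1) `&` E p.2.2 |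
  p <- [seq (g, ij) | g <- F, ij <- enum {: 'I_k * 'I_k}]].
have st_mem (E0 : 'I_k -> set T) g i j : g \in F -> (act g @` E0 i) `&` E0 j \in st E0.
  move=> gF; apply/mapP; exists (g, (i, j)) => //.
  by apply/allpairsP; exists (g, (i, j)); rewrite /= mem_enum.
have mst (E0 : 'I_k -> set T) A : measurable_partition E0 -> A \in st E0 -> measurable A.
  move=> [mE0 _ _] /mapP[p _ ->]; apply: measurableI => //.
  exact: (measurable_act_image actP).
have hst A : A \in st E' ++ st E -> asymp_indep P act A.
  by rewrite mem_cat => /orP[] /mst h; apply: indep; exact: h.
have [Q [delta [d0 hQ]]] := asymp_indep_seq hst e80.
have dd0 : 0 < Num.min delta (eps / 8) by rewrite lt_min d0.
have [D [[mD hD] hDr]] := hr (Q ++ F) _ dd0.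
have Dai : almost_invariant P act Q delta D.
  split => // g gQ; have := hD g; rewrite mem_cat gQ le_min.
  by move=> /(_ isT) /andP[].
have {}hDr : `|pr P D - r| <= eps / 8 by move: hDr; rewrite le_min => /andP[].
(* [E'] is used on [D], whose measure approximates [r], the coefficient of [V']. *)
exists (mix D E' E); split.
  exact: measurable_partition_mix.
move=> g gF i j.
have disp : displacement P act g D <= eps / 8.
  by have := hD g; rewrite mem_cat gF orbT le_min => /(_ isT) /andP[].
have := le_trans (mix_stats g i j mD Ep' Ep) disp.
have s1 := st_mem E g i j gF; have s2 := st_mem E' g i j gF.
have mS := mst _ _ Ep s1; have mS' := mst _ _ Ep' s2.
have := hQ D Dai ((act g @` E i) `&` E j) ltac:(by rewrite mem_cat s1 orbT).
have := hQ D Dai ((act g @` E' i) `&` E' j) ltac:(by rewrite mem_cat s2).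
have := prID P mS mD.
have := hE g gF i j; have := hE' g gF i j.
have := pr_ge0 P ((act g @` E i) `&` E j); have := pr_le1 P mS.
have := pr_ge0 P ((act g @` E' i) `&` E' j); have := pr_le1 P mS'.
set A := pr P (_ `&` E j); set A' := pr P (_ `&` E' j).
set B := pr P (D `&` _); set B' := pr P (D `&` _); set C := pr P (~` D `&` _).
set X := pr P (_ `&` mix _ _ _ _).
move: hDr; rewrite !ler_norml.
move=> /andP[r1 r2] a'1 a'0 a1 a0 /andP[e'1 e'2] /andP[e1 e2] AE /andP[b'1 b'2] /andP[b1 b2].
move=> /andP[x1 x2].
case/andP: r01 => r0 r1'.
have k1 : `|pr P D * A' - r * V' g i j| <= eps / 4.
  rewrite ler_norml; apply/andP; split; nra.
have k2 : `|(1 - pr P D) * A - (1 - r) * V g i j| <= eps / 4.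
  rewrite ler_norml; apply/andP; split; nra.
move: k1 k2; rewrite !ler_norml => /andP[k1 k2] /andP[k3 k4].
apply/andP; split; lra.
Qed.

(** [gap_fill] applies to the proportions that can be achieved: they form a closed set, contain 0
    and 1, and are stable under mixing in the one ratio [r] at hand. *)
Lemma achievable_segment V V' (t : R) : 0 <= t <= 1 ->
  achievable V -> achievable V' ->
  achievable (fun g i j => (1 - t) * V g i j + t * V' g i j).
Proof.
move=> t01 aV aV'; have [r [r01 hr]] := almost_invariant_ratio.
apply: (gap_fill (p := fun t => achievable (fun g i j => (1 - t) * V g i j + t * V' g i j))
  r01 _ _ _ _ t01).
- by apply: achievable_ext aV => g i j; ring.
- by apply: achievable_ext aV' => g i j; ring.
- move=> x y px py; apply: achievable_ext (achievable_mix r01 hr px py) => g i j.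
  ring.
- move=> x x01 hx; apply: achievable_closed => eps e0.
  have [y [py y01 yx]] := hx eps e0.
  exists (fun g i j => (1 - y) * V g i j + y * V' g i j); split => // g gF i j.
  rewrite (_ : _ - _ = (y - x) * (V' g i j - V g i j)); last by ring.
  rewrite normrM -[leRHS]mulr1 ler_pM //.
  have /andP[v0 v1] := achievable_bounds i j aV gF.
  have /andP[v0' v1'] := achievable_bounds i j aV' gF.
  by rewrite ler_norml; apply/andP; split; lra.
Qed.

Lemma achievable_sum (I : Type) (s : seq I) (w : I -> R) (V : I -> G -> 'I_k -> 'I_k -> R) :
  (forall x, 0 <= w x) -> (forall x, achievable (V x)) -> \sum_(x <- s) w x = 1 ->
  achievable (fun g i j => \sum_(x <- s) w x * V x g i j).
Proof.
move=> w0 aV w1.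
(* Normalized for the induction, since the weights of a tail no longer sum to 1. *)
suff h : 0 < \sum_(x <- s) w x ->
    achievable (fun g i j => (\sum_(x <- s) w x * V x g i j) / \sum_(x <- s) w x).
  have := h; rewrite w1 => /(_ ltr01).
  by apply: achievable_ext => g i j; rewrite divr1.
elim: s {w1} => [|x s ih]; first by rewrite big_nil ltxx.
rewrite big_cons => W0.
suff : achievable (fun g i j => (w x * V x g i j + \sum_(y <- s) w y * V y g i j) /
    (w x + \sum_(y <- s) w y)).
  by apply: achievable_ext => g i j; rewrite big_cons.
have S0 : 0 <= \sum_(y <- s) w y by exact: sumr_ge0.
have [Sz|Sz] := eqVneq (\sum_(y <- s) w y) 0.
  have wx0 : 0 < w x by rewrite Sz addr0 in W0.
  suff -> : (fun g i j => (w x * V x g i j + \sum_(y <- s) w y * V y g i j) /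
      (w x + \sum_(y <- s) w y)) = V x by [].
  apply/funext => g; apply/funext => i; apply/funext => j.
  have -> : \sum_(y <- s) w y * V y g i j = 0.
    elim: s Sz {ih W0 S0} => [|y s ih]; first by rewrite !big_nil.
    rewrite !big_cons => h.
    have S0 : 0 <= \sum_(y <- s) w y by exact: sumr_ge0.
    have wy : w y = 0 by have := w0 y; lra.
    by rewrite wy mul0r add0r ih //; move: h; rewrite wy add0r.
  by rewrite Sz !addr0 mulrAC mulfV ?mul1r // gt_eqF.
have Sp : 0 < \sum_(y <- s) w y by rewrite lt_neqAle eq_sym Sz.
have t01 : 0 <= (\sum_(y <- s) w y) / (w x + \sum_(y <- s) w y) <= 1.
  rewrite divr_ge0 ?(ltW W0) //= ler_pdivrMr // mul1r lerDr; exact: w0.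
apply: achievable_ext (achievable_segment t01 (aV x) (ih Sp)) => g i j.
by field; rewrite !gt_eqF.
Qed.

Section Integral.
Variables (dZ : measure_display) (Z : measurableType dZ) (eta : probability Z R).

(** Cut [Z] into finitely many cells on which every coordinate of [V] over [F] varies by at most
    [m^-1]. The integral is then close to a convex combination of values at representatives. *)
Lemma achievable_integral (V : Z -> G -> 'I_k -> 'I_k -> R) :
  (forall z, achievable (V z)) ->
  (forall g i j, g \in F -> bounded_mfun (fun z => V z g i j)) ->
  achievable (fun g i j => Ex eta (fun z => V z g i j)).
Proof.
move=> aV bV; apply: achievable_closed => eps e0.
have [M _ hM] := near_infty_natSinv_lt (PosNum e0).
have {hM} := hM M (leqnn M); set m := M.+1 => hM.
have m0 : 0 < m%:R :> R by rewrite ltr0n.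
pose J := ('I_(size F) * ('I_k * 'I_k))%type.
pose val (p : J) z := V z (nth 1%g F p.1) p.2.1 p.2.2.
have val01 p z : 0 <= val p z <= 1.
  by apply: achievable_bounds; [exact: aV|exact: mem_nth].
have bval p : bounded_mfun (val p) by apply: bV; exact: mem_nth.
(* Values in [[0, 1]] multiplied by [m] have integer part from 0 to [m], the value 1 giving [m]. *)
pose K := {ffun J -> 'I_m.+1}.
pose cell (f : K) : set Z := \bigcap_(p in [set: J])
  [set z | (f p)%:R <= m%:R * val p z < (f p).+1%:R].
have mcell f : measurable (cell f).
  apply: fin_bigcap_measurable; [exact: finite_finset|move=> p _].
  rewrite (_ : [set z | _] = (fun z => m%:R * val p z) @^-1` `[(f p)%:R, (f p).+1%:R[%classic).
    rewrite -[X in measurable X]setTI.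
    by apply: (bounded_mfunZ m%:R (bval p)).1 => //; exact: measurable_itv.
  by apply/seteqP; split=> z; rewrite /= in_itv.
pose key z : K := [ffun p => inord (Num.truncn (m%:R * val p z))].
have keyP z : cell (key z) z.
  move=> p _ /=; rewrite ffunE.
  have /andP[v0 v1] := val01 p z.
  have h0 : 0 <= m%:R * val p z by rewrite mulr_ge0.
  have /andP[t1 t2] := truncn_itv h0.
  rewrite inordK ?t1 ?t2 // ltnS -(ler_nat R).
  by apply: le_trans t1 _; rewrite ler_piMr.
have cellP f z : cell f z -> f = key z.
  move=> fz; apply/ffunP => p; rewrite ffunE; apply: val_inj; rewrite /= inordK.
    by have := fz p I; rewrite /= => /truncn_def ->.
  by have /truncn_def -> := fz p I.
(* Empty cells receive an arbitrary point, with weight 0. *)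
pose rep (f : K) : Z := xget point (cell f).
pose w f := pr eta (cell f).
have E1 f z : \1_(cell f) z = (f == key z)%:R :> R.
  rewrite indicE; congr (nat_of_bool _)%:R; apply/idP/eqP; first by rewrite inE; exact: cellP.
  by move=> ->; rewrite inE.
exists (fun g i j => \sum_(f <- index_enum K) w f * V (rep f) g i j); split.
  apply: achievable_sum => //; first by move=> f; exact: pr_ge0.
  transitivity (Ex eta (fun z => \sum_(f <- index_enum K) \1_(cell f) z)).
    rewrite Ex_sum; last by move=> f; exact: bounded_mfun_indic.
    by apply: eq_bigr => f _; rewrite Ex_indic.
  rewrite -[RHS](Ex_cst eta); congr Ex; apply/funext => z.
  under eq_bigr do rewrite E1.
  by rewrite (bigD1 (key z)) //= eqxx big1 ?addr0 // => f /negbTE ->.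
move=> g gF i j.
have [p pE] : exists p : J, forall z, V z g i j = val p z.
  have gi : (index g F < size F)%N by rewrite index_mem.
  by exists (Ordinal gi, (i, j)) => z; rewrite /val /= nth_index.
have bs : bounded_mfun (fun z => \sum_(f <- index_enum K) val p (rep f) * \1_(cell f) z).
  by apply: bounded_mfun_sum => f; apply: bounded_mfunZ; exact: bounded_mfun_indic.
have -> : \sum_(f <- index_enum K) w f * V (rep f) g i j =
    Ex eta (fun z => \sum_(f <- index_enum K) val p (rep f) * \1_(cell f) z).
  rewrite Ex_sum; last by move=> f; apply: bounded_mfunZ; exact: bounded_mfun_indic.
  apply: eq_bigr => f _; rewrite ExZ ?Ex_indic //; last exact: bounded_mfun_indic.
  by rewrite pE mulrC.
have -> : (fun z => V z g i j) = val p by apply/funext => z; exact: pE.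
have pt z : `|\sum_(f <- index_enum K) val p (rep f) * \1_(cell f) z - val p z| <= eps.
  rewrite (bigD1 (key z)) //= E1 eqxx mulr1 big1 ?addr0; last first.
    by move=> f fz; rewrite E1 (negbTE fz) mulr0.
  have h1 := keyP z p I.
  have h2 : cell (key z) (rep (key z)) by rewrite /rep; case: xgetP => // /(_ z).
  have {}h2 := h2 p I; move: h1 h2; rewrite /= => /andP[a1 a2] /andP[b1 b2].
  have : m%:R * `|val p (rep (key z)) - val p z| <= 1.
    rewrite -{1}(ger0_norm (ltW m0)) -normrM mulrBr ler_norml.
    have e1 : (key z p).+1%:R = (key z p)%:R + 1 :> R by rewrite natr1.
    by rewrite e1 in a2 b2; apply/andP; split; lra.
  rewrite -ler_pdivlMl // mulr1 => h; apply: le_trans h _.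
  exact: ltW hM.
rewrite -ExB // ler_norml; apply/andP; split.
  rewrite -(Ex_cst eta (- eps)); apply: Ex_le; [exact: bounded_mfun_cst|exact: bounded_mfunB|].
  by move=> z; have := pt z; rewrite ler_norml => /andP[].
rewrite -[leRHS](Ex_cst eta); apply: Ex_le; [exact: bounded_mfunB|exact: bounded_mfun_cst|].
by move=> z; have := pt z; rewrite ler_norml => /andP[].
Qed.

End Integral.
End Stats.
End Achievable.

(** * The profinite completion *)

Section Profinite.
Variable G : groupType.
Implicit Types (M N : fin_index_normal G) (x y : profinite G).

Lemma lcoset_of_setI (M N : set G) g :
  lcoset_of g (M `&` N) = lcoset_of g M `&` lcoset_of g N.
Proof.
apply/seteqP; split=> [_ [n [Mn Nn] <-]|x [[m Mm <-] [n Nn /mulgI nm]]].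
  by split; exists n.
by exists m => //; split=> //; rewrite -nm.
Qed.

Lemma fin_index_meet_ex M N : exists K : fin_index_normal G,
  (K `<=` M) /\ (K `<=` N).
Proof.
have f1 : (M `&` N) 1%g by split; exact: finN1.
have fM g h : (M `&` N) g -> (M `&` N) h -> (M `&` N) (g * h)%g.
  by move=> [Mg Ng] [Mh Nh]; split; exact: finNM.
have fV g : (M `&` N) g -> (M `&` N) g^-1%g.
  by move=> [Mg Ng]; split; exact: finNV.
have fJ g h : (M `&` N) g -> (M `&` N) (g ^ h)%g.
  by move=> [Mg Ng]; split; exact: finNJ.
have fi : finite_set [set lcoset_of g (M `&` N) | g in [set: G]].
  apply: (@sub_finite_set _ _ [set A `&` B | A in [set lcoset_of g M | g in [set: G]] &
      B in [set lcoset_of g N | g in [set: G]]]).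
    move=> _ [g _ <-]; rewrite lcoset_of_setI.
    by exists (lcoset_of g M); [exists g|exists (lcoset_of g N) => //; exists g].
  by apply: finite_image2; exact: finN_index.
by exists (FinIndexNormal f1 fM fV fJ fi); split=> g [].
Qed.

Lemma fin_index_top_ex : exists K : fin_index_normal G, True.
Proof.
have fi : finite_set [set lcoset_of g [set: G] | g in [set: G]].
  apply: (@sub_finite_set _ _ [set [set: G]]) => // _ [g _ <-].
  by apply/seteqP; split=> // h _; exists (g^-1 * h)%g; rewrite // mulVKg.
by exists (@FinIndexNormal G setT I (fun _ _ _ _ => I) (fun _ _ => I) (fun _ _ _ => I) fi).
Qed.

Lemma pf_coset_refine M N x y : M `<=` N -> x M = y M -> x N = y N.
Proof.
move=> MN xyM; have [a xM] := pf_cosetP x M.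
have [b xN] := pf_cosetP x N; have [c yN] := pf_cosetP y N.
have xa : x N a by apply: (pf_compat MN); rewrite xM; exact: lcoset_of_refl.
have ya : y N a by apply: (pf_compat MN); rewrite -xyM xM; exact: lcoset_of_refl.
by rewrite xN yN in xa ya *; rewrite (lcoset_of_eq xa) (lcoset_of_eq ya).
Qed.

Definition coset_cylinder N (c : set G) : set (profinite G) := [set x | x N = c].

Lemma open_coset_cylinder N c : open (coset_cylinder N c).
Proof.
exists [set coset_cylinder N c]; last by rewrite bigcup_set1.
move=> _ ->; exists [fset (coset_cylinder N c : set (profinite G))]%fset.
  by move=> C /fset1P ->; apply/mem_set; exists N, c.
by rewrite set_fset1 bigcap_set1.
Qed.

(** Finite-index normal subgroups are stable under intersection, so finitely many cylinders around
    [x] contain one finer cylinder and the subbase behaves as a base. *)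
Lemma open_coset_cylinderP (O : set (profinite G)) x : open O -> O x ->
  exists N, coset_cylinder N (x N) `<=` O.
Proof.
move=> [D' hD' e] Ox.
have [C D'C Cx] : (\bigcup_(i in D') isBaseTopological.b i) x by rewrite e.
have [A AD AC] := hD' C D'C.
suff [N hN] : exists N, forall C', C' \in (A : seq _) -> coset_cylinder N (x N) `<=` C'.
  exists N => y yN; rewrite -e; exists C => //.
  by rewrite /= -AC => C' /= C'A; exact: hN C' C'A y yN.
have hA C' : C' \in (A : seq _) -> exists N, coset_cylinder N (x N) `<=` C'.
  move=> C'A; have /set_mem[N [c C'E]] := AD C' C'A; exists N.
  have : C' x by move: Cx; rewrite -AC => /(_ C' C'A).
  by rewrite /= C'E /= => <-.
elim: (A : seq _) hA => [|C0 s ih] hA.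
  by have [N _] := fin_index_top_ex; exists N => C'; rewrite in_nil.
have [|N hN] := ih; first by move=> C' C's; apply: hA; rewrite inE C's orbT.
have [M hM] := hA C0 (mem_head _ _).
have [K [KM KN]] := fin_index_meet_ex M N.
exists K => C'; rewrite inE => /orP[/eqP -> y yK|C's y yK].
  by apply: hM; exact: pf_coset_refine KM yK.
by apply: (hN C' C's); exact: pf_coset_refine KN yK.
Qed.

Lemma open_coset_cylinderE (O : set (profinite G)) :
  (forall x, O x -> exists N, coset_cylinder N (x N) `<=` O) -> open O.
Proof.
move=> h; rewrite openE => x Ox; have [N hN] := h x Ox.
rewrite /interior nbhsE; exists (coset_cylinder N (x N)) => //.
by split => //; exact: open_coset_cylinder.
Qed.

Lemma profinite_hausdorff : hausdorff_space (profinite G).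
Proof.
rewrite open_hausdorff => x y xy.
have [N xyN] : exists N, x N <> y N.
  apply: contrapT => /forallNP h; move/eqP: xy; apply; apply: profinite_eq => N.
  by apply: contrapT; exact: h.
exists (coset_cylinder N (x N), coset_cylinder N (y N)) => /=; first by split; apply/mem_set.
split; [exact: open_coset_cylinder|exact: open_coset_cylinder|].
apply/eqP/seteqP; split=> // z [/= zx zy]; apply: xyN.
by rewrite -[x N]zx -[y N]zy.
Qed.

(** Finitely many cylinders inside [O] cover [K]; a subgroup contained in all of theirs serves every
    point of [K] at once. *)
Lemma compact_coset_cylinder (K O : set (profinite G)) : compact K -> open O ->
  K `<=` O -> exists N, (\bigcup_(x in K) coset_cylinder N (x N)) `<=` O.
Proof.
move=> Kc Oo KO.
have /choice[n hn] : forall x, exists N, K x -> coset_cylinder N (x N) `<=` O.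
  move=> x; have [Kx|nKx] := pselect (K x).
    by have [N hN] := open_coset_cylinderP Oo (KO x Kx); exists N.
  by have [N _] := fin_index_top_ex; exists N => /nKx.
have /(_ (profinite G) K (fun x => coset_cylinder (n x) (x (n x)))) : cover_compact K
  by rewrite -compact_cover.
case=> [x Kx|x Kx|D' D'K KD']; first exact: open_coset_cylinder.
  by exists x.
have [N hN] : exists N : fin_index_normal G, forall x, x \in (D' : seq _) -> N `<=` n x.
  elim: (D' : seq _) => [|x s [N ih]].
    by have [N _] := fin_index_top_ex; exists N => x; rewrite in_nil.
  have [M [Mx MN]] := fin_index_meet_ex (n x) N; exists M => y.
  rewrite inE => /orP[/eqP ->//|ys]; apply: subset_trans MN _; exact: ih.
exists N => y [x Kx yx].
have [z /= zD' xz] := KD' x Kx.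
have /set_mem Kz := D'K z zD'.
apply: (hn z Kz); rewrite /coset_cylinder /= -xz.
exact: pf_coset_refine (hN z zD') yx.
Qed.



Lemma pf_coset_mul x y N :
  (x * y)%g N = [set (a * b)%g | a in x N & b in y N].
Proof. by []. Qed.

Lemma coset_cylinder_translation N (c : set G) g x :
  coset_cylinder N c (profinite_hom g * x)%g =
  coset_cylinder N [set (g^-1 * a)%g | a in c] x.
Proof.
have [b xb] := pf_cosetP x N.
rewrite /coset_cylinder /mkset pf_coset_mul xb lcoset_ofM; apply/propeqP; split.
  move=> <-; apply/seteqP; split=> [_ [n Nn <-]|_ [_ [n Nn <-] <-]].
    by exists (g * b * n)%g; [exists n|rewrite -!mulgA mulKg].
  by exists n; rewrite // -!mulgA mulKg.
move=> e; apply/seteqP; split=> [_ [n Nn <-]|a ca].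
  have : lcoset_of b N (b * n)%g by exists n.
  by rewrite e => -[a ca ab]; rewrite -mulgA -ab mulVKg.
have : lcoset_of b N (g^-1 * a)%g by rewrite e; exists a.
by case=> n Nn bn; exists n; rewrite // -mulgA bn mulVKg.
Qed.

Lemma open_translation g (O : set (profinite G)) : open O ->
  open [set x | O (profinite_hom g * x)%g].
Proof.
move=> Oo; apply: open_coset_cylinderE => x Ox.
have [N hN] := open_coset_cylinderP Oo Ox.
exists N => y yN; apply: hN; rewrite coset_cylinder_translation.
move: yN; rewrite /coset_cylinder /mkset pf_coset_mul => ->.
have [b ->] := pf_cosetP x N; rewrite lcoset_ofM.
apply/seteqP; split=> [_ [n Nn <-]|_ [_ [n Nn <-] <-]].
  by exists (g * b * n)%g; [exists n|rewrite -!mulgA mulKg].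
by exists n; rewrite // -!mulgA mulKg.
Qed.

Lemma measurable_open_profinite (O : set (profinite_borel G)) :
  open (O : set (profinite G)) -> measurable O.
Proof. by move=> Oo; exact: sub_sigma_algebra. Qed.

Lemma profinite_homM g k : profinite_hom (g * k)%g =
  (profinite_hom g * profinite_hom k)%g :> profinite G.
Proof. by apply: profinite_eq => N; rewrite pf_coset_mul /= lcoset_ofM. Qed.

Lemma measure_preserving_translation (R : realType)
    (h : probability (profinite_borel G) R) : normalized_haar h ->
  measure_preserving_action h (@profinite_translation G).
Proof.
move=> [hinv _].
have mt g : measurable_fun [set: profinite_borel G] (@profinite_translation G g).
  have hm := @measurability _ _ _ _ setT (@profinite_translation G g) (@open (profinite G)).
  apply: hm => // _ [U Uo <-]; rewrite setTI; apply: measurable_open_profinite.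
  exact: (open_translation g Uo).
split=> // [x|g k x|g A mA].
- exact: (mul1g (x : profinite G)).
- by rewrite /profinite_translation profinite_homM mulgA.
- rewrite -(hinv (profinite_hom g) (@profinite_translation G g @^-1` A)); last first.
    by rewrite -[X in measurable X]setTI; exact: mt.
  congr (h _); apply/seteqP; split=> [_ [y Ay <-] //|y Ay].
  exists ((profinite_hom g)^-1 * y)%g; last by rewrite mulVKg.
  by rewrite /= /profinite_translation mulVKg.
Qed.
End Profinite.

(** * Asymptotic independence for Haar measure *)

Section HaarIndependence.
Variables (R : realType) (G : groupType) (h : probability (profinite_borel G) R).
Hypothesis haar : normalized_haar h.
Let actP := measure_preserving_translation haar.

Lemma coset_union_asymp_indep (K : set (profinite G)) (N : fin_index_normal G) :
  asymp_indep h (@profinite_translation G)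
    (\bigcup_(x in K) coset_cylinder N (pf_coset x N) : set (profinite_borel G)).
Proof.
have /finite_seqP[s0 hs0] := @finN_index G N.
set s := undup s0.
have hs c : reflect (exists g, c = lcoset_of g N) (c \in s).
  rewrite mem_undup; apply: (iffP idP) => [cs|[g ->]].
    have : [set` s0] c by [].
    by rewrite -hs0 => -[g _ <-]; exists g.
  by have : [set` s0] (lcoset_of g N) by rewrite -hs0; exists g.
pose C (i : 'I_(size s)) : set (profinite_borel G) := coset_cylinder N (nth set0 s i).
have oC i : open (C i : set (profinite G)) by exact: open_coset_cylinder.
have Cp : measurable_partition C.
  split=> [i|i j _ _ [x [xi xj]]|].
  - exact: measurable_open_profinite (oC i).
  - apply/val_inj/eqP; rewrite -(nth_uniq set0 (ltn_ord i) (ltn_ord j) (undup_uniq s0)).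
    by rewrite -/s -xi -xj.
  - apply/seteqP; split=> // x _.
    have xs : pf_coset x N \in s by apply/hs; exact: pf_cosetP.
    have xi : (index (pf_coset x N) s < size s)%N by rewrite index_mem.
    by exists (Ordinal xi) => //; rewrite /C /coset_cylinder /= nth_index.
have trC i j : exists g, @profinite_translation G g @` C i = C j.
  have /hs[a ai] := mem_nth set0 (ltn_ord i).
  have /hs[b bj] := mem_nth set0 (ltn_ord j).
  exists (b * a^-1)%g; rewrite (act_image actP); apply/seteqP.
  have e : [set ((b * a^-1)^-1^-1 * u)%g | u in lcoset_of a N] = lcoset_of b N.
    apply/seteqP; rewrite invgK; split=> [_ [_ [n Nn <-] <-]|_ [n Nn <-]].
      by exists n; rewrite // !mulgA mulgVK.
    by exists (a * n)%g; [exists n|rewrite mulgA mulgVK].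
  by split=> x /=; rewrite /C /profinite_translation /= coset_cylinder_translation ai bj e.
pose J (i : 'I_(size s)) := `[< exists2 x, K x & pf_coset x N = nth set0 s i >].
have -> : \bigcup_(x in K) coset_cylinder N (pf_coset x N) = \bigcup_(i in [set i | J i]) C i.
  apply/seteqP; split=> y.
    move=> [x Kx yx].
    have xs : pf_coset x N \in s by apply/hs; exact: pf_cosetP.
    have xi : (index (pf_coset x N) s < size s)%N by rewrite index_mem.
    exists (Ordinal xi); first by apply/asboolP; exists x; rewrite //= nth_index.
    by rewrite /C /coset_cylinder /= nth_index.
  by move=> [i /asboolP[x Kx xi] yi]; exists x => //; rewrite /coset_cylinder /= xi.
exact (transitive_partition_indep actP J Cp trC).
Qed.

Lemma measurable_compact_profinite (K : set (profinite G)) : compact K ->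
  measurable (K : set (profinite_borel G)).
Proof.
move=> Kc; rewrite -[K]setCK; apply: measurableC; apply: measurable_open_profinite.
by apply: closed_openC; apply: compact_closed => //; exact: profinite_hausdorff.
Qed.

Lemma haar_compact_approx (E : set (profinite_borel G)) (eps : R) :
  measurable E -> 0 < eps -> exists K : set (profinite G),
    [/\ compact K, K `<=` E & pr h E - eps < pr h K].
Proof.
move=> mE e0; have hE := haar.2 E mE.
have Efin : ereal_sup [set h K | K in [set K : set (profinite G) | compact K /\ K `<=` E]]
    \is a fin_num by rewrite -hE prE.
have [_ [K [Kc KE] <-]] := ub_ereal_sup_adherent e0 Efin.
have mK := measurable_compact_profinite Kc.
rewrite -hE (prE h mE) (prE h mK) -EFinB lte_fin => lt.
by exists K.
Qed.

(** Inner regularity gives compact sets [K] inside [E] and [L] inside its complement. A union [U] of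
    cosets fits between [K] and the complement of [L], as [E] does, so [E] and [U] differ only
    outside [K] and [L], a set of measure less than [eps]. *)
Lemma haar_asymp_indep (E : set (profinite_borel G)) : measurable E ->
  asymp_indep h (@profinite_translation G) E.
Proof.
move=> mE; apply: asymp_indep_approx => // eps e0.
have e2 : 0 < eps / 2 by rewrite divr_gt0.
have [K [Kc KE hK]] := haar_compact_approx mE e2.
have [L [Lc LE hL]] := haar_compact_approx (measurableC mE) e2.
have oL : open (~` L).
  by apply: closed_openC; apply: compact_closed => //; exact: profinite_hausdorff.
have KL : K `<=` ~` L by move=> x /KE Ex /LE.
have [N hN] := compact_coset_cylinder Kc oL KL.
set U := \bigcup_(x in K) _ in hN.
have mU : measurable (U : set (profinite_borel G)).
  apply: measurable_open_profinite; apply: bigcup_open => x _; exact: open_coset_cylinder.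
exists U; split => //; first exact: coset_union_asymp_indep.
have mK := measurable_compact_profinite Kc; have mL := measurable_compact_profinite Lc.
have bK := bounded_mfun_indic R mK.
have bL := bounded_mfun_indic R mL.
have b1 := @bounded_mfun_cst _ (profinite_borel G) R 1.
apply: (@le_trans _ _ (Ex h (fun x => (1 - \1_L x) - \1_K x))).
  apply: Ex_le; [|by do 2![apply: bounded_mfunB => //]|].
    by apply: bounded_mfun_norm; apply: bounded_mfunB; exact: bounded_mfun_indic.
  move=> x; have KU : K x -> U x by move=> Kx; exists x.
  have := hN x; have := KE x; have := LE x.
  have ind (A : set (profinite_borel G)) : (A x /\ \1_A x = 1 :> R) \/ (~ A x /\ \1_A x = 0 :> R).
    rewrite indicE; have [Ax|nAx] := pselect (A x); [left|right].
      by rewrite mem_set.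
    by rewrite memNset.
  have [[aL ->]|[aL ->]] := ind L; have [[aK ->]|[aK ->]] := ind K;
    have [[aE ->]|[aE ->]] := ind E; have [[aU ->]|[aU ->]] := ind U => h1 h2 h3;
    rewrite ?subrr ?subr0 ?sub0r ?normrN ?normr0 ?normr1;
    by [|lra|case: (h1 aL)|case: aE; exact: h2|case: (h3 aU)|case: aU; exact: KU].
rewrite ExB //; last exact: bounded_mfunB.
rewrite ExB // Ex_cst !Ex_indic //.
by move: hL hK; rewrite prC //; lra.
Qed.
End HaarIndependence.

(** * A non-atomic standard space *)

Section UnitInterval.
Variable R : realType.
Local Notation Z := (measurableTypeR R).

Lemma standard_borel_R : standard_borel R Z.
Proof.
exists R, id; split.
- split; first exact: Rhausdorff.
  exists (range (ratr : rat -> R)); last exact: dense_rat.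
  exact: (sub_countable (card_image_le _ _) (countableP _)).
- by exists id.
- move=> A; rewrite image_id; split => [mA|].
    have : (@RGenOpens.G R).-sigma.-measurable A by rewrite -RGenOpens.measurableE.
    move: A {mA}; apply: smallest_sub; first exact: smallest_sigma_algebra.
    move=> _ [x [y ->]]; apply: sub_sigma_algebra; exact: interval_open.
  move: A; apply: smallest_sub; first exact: sigma_algebra_measurable.
  by move=> U Uo; exact: open_measurable.
Qed.

(** Truncating [A] at [k / (n + 1)], with [n.+1%:R^-1] below the measure of [A], adds at most that
    much per step. Hence the first truncation of positive measure has less than the measure of
    [A]. *)
Lemma non_atomic_uniform : non_atomic (uniform_prob (@ltr01 R)).
Proof.
move=> A mA A0; set P := uniform_prob _ in A0 *.
have uE (S : set Z) (mS : measurable S) : (pr P S)%:E = lebesgue_measure (S `&` `[0, 1]%classic).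
  by rewrite -prE //; exact: uniform_prob01.
have mB x : measurable (A `&` `]-oo, x]%classic) by apply: measurableI.
have pA : (0 < pr P A)%R by rewrite -lte_fin -prE.
have [n nA] : exists n : nat, n.+1%:R^-1 < pr P A.
  have [n _ hn] := near_infty_natSinv_lt (PosNum pA).
  by exists n; exact: hn n (leqnn n).
pose B k := A `&` `]-oo, k%:R / n.+1%:R]%classic.
have mBk k : measurable (B k) by exact: mB.
have B0 : pr P (B 0%N) = 0.
  apply: EFin_inj; rewrite uE // (_ : lebesgue_measure _ = 0%E) //.
  apply/eqP; rewrite -measure_le0; apply: le_trans (_ : lebesgue_measure [set (0 : R)%R] <= _)%E.
    have mI0 : measurable (B 0%N `&` `[0, 1]%classic) by exact: measurableI.
    apply: le_measure; [exact: mem_set|exact: mem_set|].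
    move=> x [[_]] /=; rewrite !in_itv /= mul0r => x0 /andP[x1 _].
    by apply/eqP; rewrite eq_le x0.
  by rewrite lebesgue_measure_set1.
have Bn : pr P (B n.+1) = pr P A.
  apply: EFin_inj; rewrite !uE // /B divff ?pnatr_eq0 //.
  congr (lebesgue_measure _); apply/seteqP; split=> x /=.
    by move=> [[]].
  by rewrite !in_itv /= => -[Ax /andP[h0 h1]]; rewrite h0 h1.
have BS k : pr P (B k.+1) <= pr P (B k) + n.+1%:R^-1.
  rewrite -lee_fin EFinD !uE //.
  set I1 := `[0, 1]%classic.
  have mBI j : measurable (B j `&` I1) by apply: measurableI; [exact: mBk|exact: measurable_itv].
  have mI : measurable (`[k%:R / n.+1%:R, k.+1%:R / n.+1%:R]%classic : set R) by [].
  apply: le_trans (_ : (lebesgue_measure (B k `&` I1) +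
      lebesgue_measure `[(k%:R / n.+1%:R : R)%R,
        (k.+1%:R / n.+1%:R : R)%R]%classic <= _)%E); last first.
    rewrite leeD2l // lebesgue_measure_itv /= lte_fin.
    rewrite ltr_pM2r ?invr_gt0 ?ltr0n // ltr_nat ltnSn -EFinB lee_fin -mulrBl.
    by rewrite -natrB // subSnn mul1r.
  apply: le_trans (measureU2 _ _ _); first last.
  - exact: mI.
  - exact: mBI.
  apply: le_measure; [apply: mem_set; exact: mBI|
    apply: mem_set; apply: measurableU => //; exact: mBI|].
  move=> x [[Ax xk] xI]; have [xk'|xk'] := leP x (k%:R / n.+1%:R); [left|right].
    by split=> //; split=> //=; rewrite in_itv.
  by rewrite /= in_itv /= (ltW xk') /=; move: xk; rewrite /= in_itv.
have ex : exists k, 0 < pr P (B k) by exists n.+1; rewrite Bn.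
case: (ex_minnP ex) => -[|k]; first by rewrite B0 ltxx.
move=> Bk0 Bmin; exists (B k.+1); split=> //; first by move=> x [].
have Bk : pr P (B k) = 0.
  apply/eqP; rewrite eq_le pr_ge0 andbT leNgt; apply/negP => /Bmin.
  by rewrite ltnn.
rewrite (prE P (mBk _)) (prE P mA) !lte_fin Bk0 /=.
by apply: le_lt_trans (BS k) _; rewrite Bk add0r.
Qed.

End UnitInterval.

(** * The equivalence *)

Section MDtoEMD.
Variables (R : realType) (G : groupType).
Hypothesis G_countable : countable [set: G].
Hypothesis G_not_T : ~ property_T R G.

Lemma property_MD_EMD : property_MD R G -> property_EMD R G.
Proof.
move=> MD h haar d X mu b sX bP k A Ap F0 /finite_seqP[F ->] eps e0.
have actP := measure_preserving_translation haar.
(* [property_MD] is universal over non-atomic standard spaces, so using it requires exhibiting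
   one. *)
pose Z := measurableTypeR R; pose eta := uniform_prob (@ltr01 R).
have wc := MD h haar _ Z eta (standard_borel_R R) (@non_atomic_uniform R).
have [kappa k0 AI] := almost_invariant_sets actP G_countable G_not_T wc.
have indep E : measurable E -> asymp_indep h (@profinite_translation G) E.
  exact: haar_asymp_indep.
have AI' Q delta : 0 < delta -> exists D,
    almost_invariant h (@profinite_translation G) Q delta D /\
    kappa <= pr h D * (1 - pr h D).
  by move=> /(AI Q)[D [mD kD hD]]; exists D.
have e2 : 0 < eps / 2 by rewrite divr_gt0.
have ma g S : measurable S -> measurable (b g @` S) by move=> mS; exact: (measurable_act_image bP).
have mb g (S : set (Z * profinite_borel G)) : measurable S -> measurable
    (product_action (@identity_action G Z) (@profinite_translation G) g @` S).
  move=> mS; exact: (measurable_product_act_image actP).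
have [B [Bp hB]] := weakly_contained_pr F ma mb (wc d X mu b sX bP) Ap e2.
pose V z g i j := pr h ((@profinite_translation G g @` xsection (B i) z) `&` xsection (B j) z).
have mV g i j : measurable ((product_action (@identity_action G Z)
    (@profinite_translation G) g @` B i) `&` B j).
  by case: Bp => mB _ _; apply: measurableI => //; exact: mb.
have VE g i j : (fun z => V z g i j) = fun z => pr h (xsection
    ((product_action (@identity_action G Z) (@profinite_translation G) g @` B i) `&` B j) z).
  by apply/funext => z; rewrite /V (xsection_act_image actP).
have aV z : achievable h (@profinite_translation G) F (V z).
  move=> e e_gt0; exists (fun i => xsection (B i) z); split.
    exact: measurable_partition_xsection.
  by move=> g gF i j; rewrite /V subrr normr0 ltW.
have bV g i j : g \in F -> bounded_mfun (fun z => V z g i j).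
  by move=> _; rewrite VE; exact: pr_xsection_bounded.
have [E [Ep hE]] := achievable_integral actP indep k0 AI' eta aV bV e2.
exists E; split=> // g gF i j.
have mA : measurable ((b g @` A i) `&` A j).
  by case: Ap => mA _ _; apply: measurableI => //; exact: ma.
have mE : measurable ((@profinite_translation G g @` E i) `&` E j).
  case: Ep => mE _ _; apply: measurableI => //.
  exact: (measurable_act_image actP).
rewrite (prE mu mA) (prE h mE) -EFinB abse_EFin lte_fin.
have := hE g gF i j; have := hB g gF i j.
rewrite VE -pr_product //.
rewrite !ltr_norml !ler_norml.
set p := pr _ _; set q := pr _ _; set r := pr _ _.
move=> /andP[a1 a2] /andP[b1 b2]; apply/andP; split; lra.
Qed.

Lemma property_EMD_MD : property_EMD R G -> property_MD R G.
Proof.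
move=> EMD h haar dZ Z eta sZ aZ d X mu b sX bP k A Ap F Ff eps e0.
have actP := measure_preserving_translation haar.
have [B [[mB tB cB] hB]] := EMD h haar d X mu b sX bP k A Ap F Ff eps e0.
have mZB (S : set (profinite_borel G)) : measurable S ->
  (eta \x h)%E ([set: Z] `*` S) = h S.
  move=> mS; rewrite product_measure1E // [X in (X * _)%E](_ : _ = 1%E) ?mul1e //.
  exact: probability_setT.
exists (fun i => [set: Z] `*` B i); split.
  split=> [i|i j _ _ [[z y] [[_ /= yi] [_ /= yj]]]|].
  - exact: measurableX.
  - by apply: (tB i j) => //; exists y.
  - apply/seteqP; split=> // -[z y] _.
    by have : [set: profinite_borel G] y by []; rewrite -cB => -[i _ yi]; exists i.
move=> g Fg i j.
rewrite (_ : _ `&` _ = [set: Z] `*` ((@profinite_translation G g @` B i) `&` B j)).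
  have := hB g Fg i j; rewrite -mZB //.
  by apply: measurableI => //; exact: (measurable_act_image actP).
apply/seteqP; split=> [[z y] [[[z' y'] [_ /= y'i] [_ <-]] [_ /= yj]]|].
  by split=> //; split=> //; exists y'.
move=> [z y] [_ /= [[y' y'i <-] yj]]; split=> //.
by exists (z, y').
Qed.
End MDtoEMD.

Theorem corollary4p7 (R : realType) (G : groupType)
    (G_countable : countable [set: G]) (G_infinite : infinite_set [set: G])
    (G_not_T : ~ property_T R G) :
  property_EMD R G <-> property_MD R G.
Proof.
by split; [exact: property_EMD_MD|exact: property_MD_EMD].
Qed.
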